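(* Let $0<\alpha<1$, $\beta>0$, $\nu,z\in\mathbb{C}$, $0\le|\arg(z)|<(1-\alpha)\pi/2$. Then the function $K_{\alpha+\beta,\nu}(z)$ has the double integral representation $$K_{\alpha+\beta,\nu}(z)=\frac{1}{\sqrt\pi}\int_{-\infty}^\infty\int_0^\infty\frac{P^{1/2}_{-1/2+i\tau}(2x+1)}{(x(x+1))^{1/4}}\,K_{\alpha,\nu+2i\tau}\left(z(x+1)^{\beta/2}\right)dx\,d\tau .$$
   Context: For $\alpha>0$, $\nu\in\mathbb{C}$ and ${\rm Re}(z)>0$, $$K_{\alpha,\nu}(z)=\int_0^\infty e^{-z\cosh^\alpha u}\cosh(\nu u)\,du .$$ $P^\mu_\lambda(t)$, $t>1$, is the associated Legendre function of the first kind, $$P^\mu_\lambda(t)=\frac{1}{\Gamma(1-\mu)}\left(\frac{t+1}{t-1}\right)^{\mu/2}{}_2F_1\left(-\lambda,\lambda+1;1-\mu;\frac{1-t}{2}\right)$$ (analytically continued in $t$ along $(1,\infty)$). Here $z\neq0$ and $\arg$ is the principal argument. *)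

(* Defs.v *)
(* MathComp-Analysis; complex numbers are R[i] over R : realType. *)
From HB Require Import structures.
From mathcomp Require Import all_boot all_order all_algebra.
From mathcomp Require Import all_classical all_reals all_analysis.

Set Implicit Arguments.
Unset Strict Implicit.
Unset Printing Implicit Defensive.

Import Order.TTheory GRing.Theory Num.Theory.
Import numFieldNormedType.Exports.
(* Last, so that Re and Im are the real-valued projections of R[i]. *)
From mathcomp Require Import complex.

Local Open Scope classical_set_scope.
Local Open Scope ring_scope.
Local Open Scope complex_scope.

Section ComplexFunctions.
Context {R : realType}.
Implicit Types (z w : R[i]) (x r : R).

Definition cexp z : R[i] :=
  (expR (Re z) * cos (Im z)) +i* (expR (Re z) * sin (Im z)).

Definition ccosh z : R[i] := (cexp z + cexp (- z)) / 2%:R.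

Definition rcosh x : R := (expR x + expR (- x)) / 2%:R.

(* Principal power r ^ w; only meaningful for r > 0. *)
Definition cpow r w : R[i] := cexp (w * (ln r)%:C).

(* Principal argument, with values in ]-pi, pi]; only meaningful for z != 0. *)
Definition carg z : R :=
  let theta := acos (Re z / ComplexField.Normc.normc z) in
  if 0 <= Im z then theta else - theta.

End ComplexFunctions.

Section ComplexIntegral.
Context {R : realType}.
Local Notation mu := (@lebesgue_measure R).

Definition cintegrable (D : set R) (f : R -> R[i]) : Prop :=
  mu.-integrable D (fun x => (Re (f x))%:E) /\
  mu.-integrable D (fun x => (Im (f x))%:E).

Definition cintegral (D : set R) (f : R -> R[i]) : R[i] :=
  (\int[mu]_(x in D) Re (f x))%R +i* (\int[mu]_(x in D) Im (f x))%R.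

End ComplexIntegral.

Section SpecialFunctions.
Context {R : realType}.

(* K_{alpha,nu}(z), for alpha > 0 and Re z > 0. *)
Definition genK (alpha : R) (nu z : R[i]) : R[i] :=
  cintegral `]0, +oo[
    (fun u => cexp (- (z * (rcosh u `^ alpha)%:C)) * ccosh (nu * u%:C)).

(* Euler's integral, hence Gamma only for Re z > 0. *)
Definition cGamma (z : R[i]) : R[i] :=
  cintegral `]0, +oo[ (fun t => cpow t (z - 1) * (expR (- t))%:C).

Definition pochhammer (a : R[i]) (n : nat) : R[i] :=
  \prod_(0 <= k < n) (a + k%:R).

Definition hyp2F1_coef (a b c : R[i]) (n : nat) : R[i] :=
  pochhammer a n * pochhammer b n / (pochhammer c n * (n`!)%:R).

(* [R[i]^o] carries the topology given by the complex modulus. *)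
Definition csum_to (u : nat -> R[i]) (s : R[i]) : Prop :=
  series (u : nat -> R[i]^o) n @[n --> \oo] --> (s : R[i]^o).

(* Gauss series; only meaningful where it converges, in particular for
   `|w| < 1 and c not a nonpositive integer. *)
Definition hyp2F1 (a b c w : R[i]) : R[i] :=
  lim (series (fun n => hyp2F1_coef a b c n * w ^+ n : R[i]^o) n @[n --> \oo]).

(* Analytic functions of a real variable, on an open set D. *)
Definition analytic_on (D : set R) (f : R -> R[i]) : Prop :=
  forall t0, D t0 -> exists2 r : R, 0 < r & exists a : nat -> R[i],
    forall t, `|t - t0| < r ->
      csum_to (fun n => a n * ((t - t0)%:C) ^+ n) (f t).

(* The hypergeometric expression of P^mu_lambda(t), for Re mu < 1. Its Gauss
   series, of argument (1 - t) / 2, converges for 1 < t < 3. *)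
Definition legendreP_series (mu lambda : R[i]) (t : R) : R[i] :=
  (cGamma (1 - mu))^-1 * cpow ((t + 1) / (t - 1)) (mu / 2%:R) *
  hyp2F1 (- lambda) (lambda + 1) (1 - mu) ((1 - t) / 2%:R)%:C.

Definition is_legendreP (mu lambda : R[i]) (P : R -> R[i]) : Prop :=
  analytic_on `]1, +oo[ P /\
  forall t, 1 < t < 3%:R -> P t = legendreP_series mu lambda t.

(* The analytic continuation to ]1, +oo[ of the expression above; its values
   at t <= 1 are irrelevant. *)
Definition legendreP (mu lambda : R[i]) : R -> R[i] :=
  xget (fun=> 0) [set P | is_legendreP mu lambda P].

End SpecialFunctions.

(* Main.v *)
(** For x > 0 put s(x) = arsinh (sqrt x). The Legendre function is elementary:
    P^(1/2)_(-1/2+i tau)(2x+1) = pi^(-1/2) (x(x+1))^(-1/4) cos(2 tau s(x)).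
    With a = Re z and b = Im z, the real and imaginary parts of the integrand are
    combinations of integrals over u of
      cos(2 tau s(x)) (x(x+1))^(-1/2) exp(k1 u - a C Q) cos(k2 u +- 2 tau u - b C Q - phi),
    where C = cosh(u)^alpha and Q = (x+1)^(beta/2) = cosh(s(x))^beta. The
    substitution s = s(x) turns the integral over x into a cosine transform of
    the oscillating function exp(-a C cosh(s)^beta) cos(psi - b C cosh(s)^beta),
    which decays like 1/(1+tau^2) by two integrations by parts, uniformly enough in u
    for Fubini; cosine inversion in tau then puts s = u, and C Q becomes cosh(u)^(alpha+beta).

    The closed form of P is obtained from first order linear systems having a positive
    definite quadratic invariant, so that a power series solution with the right initial
    value must be the elementary one: once at each point of ]0, +oo[ for analyticity,
    and once on ]0, 1[ for the Gauss series. *)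

Require Import Defs.
From HB Require Import structures.
From mathcomp Require Import all_boot all_order all_algebra.
From mathcomp Require Import all_classical all_reals all_analysis.
From mathcomp Require Import measurable_realfun ring lra.

Import Order.TTheory GRing.Theory Num.Theory.
Import numFieldNormedType.Exports.
From mathcomp Require Import complex.

Set Implicit Arguments.
Unset Strict Implicit.
Unset Printing Implicit Defensive.

Local Open Scope classical_set_scope.
Local Open Scope ring_scope.
Local Open Scope complex_scope.

(** * Dominated integrals and Fubini *)

(** The integrand has no decay in tau of its own, so tau cannot be exchanged with x and u by
    absolute convergence. At fixed tau only x and u are exchanged; once x is integrated out, the
    remaining function of (tau, u) has a majorant H(u) / (1 + tau^2), which permits the second
    exchange. The point is uniformity in u. The oscillating function has parameters A = aC and B =
    bC with C unbounded, but |B| is at most (|b| / a) A, and every power of A cosh(s)^beta created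
    by differentiation is absorbed by half of the exponential. The phase +-2 tau u splits the result
    into a cosine term, even in tau, and a sine term, odd in tau, which cancels over the line.
    Inversion is done by Abel summation with the Poisson kernel; it asks only for the decay in tau
    and a Lipschitz bound at u. [legendreP] is a chosen analytic continuation, so its closed form
    needs both existence (the elementary function is analytic and agrees with the Gauss series on
    ]1, 3[) and uniqueness (an identity theorem on ]1, +oo[). *)

Section DominatedIntegrals.
Context {R : realType} d {T : measurableType d} (m : {measure set T -> \bar R}) (D : set T).
Hypothesis mD : measurable D.

Lemma integrable_dominated (f h : T -> R) : measurable_fun D f -> m.-integrable D (EFin \o h) ->
  (forall x, D x -> `|f x| <= h x) -> m.-integrable D (EFin \o f).
Proof.
move=> mf ih fh.
apply: (le_integrable mD _ _ ih); first exact/measurable_EFinP.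
by move=> x Dx /=; rewrite lee_fin (le_trans (fh _ Dx))// ler_norm.
Qed.

Lemma normr_Rintegral_le (f h : T -> R) : measurable_fun D f -> m.-integrable D (EFin \o h) ->
  (forall x, D x -> `|f x| <= h x) -> `|\int[m]_(x in D) f x| <= \int[m]_(x in D) h x.
Proof.
move=> mf ih fh; have if' := integrable_dominated mf ih fh.
apply: (le_trans (le_normr_Rintegral mD if')).
apply: le_Rintegral => //.
exact: (integrable_norm if').
Qed.

Lemma integrable_scale (k : R) (f : T -> R) : m.-integrable D (EFin \o f) ->
  m.-integrable D (EFin \o (fun x => k * f x)).
Proof. exact: integrableZl. Qed.

Lemma integrable_add (f g : T -> R) : m.-integrable D (EFin \o f) -> m.-integrable D (EFin \o g) ->
  m.-integrable D (EFin \o (fun x => f x + g x)).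
Proof. exact: integrableD. Qed.

Lemma integrable_sub (f g : T -> R) : m.-integrable D (EFin \o f) -> m.-integrable D (EFin \o g) ->
  m.-integrable D (EFin \o (fun x => f x - g x)).
Proof. exact: integrableB. Qed.

Lemma Rintegral_dominated_cvg (f_ : nat -> T -> R) (f g : T -> R) :
  (forall n, measurable_fun D (f_ n)) -> measurable_fun D f ->
  (forall x, D x -> f_ n x @[n --> \oo] --> f x) ->
  m.-integrable D (EFin \o g) -> (forall n x, D x -> `|f_ n x| <= g x) ->
  \int[m]_(x in D) f_ n x @[n --> \oo] --> \int[m]_(x in D) f x.
Proof.
move=> mf_ mf cf ig fg.
have [|||||i1 _ i2] := @dominated_convergence _ _ R m D mD (fun n => EFin \o f_ n) (EFin \o f) (EFin \o g).
- by move=> n; exact/measurable_EFinP.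
- exact/measurable_EFinP.
- apply: aeW => x Dx; apply: cvg_EFin; first exact: nearW.
  exact: cf.
- exact: ig.
- by apply: aeW => x n Dx; rewrite lee_fin; exact: fg.
by apply: fine_cvg; rewrite fineK// integrable_fin_num.
Qed.

End DominatedIntegrals.

Section Fubini.
Local Open Scope ereal_scope.
Context {R : realType} d1 d2 {T1 : measurableType d1} {T2 : measurableType d2}.
Variables (m1 : {sigma_finite_measure set T1 -> \bar R}) (m2 : {sigma_finite_measure set T2 -> \bar R}).
Variables (D1 : set T1) (D2 : set T2).
Hypotheses (mD1 : measurable D1) (mD2 : measurable D2).

(** No integrability is assumed: the integral is by definition the [fine] part of a difference of
    integrals of positive and negative parts, each measurable by Tonelli, and the conventions for
    infinite values are the same on both sides. *)
Lemma measurable_Rintegral (f : T1 * T2 -> R) : measurable_fun setT f ->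
  measurable_fun setT (fun x => (\int[m2]_(y in D2) f (x, y))%R).
Proof.
move=> mf.
pose F (z : T1 * T2) := (f z * \1_D2 z.2)%R.
have mF : measurable_fun setT F.
  by apply: measurable_funM => //; apply: measurableT_comp => //; exact: measurable_indic.
have -> : (fun x => (\int[m2]_(y in D2) f (x, y))%R) =
   (fun x => fine (fubini_F m2 (EFin \o F)^\+ x - fubini_F m2 (EFin \o F)^\- x)).
  apply/funext => x; rewrite /Rintegral; congr fine.
  rewrite integral_mkcond /fubini_F integralE; congr (_ - _); apply: eq_integral => y _;
   by rewrite ?funeposE ?funenegE /= patchE /F/= indicE; case: ifPn => _; rewrite /= ?mulr1 ?mulr0.
apply: measurableT_comp; first exact: fine_measurable.
apply: emeasurable_funB; apply: measurable_fun_fubini_tonelli_F => //.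
- by apply: measurable_funepos; exact/measurable_EFinP.
- by apply: measurable_funeneg; exact/measurable_EFinP.
Qed.

Lemma Rintegral_fubini (f : T1 * T2 -> R) (h1 : T1 -> R) (h2 : T2 -> R) : measurable_fun setT f ->
  m1.-integrable D1 (EFin \o h1) -> m2.-integrable D2 (EFin \o h2) ->
  (forall x y, D1 x -> D2 y -> (`|f (x, y)| <= h1 x * h2 y)%R) ->
  [/\ forall x, D1 x -> m2.-integrable D2 (EFin \o (fun y => f (x, y))),
      m1.-integrable D1 (EFin \o (fun x => \int[m2]_(y in D2) f (x, y))%R) &
     (\int[m1]_(x in D1) \int[m2]_(y in D2) f (x, y) = \int[m2]_(y in D2) \int[m1]_(x in D1) f (x, y))%R].
Proof.
move=> mf ih1 ih2 fh.
have mf1 x : measurable_fun setT (fun y => f (x, y)) by exact: measurableT_comp.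
have mf2 y : measurable_fun setT (fun x => f (x, y)) by exact: measurableT_comp.
have i2 x : D1 x -> m2.-integrable D2 (EFin \o (fun y => f (x, y))).
  move=> Dx; apply: (integrable_dominated _ _ (integrable_scale mD2 (h1 x) ih2)) => //.
    exact: measurable_funTS.
  by move=> y Dy /=; exact: fh.
have i1 y : D2 y -> m1.-integrable D1 (EFin \o (fun x => f (x, y))).
  move=> Dy; apply: (integrable_dominated _ _ (integrable_scale mD1 (h2 y) ih1)) => //.
    exact: measurable_funTS.
  by move=> x Dx /=; rewrite mulrC; exact: fh.
have b x : D1 x -> (\int[m2]_(y in D2) `|f (x, y)| <= h1 x * \int[m2]_(y in D2) h2 y)%R.
  move=> Dx; rewrite -RintegralZl//; apply: le_Rintegral => //.
  - exact: integrable_norm (i2 _ Dx).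
  - exact: integrable_scale.
  - by move=> y Dy; exact: fh.
have mnf : measurable_fun setT (fun z => `|f z|%R) by exact: measurableT_comp.
have ih1' : m1.-integrable D1 (EFin \o (fun x => (h1 x * \int[m2]_(y in D2) h2 y)%R)).
  under eq_fun do rewrite mulrC.
  exact: integrable_scale.
split.
- exact: i2.
- apply: (integrable_dominated _ _ ih1') => //.
    by apply: measurable_funTS; exact: measurable_Rintegral.
  by move=> x Dx; apply: le_trans (b _ Dx); exact: le_normr_Rintegral (i2 _ Dx).
(* Extension by zero: with both indicators in the integrand, the theorem for the product measure
   applies on the full spaces, and only iterated integrals have to be cut back to [D1] and [D2]. *)
pose F (z : T1 * T2) := (f z * \1_D2 z.2 * \1_D1 z.1)%R.
have mF : measurable_fun setT F.
  apply: measurable_funM; last by apply: measurableT_comp => //; exact: measurable_indic.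
  by apply: measurable_funM => //; apply: measurableT_comp => //; exact: measurable_indic.
have mkF (k : T1 * T2 -> R) x y : (k (x, y) * \1_D2 y * \1_D1 x)%R =
    (if x \in D1 then if y \in D2 then k (x, y) else 0 else 0)%R.
  by rewrite !indicE; case: (x \in D1); case: (y \in D2); rewrite ?(mulr0, mulr1, mul0r).
have it12 (k : T1 * T2 -> R) : (forall x, D1 x -> m2.-integrable D2 (EFin \o (fun y => k (x, y)))) ->
    \int[m1]_(x in D1) (\int[m2]_(y in D2) k (x, y))%:E =
    \int[m1]_x \int[m2]_y (k (x, y) * \1_D2 y * \1_D1 x)%:E.
  move=> ik; rewrite integral_mkcond; apply: eq_integral => x _; rewrite patchE.
  under [RHS]eq_integral do rewrite mkF.
  case: ifPn => xD; last by rewrite integral0.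
  rewrite /Rintegral fineK ?integrable_fin_num//; last by apply: ik; exact: set_mem.
  rewrite integral_mkcond; apply: eq_integral => y _; rewrite patchE.
  by case: ifPn.
have it21 : \int[m2]_(y in D2) (\int[m1]_(x in D1) f (x, y))%:E =
    \int[m2]_y \int[m1]_x (EFin \o F) (x, y).
  rewrite integral_mkcond; apply: eq_integral => y _; rewrite patchE /F/=.
  under [RHS]eq_integral do rewrite mkF.
  case: ifPn => yD; last by apply/esym/integral0_eq => x _; case: ifPn.
  rewrite /Rintegral fineK ?integrable_fin_num//; last by apply: i1; exact: set_mem.
  rewrite integral_mkcond; apply: eq_integral => x _; rewrite patchE.
  by case: ifPn.
have iF : (m1 \x m2).-integrable setT (EFin \o F).
  apply/integrable12ltyP; first exact/measurable_EFinP.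
  rewrite [X in X < _](_ : _ = \int[m1]_(x in D1) (\int[m2]_(y in D2) `|f (x, y)|)%:E); last first.
    rewrite (it12 (fun z => `|f z|%R)); last by move=> x Dx; exact: integrable_norm (i2 _ Dx).
    apply: eq_integral => x _; apply: eq_integral => y _.
    by rewrite /F /= !normrM !(ger0_norm (_ : 0 <= \1__ _)%R).
  apply: (@le_lt_trans _ _ (\int[m1]_(x in D1) (h1 x * \int[m2]_(y in D2) h2 y)%:E)).
    apply: ge0_le_integral => //.
    - by move=> x _; rewrite lee_fin; apply: Rintegral_ge0.
    - by apply/measurable_EFinP/measurable_funTS; exact: measurable_Rintegral mnf.
    - exact: measurable_int ih1'.
  by have := integrable_fin_num mD1 ih1'; rewrite fin_numElt => /andP[].
rewrite /Rintegral; congr fine.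
transitivity (\int[m1]_x \int[m2]_y (EFin \o F) (x, y)); first by rewrite -it12.
by rewrite (Fubini iF) -it21.
Qed.

End Fubini.

(** * The cosine transform and its inversion *)

Section CosTransform.
Context {R : realType}.
Local Notation mu := (@lebesgue_measure R).

Lemma cvg_expRNM (c : R) : 0 < c -> expR (- (c * x)) @[x --> +oo] --> (0 : R).
Proof.
move=> c0.
apply: (@cvg_comp _ _ _ (fun x : R => c * x) (fun x => expR (- x))); last exact: cvgr_expR.
exact: (gt0_cvgMry c0 cvg_id).
Qed.

Lemma cvg_mul_expRNM (k c : R) : 0 < c -> k * expR (- (c * x)) @[x --> +oo] --> (0 : R).
Proof.
move=> c0; rewrite -[X in _ --> X](mulr0 k).
apply: cvgM; [exact: cvg_cst|exact: cvg_expRNM].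
Qed.

Lemma is_derive_continuous (f df : R -> R) : (forall x : R, is_derive x (1:R) f (df x)) -> continuous f.
Proof. by move=> fd x; apply/differentiable_continuous/derivable1_diffP; case: (fd x). Qed.

Lemma integral_derivative_ge0 (f F : R -> R) (l : R) : continuous f ->
  (forall x : R, is_derive x (1:R) F (f x)) -> (forall x, 0 <= x -> 0 <= f x) ->
  F x @[x --> +oo] --> l ->
  mu.-integrable `]0, +oo[ (EFin \o f) /\ \int[mu]_(x in `]0, +oo[) f x = l - F 0.
Proof.
move=> cf dF f0 Fl.
have E : (\int[mu]_(x in `[0%R, +oo[) (f x)%:E = l%:E - (F 0)%:E)%E.
  apply: (@ge0_continuous_FTC2y R f F) => //.
  - exact: continuous_subspaceT.
  - by apply: cvg_at_right_filter; exact: (is_derive_continuous dF).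
  - by move=> x _; rewrite derive1E; case: (dF x).
have mf (D : set R) : measurable_fun D f.
  by apply: measurable_funTS; exact: continuous_measurable_fun.
have E' : (\int[mu]_(x in `]0%R, +oo[) (f x)%:E = l%:E - (F 0)%:E)%E.
  by rewrite integral_itv_obnd_cbnd//; exact/measurable_EFinP.
split; last by rewrite /Rintegral E'.
apply/integrableP; split; first by apply/measurable_EFinP; exact: mf.
rewrite [X in (X < _)%E](_ : _ = (l%:E - (F 0)%:E)%E) ?ltry// -E'.
by apply: eq_integral => x; rewrite inE/= in_itv/= andbT => x0; rewrite ger0_norm// f0// ltW.
Qed.

Lemma integrable_expRNM (c : R) : 0 < c -> mu.-integrable `]0, +oo[ (EFin \o (fun x => expR (- (c * x)))).
Proof.
move=> c0.
have [] // := @integral_derivative_ge0 (fun x => expR (- (c * x))) (fun x => - c^-1 * expR (- (c * x))) 0.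
- apply: (@is_derive_continuous _ (fun x => - c * expR (- (c * x)))) => x.
  apply: is_derive_eq; rewrite /GRing.scale/=; ring.
- move=> x; apply: is_derive_eq; rewrite /GRing.scale/=; field.
  by rewrite gt_eqF.
- exact: cvg_mul_expRNM.
Qed.

(** A signed integrand becomes nonnegative once its exponential majorant is added. The majorant has
    an explicit primitive, so the nonnegative case applies to it and to the sum, and the difference
    gives the claim. *)
Lemma integral_derivative_expRN (f F : R -> R) (C c l : R) : 0 < c -> continuous f ->
  (forall x : R, is_derive x (1:R) F (f x)) ->
  (forall x, 0 <= x -> `|f x| <= C * expR (- (c * x))) ->
  F x @[x --> +oo] --> l ->
  mu.-integrable `]0, +oo[ (EFin \o f) /\ \int[mu]_(x in `]0, +oo[) f x = l - F 0.
Proof.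
move=> c0 cf dF fC Fl.
pose g x := C * expR (- (c * x)); pose G x := - (C / c) * expR (- (c * x)).
have dg (x:R) : is_derive x (1:R) g (- c * g x).
  by apply: is_derive_eq; rewrite /g/GRing.scale/=; ring.
have cg := is_derive_continuous dg.
have dG (x:R) : is_derive x (1:R) G (g x).
  by apply: is_derive_eq; rewrite /g/GRing.scale/=; field; rewrite gt_eqF.
have G0 : G x @[x --> +oo] --> (0:R).
  exact: cvg_mul_expRNM.
have C0 x : 0 <= x -> 0 <= g x by move=> x0; apply: le_trans (fC _ x0).
have [ig gE] := integral_derivative_ge0 cg dG C0 G0.
have [|||ifg fgE] := @integral_derivative_ge0 (fun x => f x + g x) (fun x => F x + G x) (l + 0).
- by move=> x; apply: cvgD; [exact: cf|exact: cg].
- move=> x x0; have := fC _ x0; rewrite ler_norml => /andP[+ _]; rewrite /g; lra.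
- exact: cvgD.
have fE : f = (fun x => (f x + g x) - g x) by apply/funext => x; rewrite addrK.
have ifE : mu.-integrable `]0, +oo[ (EFin \o f).
  rewrite fE; exact: (integrableB _ ifg ig).
split => //.
rewrite fE RintegralB// fgE gE; ring.
Qed.

Lemma cvg0_expRNM_le (F : R -> R) (K c : R) : 0 < c ->
  (forall x, 0 <= x -> `|F x| <= K * expR (- (c * x))) -> F x @[x --> +oo] --> (0 : R).
Proof.
move=> c0 FK; apply/norm_cvg0P.
apply: (@squeeze_cvgr _ _ _ _ (cst 0) (fun x => K * expR (- (c * x)))).
- near=> x; rewrite normr_ge0/=; apply: FK.
  by near: x; apply: nbhs_pinfty_ge; exact: num_real.
- exact: cvg_cst.
- exact: cvg_mul_expRNM.
Unshelve. all: by end_near. Qed.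

(* As e tends to 0, poisson e concentrates at 0 with mass pi / 2 on each side. *)
Definition poisson (e v : R) := e / (e ^+ 2 + v ^+ 2).

Lemma integral_expRNM_cos (e c : R) : 0 < e ->
  mu.-integrable `]0, +oo[ (EFin \o (fun t => expR (- (e * t)) * cos (c * t))) /\
  \int[mu]_(t in `]0, +oo[) (expR (- (e * t)) * cos (c * t)) = poisson e c.
Proof.
move=> e0.
have d0 : e ^+ 2 + c ^+ 2 != 0 by rewrite gt_eqF// ltr_wpDr ?sqr_ge0 ?exprn_gt0.
pose F t := expR (- (e * t)) * (c * sin (c * t) - e * cos (c * t)) / (e ^+ 2 + c ^+ 2).
have [||||i iE] := @integral_derivative_expRN (fun t => expR (- (e * t)) * cos (c * t)) F 1 e 0 e0.
- apply: (@is_derive_continuous _ (fun t => expR (- (e * t)) * (- e * cos (c * t) - c * sin (c * t)))) => x.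
  apply: is_derive_eq; rewrite /GRing.scale/=; ring.
- move=> x; apply: is_derive_eq; rewrite /GRing.scale/=; by field.
- by move=> x x0; rewrite normrM gtr0_norm ?expR_gt0// mul1r ler_piMr ?expR_ge0// cos_max.
- apply: (@cvg0_expRNM_le _ ((`|c| + e) / (e ^+ 2 + c ^+ 2)) e e0) => x x0.
  rewrite normrM normfV normrM gtr0_norm ?expR_gt0// mulrAC [leRHS]mulrC -mulrA.
  rewrite ler_wpM2l ?expR_ge0// [`|_ ^+ _ + _|]ger0_norm ?addr_ge0 ?sqr_ge0//.
  rewrite [leLHS]mulrC ler_wpM2r ?invr_ge0 ?addr_ge0 ?sqr_ge0//.
  rewrite (le_trans (ler_normB _ _))// !normrM lerD//; first by rewrite ler_piMr// sin_max.
  by rewrite [`|e|]gtr0_norm// ler_piMr ?cos_max// ltW.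
split => //; rewrite iE /F /poisson mulr0 oppr0 expR0 !mulr0 sin0 cos0; by field.
Qed.

(** The factor 2 is the one in the phase 2 tau s of the Legendre function. *)
Definition cos_transform (g : R -> R) (t : R) := \int[mu]_(s in `]0, +oo[) (cos (2 * t * s) * g s).

(* Two integrations by parts; the boundary terms vanish because g1 0 = 0. *)
Lemma cos_transform_le (g g1 g2 h : R -> R) (C c t : R) : 0 < c ->
  (forall x : R, is_derive x (1:R) g (g1 x)) ->
  (forall x : R, is_derive x (1:R) g1 (g2 x)) ->
  continuous g2 -> g1 0 = 0 ->
  (forall x, 0 <= x -> `|g x| <= C * expR (- (c * x))) ->
  (forall x, 0 <= x -> `|g1 x| <= C * expR (- (c * x))) ->
  (forall x, 0 <= x -> `|g2 x| <= C * expR (- (c * x))) ->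
  mu.-integrable `]0, +oo[ (EFin \o h) ->
  (forall x, 0 < x -> `|g x| + `|g2 x| <= h x) ->
  (1 + 4 * t ^+ 2) * `|cos_transform g t| <= \int[mu]_(x in `]0, +oo[) h x.
Proof.
move=> c0 dg dg1 cg2 g10 gC g1C g2C ih gh.
have cg := is_derive_continuous dg; have cg1 := is_derive_continuous dg1.
(* [f] is the derivative of [F], which performs both integrations by parts at once: [F] tends to 0
   at infinity and [F 0] equals [g1 0], so the integral of [f] is 0. *)
pose f s := cos (2 * t * s) * (4 * t ^+ 2 * g s + g2 s).
pose F s := 2 * t * sin (2 * t * s) * g s + cos (2 * t * s) * g1 s.
have dct (s : R) : is_derive s (1:R) (fun s : R => cos (2 * t * s)) (- (2 * t) * sin (2 * t * s)).
  by apply: is_derive_eq; rewrite /GRing.scale/=; ring.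
have cct := is_derive_continuous dct.
have C0 : 0 <= C.
  by move: (le_trans (normr_ge0 _) (gC 0 (lexx _))); rewrite mulr0 oppr0 expR0 mulr1.
have [||||i0 iE] := @integral_derivative_expRN f F ((4 * t ^+ 2) * C + C) c 0 c0.
- by move=> x; apply: cvgM; [exact: cct|apply: cvgD; [apply: cvgM; [exact: cvg_cst|exact: cg]|exact: cg2]].
- by move=> x; apply: is_derive_eq; rewrite /f /GRing.scale/=; ring.
- move=> x x0; rewrite /f normrM (le_trans (ler_piMl _ (cos_max _)))//.
  rewrite (le_trans (ler_normD _ _))// [leRHS]mulrDl; apply: lerD; last exact: g2C.
  have t0 : 0 <= 4 * t ^+ 2 by rewrite mulr_ge0// sqr_ge0.
  by rewrite normrM (ger0_norm t0) -[leRHS]mulrA ler_wpM2l// gC.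
- apply: (@cvg0_expRNM_le _ (`|2 * t| * C + C) c c0) => x x0.
  rewrite /F (le_trans (ler_normD _ _))// [leRHS]mulrDl lerD//.
    rewrite !normrM -!mulrA ler_wpM2l// ler_wpM2l// (le_trans (ler_piMl _ (sin_max _)))//.
    exact: gC.
  by rewrite normrM (le_trans (ler_piMl _ (cos_max _)))// g1C.
have cvgb (k : R -> R) : continuous k -> (forall x, 0 <= x -> `|k x| <= C * expR (- (c * x))) ->
   mu.-integrable `]0, +oo[ (EFin \o (fun s => cos (2 * t * s) * k s)).
  move=> ck kC.
  have ie : mu.-integrable `]0, +oo[ (EFin \o (fun x => C * expR (- (c * x)))).
    exact: integrable_scale (integrable_expRNM c0).
  apply: (integrable_dominated _ _ ie) => //.
    apply: measurable_funTS; apply: continuous_measurable_fun => x.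
    by apply: cvgM; [exact: cct|exact: ck].
  move=> x; rewrite /= in_itv/= andbT => x0; rewrite normrM.
  by rewrite (le_trans (ler_piMl _ (cos_max _)))// (le_trans (kC _ (ltW x0))).
have ig := cvgb _ cg gC; have ig2 := cvgb _ cg2 g2C.
have E : 4 * t ^+ 2 * cos_transform g t = - \int[mu]_(s in `]0, +oo[) (cos (2 * t * s) * g2 s).
  apply/eqP; rewrite -addr_eq0 -RintegralZl// -RintegralD//; last exact: integrable_scale ig.
  rewrite (_ : Rintegral _ _ _ = 0 - F 0); last first.
    by rewrite -iE; apply: eq_Rintegral => x _; rewrite /f; ring.
  by rewrite /F mulr0 sin0 cos0 g10; apply/eqP; ring.
(* Adding the transform of [g] to 4 t^2 times itself gives one integral, of [g - g2]; the estimate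
   then needs no division by t. *)
have -> : (1 + 4 * t ^+ 2) * `|cos_transform g t| = `|\int[mu]_(s in `]0, +oo[) (cos (2 * t * s) * (g s - g2 s))|.
  rewrite -[X in X * _]ger0_norm; last by rewrite addr_ge0// mulr_ge0 ?sqr_ge0.
  rewrite -normrM mulrDl mul1r E -RintegralB//; congr `| _ |.
  by apply: eq_Rintegral => x _; ring.
apply: normr_Rintegral_le => //.
  apply: measurable_funTS; apply: continuous_measurable_fun => x.
  by apply: cvgM; [exact: cct|apply: cvgB; [exact: cg|exact: cg2]].
move=> x; rewrite /= in_itv/= andbT => x0; rewrite normrM.
rewrite (le_trans (ler_piMl _ (cos_max _)))// (le_trans (ler_normB _ _))// gh//.
Qed.
Lemma poisson_ge0 (e v : R) : 0 <= e -> 0 <= poisson e v.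
Proof. by move=> e0; rewrite divr_ge0// addr_ge0 ?sqr_ge0. Qed.

Lemma continuous_poisson (e b : R) : 0 < e -> continuous (fun s => poisson e (2 * (s + b))).
Proof.
move=> e0 s; apply: cvgM; first exact: cvg_cst.
apply: cvgV; first by rewrite gt_eqF// ltr_pwDl ?exprn_gt0// sqr_ge0.
apply: cvgD; first exact: cvg_cst.
apply: (@continuous_comp _ _ _ (fun s : R => 2 * (s + b)) (fun x => x ^+ 2)); last exact: exprn_continuous.
apply: cvgM; first exact: cvg_cst.
by apply: cvgD; [exact: cvg_id|exact: cvg_cst].
Qed.

(** The primitive is half an arctangent. For u > 0 the value tends to pi / 2 as e tends to 0: the
    factor 2 in the argument halves the full mass pi of the kernel. *)
Lemma integral_poisson (e u : R) : 0 < e ->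
  mu.-integrable `]0, +oo[ (EFin \o (fun s => poisson e (2 * (s - u)))) /\
  \int[mu]_(s in `]0, +oo[) poisson e (2 * (s - u)) = (pi / 2 + atan (2 * u / e)) / 2.
Proof.
move=> e0.
have [||||i iE] := @integral_derivative_ge0 (fun s => poisson e (2 * (s - u))) (fun s => 2^-1 * atan (2 / e * (s - u))) (2^-1 * (pi / 2)).
- by apply: continuous_poisson.
- move=> x; apply: is_derive_eq; rewrite /GRing.scale/= /poisson; field.
  by apply/andP; split; rewrite gt_eqF// ltr_pwDl ?exprn_gt0 ?sqr_ge0.
- by move=> x _; apply: poisson_ge0; exact: ltW.
- apply: cvgM; first exact: cvg_cst.
  apply: (@cvg_comp _ _ _ (fun s : R => 2 / e * (s - u)) (@atan R)); last exact: cvgy_atan.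
  apply: gt0_cvgMry; first by rewrite divr_gt0.
  exact: cvg_addrr.
split => //; rewrite iE sub0r mulrN atanN; set x := _ / e * u; set y := _ * u / e.
by have -> : x = y; [rewrite /x /y mulrAC|field].
Qed.

(** The majorant is free of [e], as dominated convergence requires. For |v| at most 1 the bound
    linear in |v| is combined with 4 e |v| <= e^2 + 4 v^2; for larger |v| the constant bound
    suffices, since e / (e^2 + 4 v^2) is at most 1 / (4 v^2). *)
Lemma poisson_le (K1 K2 e v d : R) : 0 < e <= 1 -> 0 <= K1 -> 0 <= d -> d <= K1 * `|v| -> d <= 2 * K2 ->
  d * poisson e (2 * v) <= (K1 + 2 * K2) / (1 + v ^+ 2).
Proof.
move=> /andP[e0 e1] K10 d0 dK1 dK2.
have p1 : 0 < 1 + v ^+ 2 by rewrite ltr_pwDl// sqr_ge0.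
have p2 : 0 < e ^+ 2 + (2 * v) ^+ 2 by rewrite ltr_pwDl ?exprn_gt0// sqr_ge0.
rewrite /poisson mulrA ler_pdivrMr// mulrAC ler_pdivlMr//.
have K20 : 0 <= K2 by lra.
rewrite exprMn -real_normK ?num_real//; move: (normr_ge0 v) dK1; set w := `|v| => w0 dw.
have [w1|w1] := leP w 1.
  apply: (@le_trans _ _ (2 * K1 * w * e)).
    have h1 : d * e <= K1 * w * e by rewrite ler_wpM2r// ltW.
    have h2 : 1 + w ^+ 2 <= 2 by nra.
    have h3 : 0 <= d * e by rewrite mulr_ge0// ltW.
    nra.
  have h1 : 0 <= K1 * (e - 2 * w) ^+ 2 by rewrite mulr_ge0// sqr_ge0.
  have h2 : 0 <= K1 * e ^+ 2 by rewrite mulr_ge0// sqr_ge0.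
  have h3 : 0 <= K2 * e ^+ 2 by rewrite mulr_ge0// sqr_ge0.
  have h4 : 0 <= K2 * w ^+ 2 by rewrite mulr_ge0// sqr_ge0.
  have h5 : 0 <= K1 * w ^+ 2 by rewrite mulr_ge0// sqr_ge0.
  nra.
apply: (@le_trans _ _ (2 * K2 * (2 * w ^+ 2))).
  apply: ler_pM; [by rewrite mulr_ge0// ltW|by nra| |by nra].
  by rewrite (le_trans _ dK2)// ler_piMr.
have h2 : 0 <= K1 * e ^+ 2 by rewrite mulr_ge0// sqr_ge0.
have h3 : 0 <= K2 * e ^+ 2 by rewrite mulr_ge0// sqr_ge0.
have h4 : 0 <= K2 * w ^+ 2 by rewrite mulr_ge0// sqr_ge0.
have h5 : 0 <= K1 * w ^+ 2 by rewrite mulr_ge0// sqr_ge0.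
nra.
Qed.

Lemma poisson_cvg0 (v : R) : v != 0 -> poisson (harmonic n) v @[n --> \oo] --> 0.
Proof.
move=> v0; rewrite -[X in _ --> X](mul0r (0 ^+ 2 + v ^+ 2)^-1).
have h0 : @harmonic R n @[n --> \oo] --> 0 by exact: cvg_harmonic.
apply: cvgM => //; apply: cvgV; first by rewrite expr0n add0r sqrf_eq0.
apply: cvgD; last exact: cvg_cst.
by apply: (@cvg_comp _ _ _ (@harmonic R) (fun x => x ^+ 2) _ _ _ h0); exact: exprn_continuous.
Qed.

Lemma harmonic_le1 n : 0 < @harmonic R n <= 1.
Proof. by rewrite invr_gt0 ltr0n/= invf_le1 ?ltr0n// ler1n. Qed.

Local Notation mR := (measurableTypeR R).

Lemma measurable_cosM d (T : measurableType d) (f : T -> R) : measurable_fun setT f -> measurable_fun setT (fun x => cos (f x)).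
Proof. by move=> mf; apply: measurableT_comp => //; apply: continuous_measurable_fun; exact: continuous_cos. Qed.

Lemma measurable_cos_transform (g : R -> R) : measurable_fun setT g -> measurable_fun setT (cos_transform g).
Proof.
move=> mg; apply: (@measurable_Rintegral R _ _ mR mR mu `]0, +oo[ _ (fun z => cos (2 * z.1 * z.2) * g z.2)) => //.
apply: measurable_funM; last exact: (measurableT_comp mg).
by apply: measurable_cosM; apply: measurable_funM => //; exact: measurable_funM.
Qed.

Lemma integrable_cauchy (a : R) : mu.-integrable `]0, +oo[ (EFin \o (fun s => (1 + (s - a) ^+ 2)^-1)).
Proof.
have p (s : R) : 0 < 1 + (s - a) ^+ 2 by rewrite ltr_pwDl// sqr_ge0.
have [||||//] := @integral_derivative_ge0 (fun s => (1 + (s - a) ^+ 2)^-1) (fun s => atan (s - a)) (pi / 2).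
- move=> s; apply: cvgV; first by rewrite gt_eqF.
  apply: cvgD; first exact: cvg_cst.
  apply: (@continuous_comp _ _ _ (fun s : R => s - a) (fun x => x ^+ 2)); last exact: exprn_continuous.
  by apply: cvgD; [exact: cvg_id|exact: cvg_cst].
- by move=> s; apply: is_derive_eq; rewrite /GRing.scale/= ?subr0 mulr1.
- by move=> s _; rewrite invr_ge0 ltW.
- by apply: (@cvg_comp _ _ _ (fun s : R => (s - a)) (@atan R)); [exact: cvg_addrr|exact: cvgy_atan].
Qed.

(** * Inversion of the cosine transform by Abel summation *)

Section Inversion.
Variables (g : R -> R) (C c : R).
Hypotheses (c0 : 0 < c) (cg : continuous g) (gC : forall s, 0 <= s -> `|g s| <= C * expR (- (c * s))).

Let mD : measurable (`]0, +oo[%classic : set mR). Proof. by []. Qed.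

Let mg : measurable_fun (setT : set mR) (g : mR -> R).
Proof. exact: continuous_measurable_fun cg. Qed.

Let mcos (k : R) : measurable_fun (setT : set mR) (fun t : mR => cos (k * t)).
Proof. by apply: measurable_cosM; exact: measurable_funM. Qed.

Let mexp (k : R) : measurable_fun (setT : set mR) (fun t : mR => expR (- (k * t))).
Proof. by apply: measurableT_comp => //; apply: measurableT_comp => //; exact: measurable_funM. Qed.

Let C0 : 0 <= C.
Proof. by move: (le_trans (normr_ge0 _) (gC (lexx _))); rewrite mulr0 oppr0 expR0 mulr1. Qed.

Let iC : mu.-integrable `]0, +oo[ (EFin \o (fun s => C * expR (- (c * s)))).
Proof. exact: integrable_scale (integrable_expRNM c0). Qed.

Let ig (k : mR -> R) : measurable_fun (setT : set mR) k -> (forall s, 0 < s -> `|k s| <= 1) ->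
  mu.-integrable `]0, +oo[ (EFin \o (fun s => k s * g s)).
Proof.
move=> mk k1; apply: (integrable_dominated mD _ iC).
  by apply: measurable_funTS; apply: measurable_funM; [exact: mk|exact: mg].
move=> s; rewrite /= in_itv/= andbT => s0; rewrite normrM.
apply: le_trans (gC (ltW s0)).
by apply: ler_piMl; [exact: normr_ge0|exact: k1].
Qed.

(* Abel regularisation of the inversion integral. *)
Lemma cos_transform_abel (u e : R) : 0 < e ->
  \int[mu]_(t in `]0, +oo[) (expR (- (e * t)) * (cos_transform g t * cos (2 * u * t))) =
  \int[mu]_(s in `]0, +oo[) (g s * (2^-1 * (poisson e (2 * (s - u)) + poisson e (2 * (s + u))))).
Proof.
move=> e0.
pose f (z : mR * mR) := expR (- (e * z.1)) * cos (2 * u * z.1) * (cos (2 * z.1 * z.2) * g z.2).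
have [||_ _ ff] := @Rintegral_fubini _ _ _ mR mR mu mu `]0, +oo[ `]0, +oo[ mD mD f (fun t => expR (- (e * t))) (fun s => C * expR (- (c * s))) _ (integrable_expRNM e0) iC.
- apply: measurable_funM; last first.
    apply: measurable_funM; last exact: (measurableT_comp mg).
    by apply: measurable_cosM; apply: measurable_funM => //; exact: measurable_funM.
  by apply: measurable_funM; [exact: (measurableT_comp (mexp _))|exact: (measurableT_comp (mcos _))].
- move=> t s _; rewrite /= in_itv/= andbT => s0; rewrite /f/= !normrM (ger0_norm (expR_ge0 _)).
  apply: ler_pM; rewrite ?mulr_ge0 ?expR_ge0 ?ler_piMr ?expR_ge0 ?cos_max//.
  by rewrite (le_trans (ler_piMl _ (cos_max _)))// gC// ltW.
transitivity (\int[mu]_(t in `]0, +oo[) \int[mu]_(s in `]0, +oo[) f (t, s)).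
  apply: eq_Rintegral => t _; rewrite /f/= (RintegralZl _ mD).
    by rewrite -/(cos_transform g t) mulrA mulrAC.
  by apply: ig; [exact: mcos|move=> s _; exact: cos_max].
rewrite ff; apply: eq_Rintegral => s' _; move: (s' : R) => {s'} s.
have [i1 e1] := integral_expRNM_cos (2 * (s - u)) e0.
have [i2 e2] := integral_expRNM_cos (2 * (s + u)) e0.
have i12 : mu.-integrable `]0, +oo[ (EFin \o (fun t => expR (- (e * t)) * cos (2 * (s - u) * t) + expR (- (e * t)) * cos (2 * (s + u) * t))).
  by have h := integrable_add mD i1 i2; exact: h.
rewrite -e1 -e2 -(RintegralD mD i1 i2) -(RintegralZl _ mD i12).
rewrite -(RintegralZl _ mD (integrable_scale mD 2^-1 i12)).
apply: eq_Rintegral => t _; rewrite /f /=.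
rewrite (_ : 2 * (s - u) * t = 2 * t * s - 2 * u * t); last by ring.
rewrite (_ : 2 * (s + u) * t = 2 * t * s + 2 * u * t); last by ring.
by rewrite cosB cosD; field.
Qed.

(** The regularised integral is computed in two ways with e = 1 / (n + 1). In t, the decay
    hypothesis dominates it. In s, the Poisson kernel centred at u selects [g u], while the one
    centred at -u disappears because u > 0. The constant is 1 / 2 from the product formula for
    cosines times the mass pi / 2. *)
Lemma cos_transform_inversion (K M u : R) : 0 < u -> 0 <= K ->
  (forall s, 0 <= s -> `|g s - g u| <= K * `|s - u|) ->
  (forall t, (1 + 4 * t ^+ 2) * `|cos_transform g t| <= M) ->
  \int[mu]_(t in `]0, +oo[) (cos_transform g t * cos (2 * u * t)) = pi / 4 * g u.
Proof.
move=> u0 K0 gK gM.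
have mc : measurable_fun (setT : set mR) (cos_transform g : mR -> R) by exact: measurable_cos_transform mg.
have bh (t : R) : `|cos_transform g t * cos (2 * u * t)| <= M * (1 + (t - 0) ^+ 2)^-1.
  have p1 : 0 < 1 + t ^+ 2 by rewrite ltr_pwDl// sqr_ge0.
  rewrite normrM subr0 (le_trans (ler_piMr _ (cos_max _)))// ler_pdivlMr//.
  rewrite (le_trans _ (gM t))// mulrC ler_wpM2r//; have := sqr_ge0 t; lra.
have ih : mu.-integrable `]0, +oo[ (EFin \o (fun t => M * (1 + (t - 0) ^+ 2)^-1)).
  exact: (integrable_scale mD M (f := fun t => (1 + (t - 0) ^+ 2)^-1) (integrable_cauchy 0)).
have mfi : measurable_fun (setT : set mR) (fun t : mR => cos_transform g t * cos (2 * u * t)) by exact: measurable_funM.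
pose A n := \int[mu]_(t in `]0, +oo[) (expR (- (harmonic n * t)) * (cos_transform g t * cos (2 * u * t))).
have A1 : A n @[n --> \oo] --> \int[mu]_(t in `]0, +oo[) (cos_transform g t * cos (2 * u * t)).
  apply: (Rintegral_dominated_cvg mD _ _ _ ih).
  - by move=> n; apply: measurable_funTS; exact: measurable_funM.
  - exact: measurable_funTS.
  - move=> t _; rewrite -[X in _ --> X]mul1r; apply: cvgM; last exact: cvg_cst.
    rewrite -[X in _ --> X](@expR0 R) -[X in expR X]oppr0 -(mul0r t).
    apply: (@cvg_comp _ _ _ (fun n => - (harmonic n * t)) (@expR R)); last exact: continuous_expR.
    by apply: cvgN; apply: cvgM; [exact: cvg_harmonic|exact: cvg_cst].
  - move=> n t; rewrite /= in_itv/= andbT => t0; rewrite normrM.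
    rewrite (le_trans _ (bh t))// ler_piMl// ger0_norm ?expR_ge0//.
    by rewrite expR_le1 oppr_le0 mulr_ge0 ?harmonic_ge0// ltW.
(* [r] is the error made by replacing g(s) by g(u) under the peak at u, and [q] comes from the peak
   at -u, outside the half-line. Both tend to 0 under majorants free of e: the Lipschitz bound
   serves [r], the lower bound u on the distance to the peak serves [q]. *)
pose r e s := (g s - g u) * poisson e (2 * (s - u)).
pose q e s := poisson e (2 * (s + u)) * g s.
have cP e a : 0 < e -> measurable_fun (setT : set mR) (fun s : mR => poisson e (2 * (s + a))).
  by move=> e0; apply: continuous_measurable_fun; exact: continuous_poisson.
have gC1 s : 0 <= s -> `|g s| <= C.
  move=> s0; apply: le_trans (gC s0) _; rewrite ler_piMr// expR_le1 oppr_le0 mulr_ge0// ltW//.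
have ih2 : mu.-integrable `]0, +oo[ (EFin \o (fun s => (K + 2 * C) * (1 + (s - u) ^+ 2)^-1)).
  exact: (integrable_scale mD (K + 2 * C) (f := fun t => (1 + (t - u) ^+ 2)^-1) (integrable_cauchy u)).
have rb e s : 0 < e <= 1 -> 0 < s -> `|r e s| <= (K + 2 * C) * (1 + (s - u) ^+ 2)^-1.
  move=> e01 s0; have /andP[e0 _] := e01; rewrite /r normrM (ger0_norm (poisson_ge0 _ (ltW e0))).
  apply: poisson_le => //; first by apply: gK; exact: ltW.
  by rewrite (le_trans (ler_normB _ _))// mulr2n mulrDl !mul1r lerD// gC1// ltW.
have mr e : 0 < e -> measurable_fun (setT : set mR) (r e : mR -> R).
  by move=> e0; apply: measurable_funM; [exact: measurable_funB|exact: cP].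
have qb e s : 0 < e <= 1 -> 0 < s -> `|q e s| <= (4 * u ^+ 2)^-1 * (C * expR (- (c * s))).
  move=> /andP[e0 e1] s0; rewrite /q normrM (ger0_norm (poisson_ge0 _ (ltW e0))).
  apply: ler_pM; rewrite ?poisson_ge0 ?(ltW e0)//; last by apply: gC; exact: ltW.
  rewrite -[leRHS]mul1r; apply: ler_pM => //; first exact: ltW.
    by rewrite invr_ge0 addr_ge0 ?sqr_ge0.
  have p1 : 0 < 4 * u ^+ 2 by rewrite mulr_gt0// exprn_gt0.
  have p2 : 0 < e ^+ 2 + (2 * (s + u)) ^+ 2 by rewrite ltr_pwDl ?exprn_gt0 ?sqr_ge0.
  by rewrite lef_pV2 ?posrE//; nra.
have iq : mu.-integrable `]0, +oo[ (EFin \o (fun s => (4 * u ^+ 2)^-1 * (C * expR (- (c * s))))).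
  by have h := integrable_scale mD (4 * u ^+ 2)^-1 iC; exact: h.
have mq e : 0 < e -> measurable_fun (setT : set mR) (q e : mR -> R).
  by move=> e0; apply: measurable_funM; [exact: cP|exact: mg].
have r0 : \int[mu]_(s in `]0, +oo[) r (harmonic n) s @[n --> \oo] --> (0 : R).
  rewrite [X in _ --> X](_ : 0 = \int[mu]_(s in `]0, +oo[) (0 : R)); last by rewrite Rintegral_cst// mul0r.
  apply: (Rintegral_dominated_cvg mD _ _ _ ih2).
  - by move=> n; apply: measurable_funTS; apply: mr; have /andP[] := harmonic_le1 n.
  - exact: measurable_cst.
  - move=> s _; have [->|su] := eqVneq s u.
      by under eq_fun do rewrite /r subrr mul0r; exact: cvg_cst.
    rewrite -[X in _ --> X](mulr0 (g s - g u)); apply: cvgM; first exact: cvg_cst.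
    by apply: poisson_cvg0; rewrite mulf_eq0 negb_or pnatr_eq0/= subr_eq0.
  - by move=> n s; rewrite /= in_itv/= andbT; apply: rb; exact: harmonic_le1.
have q0 : \int[mu]_(s in `]0, +oo[) q (harmonic n) s @[n --> \oo] --> (0 : R).
  rewrite [X in _ --> X](_ : 0 = \int[mu]_(s in `]0, +oo[) (0 : R)); last by rewrite Rintegral_cst// mul0r.
  apply: (Rintegral_dominated_cvg mD _ _ _ iq).
  - by move=> n; apply: measurable_funTS; apply: mq; have /andP[] := harmonic_le1 n.
  - exact: measurable_cst.
  - move=> s; rewrite /= in_itv/= andbT => s0.
    rewrite -[X in _ --> X](mul0r (g s)); apply: cvgM; last exact: cvg_cst.
    by apply: poisson_cvg0; rewrite mulf_neq0// gt_eqF// addr_gt0.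
  - by move=> n s; rewrite /= in_itv/= andbT; apply: qb; exact: harmonic_le1.
have p0 : \int[mu]_(s in `]0, +oo[) poisson (harmonic n) (2 * (s - u)) @[n --> \oo] --> (pi / 2 : R).
  rewrite [X in _ --> X](_ : pi / 2 = (pi / 2 + pi / 2) / 2); last by field.
  under eq_fun do rewrite (integral_poisson u (andP (harmonic_le1 _)).1).2.
  apply: cvgM; last exact: cvg_cst.
  apply: cvgD; first exact: cvg_cst.
  apply: (@cvg_comp _ _ _ (fun n : nat => 2 * u / harmonic n) (@atan R)); last exact: cvgy_atan.
  have u2 : 0 < 2 * u by rewrite mulr_gt0.
  have h : (n.+1%:R : R) @[n --> \oo] --> +oo.
    by apply/cvgryPge => y; near=> n; rewrite (le_trans _ (_ : n%:R <= _)) ?ler_nat//; near: n; exact: nbhs_infty_ger.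
  rewrite (_ : (fun n : nat => 2 * u / harmonic n) = (fun n => 2 * u * n.+1%:R)); last first.
    by apply/funext => n; rewrite /harmonic invrK.
  exact: (cvg_comp _ _ h (gt0_cvgMry u2 cvg_id)).
have AE n : A n = 2^-1 * (\int[mu]_(s in `]0, +oo[) r (harmonic n) s + g u * \int[mu]_(s in `]0, +oo[) poisson (harmonic n) (2 * (s - u))
      + \int[mu]_(s in `]0, +oo[) q (harmonic n) s).
  rewrite /A; move: (harmonic n) (harmonic_le1 n) => e e01; have /andP[e0 _] := e01.
  rewrite cos_transform_abel//.
  have ir : mu.-integrable `]0, +oo[ (EFin \o r e).
    apply: (integrable_dominated mD _ ih2); first by apply: measurable_funTS; exact: mr.
    by move=> s; rewrite /= in_itv/= andbT; exact: rb.
  have iqe : mu.-integrable `]0, +oo[ (EFin \o q e).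
    apply: (integrable_dominated mD _ iq); first by apply: measurable_funTS; exact: mq.
    by move=> s; rewrite /= in_itv/= andbT; exact: qb.
  have [ip _] := integral_poisson u e0.
  have ipu := integrable_scale mD (g u) ip.
  have i1 := integrable_add mD ir ipu.
  have i2 := integrable_add mD i1 iqe.
  rewrite -(RintegralZl _ mD ip) -(RintegralD mD ir ipu) -(RintegralD mD i1 iqe) -(RintegralZl _ mD i2).
  by apply: eq_Rintegral => s _; rewrite /r /q; ring.
have A2 : A n @[n --> \oo] --> 2^-1 * (0 + g u * (pi / 2) + 0).
  under eq_fun do rewrite AE.
  apply: cvgM; first exact: cvg_cst.
  apply: cvgD => //; apply: cvgD => //.
  by apply: cvgM => //; exact: cvg_cst.
rewrite (cvg_unique _ A1 A2) //; last by field.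
Unshelve. all: by end_near.
Qed.

End Inversion.

(** * Hyperbolic functions and the growth of powers of cosh *)

Definition rsinh (x : R) : R := (expR x - expR (- x)) / 2.

Lemma is_derive_rcosh (x : R) : is_derive x 1 (@rcosh R) (rsinh x).
Proof. by apply: is_derive_eq; rewrite /rsinh /GRing.scale/=; field. Qed.

Lemma is_derive_rsinh (x : R) : is_derive x 1 rsinh (rcosh x).
Proof. by apply: is_derive_eq; rewrite /rcosh /GRing.scale/=; field. Qed.

Lemma rcosh2_rsinh2 (x : R) : rcosh x ^+ 2 - rsinh x ^+ 2 = 1.
Proof.
have h := expRxMexpNx_1 x.
rewrite /rcosh /rsinh -[RHS]h; by field.
Qed.

Lemma rcosh_ge1 (x : R) : 1 <= rcosh x.
Proof.
have h := expRxMexpNx_1 x; have p := expR_gt0 x; have q := expR_gt0 (- x).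
rewrite /rcosh ler_pdivlMr// mul1r.
have := sqr_ge0 (expR x - expR (- x)); nra.
Qed.

Lemma rcosh_gt0 (x : R) : 0 < rcosh x.
Proof. exact: lt_le_trans (rcosh_ge1 x). Qed.

Lemma rsinh0 : rsinh 0 = 0.
Proof. by rewrite /rsinh oppr0 subrr mul0r. Qed.

Lemma rcosh_ge_expR (x : R) : expR x / 2 <= rcosh x.
Proof. by rewrite ler_wpM2r// lerDl expR_ge0. Qed.

Lemma rcosh_powR_ge1 (g s : R) : 0 <= g -> 1 <= rcosh s `^ g.
Proof.
move=> g0; have := @ge0_ler_powR R g g0 1 (rcosh s); rewrite powR1; apply.
- by rewrite nnegrE.
- by rewrite nnegrE ltW// rcosh_gt0.
- exact: rcosh_ge1.
Qed.

(** Since cosh(s)^g >= 2^(-g) e^(g s) and e^(g s) >= (1 + g s / 2)^2, the power dominates some c'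
    s^2, which beats every linear term. The witness is the exponential of the maximum of (k + 1) s -
    c' s^2. *)
Lemma rcosh_powR_growth (g c k : R) : 0 < g -> 0 < c ->
  exists2 C, 0 < C & forall s, 0 <= s -> expR (k * s - c * rcosh s `^ g) <= C * expR (- (1 * s)).
Proof.
move=> g0 c0.
pose c' := c * (2^-1 `^ g) * (g ^+ 2 / 4).
have c'0 : 0 < c' by rewrite !mulr_gt0 ?exprn_gt0 ?powR_gt0.
exists (expR ((k + 1) ^+ 2 / (4 * c'))); first exact: expR_gt0.
move=> s s0; rewrite -expRD ler_expR.
have h : c' * s ^+ 2 <= c * rcosh s `^ g.
  rewrite (_ : c' * s ^+ 2 = c * (2^-1 `^ g * (g ^+ 2 / 4 * s ^+ 2))); last by rewrite /c'; ring.
  rewrite ler_pM2l//.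
  have h1 : (expR s / 2) `^ g <= rcosh s `^ g.
    apply: ge0_ler_powR; [exact: ltW| | |exact: rcosh_ge_expR].
    - by rewrite nnegrE divr_ge0// expR_ge0.
    - by rewrite nnegrE ltW// rcosh_gt0.
  apply: le_trans h1; rewrite powRM ?expR_ge0// mulrC ler_wpM2r ?powR_ge0// -expRM.
  have h2 : (1 + s * g / 2) <= expR (s * g / 2) by exact: expR_ge1Dx.
  have h3 : expR (s * g) = expR (s * g / 2) ^+ 2 by rewrite -expRM_natl; congr expR; field.
  have h4 : 0 <= s * g by rewrite mulr_ge0// ltW.
  rewrite h3; nra.
have h5 : (k + 1) * s - c' * s ^+ 2 <= (k + 1) ^+ 2 / (4 * c').
  rewrite ler_pdivlMr ?mulr_gt0//.
  have := sqr_ge0 (2 * c' * s - (k + 1)); lra.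
lra.
Qed.

Definition rtanh (x : R) := rsinh x / rcosh x.

Lemma is_derive_rtanh (x : R) : is_derive x 1 rtanh (1 - rtanh x ^+ 2).
Proof.
have := is_derive_rcosh x; have := is_derive_rsinh x => ds dc.
have c0 : rcosh x != 0 by rewrite gt_eqF// rcosh_gt0.
apply: is_derive_eq; rewrite /rtanh/GRing.scale/=; by field.
Qed.

Lemma rtanh_le1 (x : R) : rtanh x ^+ 2 <= 1.
Proof.
rewrite /rtanh expr_div_n ler_pdivrMr ?exprn_gt0 ?rcosh_gt0// mul1r.
have := rcosh2_rsinh2 x; lra.
Qed.

Lemma rtanh0 : rtanh 0 = 0.
Proof. by rewrite /rtanh rsinh0 mul0r. Qed.

(** Written through tanh, the derivative keeps the exponent g, so repeated derivatives stay
    polynomial in [rtanh] and one power of cosh. *)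
Lemma is_derive_rcosh_powR (g x : R) :
  is_derive x 1 (fun s : R => rcosh s `^ g) (g * rtanh x * rcosh x `^ g).
Proof.
have c0 := rcosh_gt0 x.
have h := is_derive1_comp (is_derive1_powR g c0) (is_derive_rcosh x).
apply: (@is_derive_eq _ _ _ _ _ _ _ _ h).
rewrite powRB ?(gt_eqF c0) ?implybT// powRr1 ?(ltW c0)// /rtanh; field.
by rewrite gt_eqF.
Qed.

Lemma integrable_expR_rcosh (g c k : R) : 0 < g -> 0 < c ->
  mu.-integrable `]0, +oo[ (EFin \o (fun s => expR (k * s - c * rcosh s `^ g))).
Proof.
move=> g0 c0; have [C C0 h] := rcosh_powR_growth k g0 c0.
have mD : measurable (`]0, +oo[%classic : set mR) by [].
have i1 := integrable_scale mD C (integrable_expRNM (ltr01 : 0 < 1 :> R)).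
apply: (integrable_dominated mD _ i1).
  apply: measurable_funTS; apply: continuous_measurable_fun.
  apply: (@is_derive_continuous _ (fun s => (k - c * (g * rtanh s * rcosh s `^ g)) * expR (k * s - c * rcosh s `^ g))) => x.
  have := is_derive_rcosh_powR g x => d.
  apply: is_derive_eq; rewrite /GRing.scale/=; ring.
by move=> s; rewrite /= in_itv/= andbT => /ltW s0; rewrite ger0_norm ?expR_ge0// h.
Qed.

Lemma integrable_expRN_rcosh (g c : R) : 0 < g -> 0 < c ->
  mu.-integrable `]0, +oo[ (EFin \o (fun s => expR (- (c * rcosh s `^ g)))).
Proof.
move=> g0 c0; have h := integrable_expR_rcosh 0 g0 c0.
rewrite (_ : (fun s => _) = (fun s => expR (0 * s - c * rcosh s `^ g)))//.
by apply/funext => s; rewrite mul0r add0r.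
Qed.

(** * The oscillating function, its derivatives and uniform bounds *)

Section Oscillation.
Variables (b A B psi : R).
Hypotheses (b0 : 0 < b) (A0 : 0 < A).
Let p s := rcosh s `^ b.
Let E s := expR (- (A * p s)).
Let th s := psi - B * p s.

(** In the application A and B are Re z and Im z times cosh(u)^al, and psi carries the rest of the
    phase; u is a parameter here. *)
Definition osc s := expR (- (A * rcosh s `^ b)) * cos (psi - B * rcosh s `^ b).
Definition osc1 s := b * rtanh s * p s * (E s * (B * sin (th s) - A * cos (th s))).
Definition osc2 s := (b * (1 - rtanh s ^+ 2) + b ^+ 2 * rtanh s ^+ 2) * p s * (E s * (B * sin (th s) - A * cos (th s)))
   + (b * rtanh s * p s) ^+ 2 * (E s * ((A ^+ 2 - B ^+ 2) * cos (th s) - 2 * A * B * sin (th s))).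

Lemma is_derive_osc (s : R) : is_derive s 1 osc (osc1 s).
Proof.
have d := is_derive_rcosh_powR b s.
by apply: is_derive_eq; rewrite /osc1/E/th/p/GRing.scale/=; ring.
Qed.

Lemma is_derive_osc1 (s : R) : is_derive s 1 osc1 (osc2 s).
Proof.
have d := is_derive_rcosh_powR b s; have d' := is_derive_rtanh s.
by apply: is_derive_eq; rewrite /osc2/E/th/p/GRing.scale/=; ring.
Qed.

Lemma continuous_osc2 : continuous osc2.
Proof.
move=> s; apply/differentiable_continuous/derivable1_diffP; rewrite /osc2 /E /th /p.
have d := is_derive_rcosh_powR b s; have d' := is_derive_rtanh s.
by apply: ex_derive.
Qed.

(** [osc] is even in s. This removes the boundary term at 0 in the integrations by parts. *)
Lemma osc1_0 : osc1 0 = 0.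
Proof. by rewrite /osc1 rtanh0 mulr0 !mul0r. Qed.

(** The four terms bound [osc], [osc1] and the two summands of [osc2]. They involve only b and a
    bound m for |B| / A, never A itself, whence estimates uniform in u. *)
Definition osc_bound (m : R) := 1 + 2 * b * (1 + m) + 2 * (b + b ^+ 2) * (1 + m) + 16 * b ^+ 2 * (1 + m) ^+ 2.

(** Differentiation brings out y = A cosh(s)^b to the power 1 or 2. Half of the exponential pays for
    it, because y e^(-y/2) <= 2 and y^2 e^(-y/2) <= 16; the other half is the decay that remains. *)
Lemma osc_bounds (m s : R) : 0 <= m -> `|B| <= m * A ->
  `|osc1 s| <= osc_bound m * expR (- (A / 2 * rcosh s `^ b)) /\
  `|osc s| + `|osc2 s| <= osc_bound m * expR (- (A / 2 * rcosh s `^ b)).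
Proof.
move=> m0 Bm.
have p1 : 1 <= p s by apply: rcosh_powR_ge1; exact: ltW.
have p0 : 0 <= p s by exact: le_trans p1.
have E0 : 0 <= E s by exact: expR_ge0.
set y := A * p s.
have y0 : 0 <= y by rewrite mulr_ge0// ltW.
set e := expR (- (A / 2 * rcosh s `^ b)).
have e0 : 0 < e by exact: expR_gt0.
have eE : E s = e ^+ 2 by rewrite /E /e -expRM_natl; congr expR; rewrite /p; field.
have ye : y * e <= 2.
  have h := expR_ge1Dx (y / 2).
  have -> : y = y / 2 * 2 by field.
  have h2 : e * expR (y / 2) = 1.
    by rewrite /e -expRD -[RHS]expR0; congr expR; rewrite /y /p; field.
  nra.
have y2e : y ^+ 2 * e <= 16.
  have h := expR_ge1Dx (y / 4).
  have h2 : e * expR (y / 4) ^+ 2 = 1.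
    by rewrite /e -expRM_natl -expRD -[RHS]expR0; congr expR; rewrite /y /p; field.
  have h3 : (y / 4) ^+ 2 <= expR (y / 4) ^+ 2 by rewrite lerXn2r ?nnegrE ?divr_ge0 ?expR_ge0//; lra.
  nra.
have e1 : e <= 1.
  by rewrite /e expR_le1 oppr_le0 !mulr_ge0 ?powR_ge0 ?invr_ge0// ltW.
set N := 1 + m; have N0 : 0 <= N by rewrite addr_ge0.
(* This makes the trigonometric factors at most N A after one differentiation and (N A)^2 after
   two. *)
have AB : A + `|B| <= N * A by rewrite mulrDl mul1r lerD2l.
have S1 : `|B * sin (th s) - A * cos (th s)| <= N * A.
  apply: le_trans AB; rewrite [leRHS]addrC (le_trans (ler_normB _ _))// !normrM (gtr0_norm A0) lerD//.
    by rewrite ler_piMr// sin_max.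
  by rewrite ler_piMr ?cos_max// ltW.
have S2 : `|(A ^+ 2 - B ^+ 2) * cos (th s) - 2 * A * B * sin (th s)| <= (N * A) ^+ 2.
  have h : `|A ^+ 2 - B ^+ 2| <= A ^+ 2 + `|B| ^+ 2.
    by rewrite (le_trans (ler_normB _ _))// !normrX (gtr0_norm A0).
  apply: (@le_trans _ _ ((A + `|B|) ^+ 2)); last first.
    by rewrite lerXn2r ?nnegrE ?addr_ge0 ?mulr_ge0// ltW.
  rewrite (le_trans (ler_normB _ _))// !normrM (gtr0_norm A0) (ger0_norm (_ : 0 <= 2))//.
  have c1 := cos_max (th s); have s1 := sin_max (th s).
  have h1 : `|A ^+ 2 - B ^+ 2| * `|cos (th s)| <= A ^+ 2 + `|B| ^+ 2.
    by apply: le_trans h; rewrite ler_piMr.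
  have h2 : 2 * A * `|B| * `|sin (th s)| <= 2 * A * `|B|.
    by rewrite ler_piMr// !mulr_ge0// ltW.
  rewrite sqrrD; lra.
have t2 := rtanh_le1 s; have t2' := sqr_ge0 (rtanh s).
have t1 : `|rtanh s| <= 1 by rewrite -(@ler_pXn2r _ 2)// ?nnegrE// expr1n real_normK ?num_real.
have T1 : `|E s * (B * sin (th s) - A * cos (th s))| * p s <= 2 * N * e.
  rewrite normrM (ger0_norm E0) eE; set w := `|_|.
  have h1 : w * p s <= N * y by rewrite /y mulrA ler_wpM2r.
  have h2 : e ^+ 2 * (w * p s) <= e ^+ 2 * (N * y) by rewrite ler_wpM2l ?sqr_ge0.
  have h3 : N * e * (y * e) <= N * e * 2 by rewrite ler_wpM2l// mulr_ge0// ltW.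
  lra.
have T2 : `|E s * ((A ^+ 2 - B ^+ 2) * cos (th s) - 2 * A * B * sin (th s))| * p s ^+ 2 <= 16 * N ^+ 2 * e.
  rewrite normrM (ger0_norm E0) eE; set w := `|_|.
  have h1 : w * p s ^+ 2 <= N ^+ 2 * y ^+ 2.
    rewrite (_ : N ^+ 2 * y ^+ 2 = (N * A) ^+ 2 * p s ^+ 2); last by rewrite /y; ring.
    by rewrite ler_wpM2r ?sqr_ge0.
  have h2 : e * (N ^+ 2 * (y ^+ 2 * e)) <= e * (N ^+ 2 * 16).
    by rewrite ler_wpM2l ?(ltW e0)// ler_wpM2l ?sqr_ge0.
  have h3 : e ^+ 2 * (w * p s ^+ 2) <= e ^+ 2 * (N ^+ 2 * y ^+ 2).
    by rewrite ler_wpM2l ?sqr_ge0.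
  lra.
have T0 : `|osc s| <= e.
  rewrite /osc -/(E s) normrM (ger0_norm E0) (le_trans (ler_piMr _ (cos_max _)))// eE.
  by rewrite expr2 ler_piMr// ltW.
have O1 : `|osc1 s| <= 2 * b * N * e.
  rewrite /osc1 normrM [X in X * _]normrM [X in X * _ * _]normrM (ger0_norm p0) (gtr0_norm b0).
  move: T1; set w := `|E s * _| => T1.
  have w0 : 0 <= w * p s by rewrite mulr_ge0// normr_ge0.
  have h1 : `|rtanh s| * (w * p s) <= w * p s by rewrite ler_piMl.
  have h2 : b * (`|rtanh s| * (w * p s)) <= b * (2 * N * e).
    by rewrite ler_wpM2l ?(ltW b0)// (le_trans h1).
  lra.
have O2 : `|osc2 s| <= 2 * (b + b ^+ 2) * N * e + 16 * b ^+ 2 * N ^+ 2 * e.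
  rewrite /osc2 (le_trans (ler_normD _ _))// lerD//.
    rewrite normrM [X in X * _]normrM (ger0_norm p0).
    move: T1; set w := `|E s * _| => T1.
    have w0 : 0 <= w * p s by rewrite mulr_ge0// normr_ge0.
    set v := `|_|.
    have hv : v <= b + b ^+ 2.
      rewrite /v ger0_norm; last first.
        by rewrite addr_ge0// mulr_ge0 ?sqr_ge0 ?(ltW b0)// subr_ge0.
      rewrite lerD//; first by rewrite ler_piMr ?(ltW b0)//; lra.
      by rewrite ler_piMr ?sqr_ge0.
    have h2 : v * (w * p s) <= (b + b ^+ 2) * (2 * N * e).
      by apply: ler_pM => //; exact: normr_ge0.
    lra.
  rewrite normrM ger0_norm ?sqr_ge0//.
  rewrite (_ : (b * rtanh s * p s) ^+ 2 = b ^+ 2 * rtanh s ^+ 2 * p s ^+ 2); last by ring.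
  move: T2; set w := `|E s * _| => T2.
  have w0 : 0 <= w * p s ^+ 2 by rewrite mulr_ge0 ?sqr_ge0// normr_ge0.
  have h1 : rtanh s ^+ 2 * (w * p s ^+ 2) <= 16 * N ^+ 2 * e by apply: le_trans T2; rewrite ler_piMl.
  have h2 : b ^+ 2 * (rtanh s ^+ 2 * (w * p s ^+ 2)) <= b ^+ 2 * (16 * N ^+ 2 * e) by rewrite ler_wpM2l ?sqr_ge0.
  lra.
have q1 : 0 <= b * N * e by rewrite !mulr_ge0 ?(ltW b0) ?(ltW e0).
have q2 : 0 <= b ^+ 2 * N * e by rewrite !mulr_ge0 ?(ltW b0) ?(ltW e0).
have q3 : 0 <= b ^+ 2 * N ^+ 2 * e by rewrite !mulr_ge0 ?(ltW b0) ?(ltW e0).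
rewrite /osc_bound -/N; split; lra.
Qed.

Lemma osc_bound_ge0 m : 0 <= m -> 0 <= osc_bound m.
Proof.
move=> m0; have := ltW b0 => b0'.
by rewrite /osc_bound !addr_ge0 ?mulr_ge0 ?addr_ge0 ?sqr_ge0.
Qed.

Lemma cos_transform_osc_le (m t : R) : 0 <= m -> `|B| <= m * A ->
  (1 + 4 * t ^+ 2) * `|cos_transform osc t| <= osc_bound m * \int[mu]_(s in `]0, +oo[) expR (- (A / 2 * rcosh s `^ b)).
Proof.
move=> m0 Bm.
have mD : measurable (`]0, +oo[%classic : set mR) by [].
have A20 : 0 < A / 2 by rewrite divr_gt0.
have ie := integrable_expRN_rcosh b0 A20.
have K0 := osc_bound_ge0 m0.
have [C C0 hC] := rcosh_powR_growth 0 b0 A20.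
have hC' (x : R) : 0 <= x -> osc_bound m * expR (- (A / 2 * rcosh x `^ b)) <= (osc_bound m * C) * expR (- (1 * x)).
  by move=> x0; rewrite -[leRHS]mulrA ler_wpM2l//; have := hC x x0; rewrite mul0r add0r.
have ie' := integrable_scale mD (osc_bound m) ie.
rewrite -(RintegralZl _ mD ie).
refine (@cos_transform_le osc osc1 osc2 _ (osc_bound m * C) 1 t ltr01 is_derive_osc is_derive_osc1 continuous_osc2 osc1_0 _ _ _ ie' _).
- move=> x x0; apply: le_trans (hC' _ x0); have [_] := osc_bounds x m0 Bm; apply: le_trans.
  by rewrite lerDl.
- by move=> x x0; apply: le_trans (hC' _ x0); have [] := osc_bounds x m0 Bm.
- move=> x x0; apply: le_trans (hC' _ x0); have [_] := osc_bounds x m0 Bm; apply: le_trans.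
  by rewrite lerDr.
- by move=> x _; have [] := osc_bounds x m0 Bm.
Qed.

Lemma cos_transform_osc_inversion (m u : R) : 0 <= m -> `|B| <= m * A -> 0 < u ->
  \int[mu]_(t in `]0, +oo[) (cos_transform osc t * cos (2 * u * t)) = pi / 4 * osc u.
Proof.
move=> m0 Bm u0.
have A20 : 0 < A / 2 by rewrite divr_gt0.
have K0 := osc_bound_ge0 m0.
have [C C0 hC] := rcosh_powR_growth 0 b0 A20.
have dc := is_derive_continuous is_derive_osc.
refine (@cos_transform_inversion osc (osc_bound m * C) 1 ltr01 dc _ (osc_bound m) _ u u0 K0 _ (fun t => cos_transform_osc_le t m0 Bm)).
- move=> x x0; have [_ h] := osc_bounds x m0 Bm.
  apply: le_trans (_ : osc_bound m * expR (- (A / 2 * rcosh x `^ b)) <= _).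
    by apply: le_trans h; rewrite lerDl.
  by rewrite -[leRHS]mulrA ler_wpM2l//; have := hC x x0; rewrite mul0r add0r.
- move=> x x0.
  have e1 s : expR (- (A / 2 * rcosh s `^ b)) <= 1.
    by rewrite expR_le1 oppr_le0 !mulr_ge0 ?powR_ge0 ?invr_ge0// ltW.
  have b1 s : `|osc1 s| <= osc_bound m.
    have [h _] := osc_bounds s m0 Bm; apply: le_trans h _.
    by rewrite ler_piMr.
  (* By the mean value theorem the global bound on [osc1] is the Lipschitz constant that the
     inversion requires. *)
  have wl (v y : R) : v <= y -> `|osc y - osc v| <= osc_bound m * `|y - v|.
    move=> xy; have [|c _ ->] := @MVT_segment R osc osc1 v y xy (fun z _ => is_derive_osc z).
      exact: continuous_subspaceT.
    by rewrite normrM ler_wpM2r.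
  have [xu|/ltW ux] := leP x u; last exact: wl.
  by rewrite distrC [in leRHS]distrC; exact: wl.
Qed.

End Oscillation.

End CosTransform.

(** * The substitution s = arsinh (sqrt x) *)

Section ArsinhSqrt.
Context {R : realType}.
Local Notation mu := (@lebesgue_measure R).
Local Notation mR := (measurableTypeR R).

Definition arsinh_sqrt (x : R) : R := ln (Num.sqrt x + Num.sqrt (x + 1)).
(** This is twice the derivative of [arsinh_sqrt], and also what the amplitude of the Legendre
    function leaves after division by the fourth root; hence the substitution absorbs it
    entirely. *)
Definition leg_weight (x : R) : R := (Num.sqrt x * Num.sqrt (x + 1))^-1.

Lemma arsinh_sqrt_arg (x : R) : 0 <= x -> 0 < Num.sqrt x + Num.sqrt (x + 1).
Proof. by move=> x0; rewrite ltr_wpDl ?sqrtr_ge0// sqrtr_gt0; lra. Qed.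

Lemma expR_arsinh_sqrt (x : R) : 0 <= x -> expR (arsinh_sqrt x) = Num.sqrt x + Num.sqrt (x + 1).
Proof. by move=> x0; rewrite lnK// posrE arsinh_sqrt_arg. Qed.

Lemma expRN_arsinh_sqrt (x : R) : 0 <= x -> expR (- arsinh_sqrt x) = Num.sqrt (x + 1) - Num.sqrt x.
Proof.
move=> x0; have h := arsinh_sqrt_arg x0; rewrite expRN expR_arsinh_sqrt//.
apply: (mulfI (lt0r_neq0 h)); rewrite mulfV ?gt_eqF//.
have h1 := sqr_sqrtr x0; have h2 : Num.sqrt (x + 1) ^+ 2 = x + 1 by rewrite sqr_sqrtr; lra.
by transitivity (Num.sqrt (x + 1) ^+ 2 - Num.sqrt x ^+ 2); [rewrite h1 h2|]; ring.
Qed.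

Lemma rcosh_arsinh_sqrt (x : R) : 0 <= x -> rcosh (arsinh_sqrt x) = Num.sqrt (x + 1).
Proof. by move=> x0; rewrite /rcosh expR_arsinh_sqrt// expRN_arsinh_sqrt//; field. Qed.

Lemma rcosh_arsinh_sqrt_powR (b x : R) : 0 <= x -> rcosh (arsinh_sqrt x) `^ b = (x + 1) `^ (b / 2).
Proof.
move=> x0; rewrite rcosh_arsinh_sqrt// -powR12_sqrt; last lra.
by rewrite -powRrM mulrC.
Qed.

Lemma arsinh_sqrt0 : arsinh_sqrt 0 = 0.
Proof. by rewrite /arsinh_sqrt sqrtr0 !add0r sqrtr1 ln1. Qed.

Lemma is_derive_sqrt_shift (x : R) : 0 < x + 1 -> is_derive x 1 (fun x : R => Num.sqrt (x + 1)) (2 * Num.sqrt (x + 1))^-1.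
Proof.
move=> x1; have dp : is_derive x 1 (fun x : R => x + 1) 1 by apply: is_derive_eq; rewrite addr0.
have h := @is_derive1_comp R Num.sqrt (fun x => x + 1) x _ _ (is_derive1_sqrt x1) dp.
by apply: (@is_derive_eq _ _ _ _ _ _ _ _ h); rewrite mulr1.
Qed.

Lemma is_derive_arsinh_sqrt (x : R) : 0 < x -> is_derive x 1 arsinh_sqrt (leg_weight x / 2).
Proof.
move=> x0.
have s0 : 0 < Num.sqrt x by rewrite sqrtr_gt0.
have x1 : 0 < x + 1 by lra.
have s1 : 0 < Num.sqrt (x + 1) by rewrite sqrtr_gt0.
have p : 0 < Num.sqrt x + Num.sqrt (x + 1) by rewrite addr_gt0.
have d1 := is_derive1_sqrt x0.
have d2 := is_derive_sqrt_shift x1.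
have d3 : is_derive x 1 (fun x : R => Num.sqrt x + Num.sqrt (x + 1)) ((2 * Num.sqrt x)^-1 + (2 * Num.sqrt (x + 1))^-1).
  exact: is_deriveD.
have h := @is_derive1_comp R _ (fun x : R => Num.sqrt x + Num.sqrt (x + 1)) x _ _ (is_derive1_ln p) d3.
apply: (@is_derive_eq _ _ _ _ _ _ _ _ h).
by rewrite /leg_weight; field; rewrite !gt_eqF.
Qed.

Lemma arsinh_sqrt_lt : {in `[0, +oo[ &, {homo arsinh_sqrt : x y / x < y}}.
Proof.
move=> x y; rewrite !in_itv/= !andbT => x0 y0 xy.
rewrite ltr_ln ?posrE ?arsinh_sqrt_arg// ltrD// ltr_sqrt; lra.
Qed.

Lemma arsinh_sqrt_cvgy : arsinh_sqrt x @[x --> +oo] --> +oo.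
Proof.
apply/cvgryPge => A.
near=> x.
have x0 : 0 <= x by near: x; apply: nbhs_pinfty_ge; exact: num_real.
have hx : (expR A) ^+ 2 <= x by near: x; apply: nbhs_pinfty_ge; exact: num_real.
rewrite -ler_expR expR_arsinh_sqrt// (@le_trans _ _ (Num.sqrt x))//.
  by rewrite -[leLHS]ger0_norm ?expR_ge0// -sqrtr_sqr ler_sqrt// (le_trans _ hx) ?sqr_ge0.
by rewrite lerDl sqrtr_ge0.
Unshelve. all: by end_near. Qed.

Lemma arsinh_sqrtK (s : R) : 0 <= s -> arsinh_sqrt (rsinh s ^+ 2) = s.
Proof.
move=> s0; have h := rcosh2_rsinh2 s; have c0 := rcosh_gt0 s.
have sh0 : 0 <= rsinh s by rewrite divr_ge0// subr_ge0 ler_expR; lra.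
rewrite /arsinh_sqrt sqrtr_sqr ger0_norm// (_ : rsinh s ^+ 2 + 1 = rcosh s ^+ 2); last lra.
rewrite sqrtr_sqr gtr0_norm// (_ : rsinh s + rcosh s = expR s) ?expRK//.
by rewrite /rsinh /rcosh; field.
Qed.

Lemma continuous_leg_weight (x : R) : 0 < x -> {for x, continuous leg_weight}.
Proof.
move=> x0; apply: cvgV.
  by rewrite mulf_neq0// gt_eqF// sqrtr_gt0//; lra.
apply: cvgM; first exact: sqrt_continuous.
apply: (@continuous_comp _ _ _ (fun x : R => x + 1) Num.sqrt); last exact: sqrt_continuous.
by apply: cvgD; [exact: cvg_id|exact: cvg_cst].
Qed.

Lemma leg_weight_cvg0 : leg_weight x @[x --> +oo] --> (0 : R).
Proof.
apply/cvgrPdist_le => e e0; near=> x.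
have x0 : 0 < x by near: x; apply: nbhs_pinfty_gt; exact: num_real.
have xe : e^-1 <= x by near: x; apply: nbhs_pinfty_ge; exact: num_real.
have s0 : 0 < Num.sqrt x by rewrite sqrtr_gt0.
have s1 : Num.sqrt x <= Num.sqrt (x + 1) by rewrite ler_sqrt; lra.
have h : x <= Num.sqrt x * Num.sqrt (x + 1).
  by rewrite -[leLHS](sqr_sqrtr (ltW x0)) expr2 ler_wpM2l// ltW.
rewrite sub0r normrN ger0_norm; last by rewrite invr_ge0 mulr_ge0 ?sqrtr_ge0.
by rewrite invf_ple ?posrE//; [apply: le_trans h|apply: lt_le_trans h].
Unshelve. all: by end_near. Qed.

Lemma bigcup_itv (a : nat -> R) : (forall n, 0 < a n) -> (forall s, 0 < s -> exists n, a n <= s) ->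
  \bigcup_n `[a n, +oo[%classic = `]0, +oo[%classic.
Proof.
move=> a0 h; apply/seteqP; split => x /=.
  by move=> [n _]; rewrite /= !in_itv/= !andbT; exact: lt_le_trans.
by rewrite in_itv/= andbT => /h[n xn]; exists n => //=; rewrite in_itv/= xn.
Qed.

Lemma harmonic_le (s : R) : 0 < s -> exists n, harmonic n <= s.
Proof.
move=> s0; have /cvgrPdist_le := @cvg_harmonic R => /(_ s s0)[n _ h]; exists n.
have := h n (leqnn n) => /=; rewrite sub0r normrN ger0_norm//.
Qed.

Section Substitution.
Variables (F w : R -> R) (l : R).
Hypotheses (F_lt : {in `[0, +oo[ &, {homo F : x y / x < y}}) (F0 : F 0 = 0)
  (dF : forall x : R, 0 < x -> is_derive x 1 F (w x))
  (cw : forall x : R, 0 < x -> {for x, continuous w}) (w0 : forall x, 0 < x -> 0 <= w x)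
  (wl : w x @[x --> +oo] --> l) (F_y : F x @[x --> +oo] --> +oo)
  (F_small : forall s, 0 < s -> exists2 x, 0 < x & F x <= s).

(** The weight blows up at 0 in both uses. The substitution is therefore made on [a_n, +oo[ with a_n
    = 1 / (n + 1), and both sides pass to the limit by monotone convergence; [F_small] ensures that
    the half-lines [F(a_n), +oo[ exhaust ]0, +oo[. *)
Lemma ge0_substitution0y (G : R -> R) : continuous G -> (forall x, 0 <= G x) ->
  (\int[mu]_(x in `]0%R, +oo[) (G (F x) * w x)%:E = \int[mu]_(s in `]0%R, +oo[) (G s)%:E)%E.
Proof.
move=> cG G0.
have cF (x : R) : 0 < x -> {for x, continuous F}.
  by move=> x0; apply/differentiable_continuous/derivable1_diffP; case: (dF x0).
have d1F (x : R) : 0 < x -> derive1 F x = w x by move=> x0; rewrite derive1E; case: (dF x0).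
have F_le (x y : R) : 0 <= x -> x <= y -> F x <= F y.
  move=> x0; rewrite le_eqVlt => /predU1P[->//|xy]; apply/ltW/F_lt => //; rewrite in_itv/= andbT//.
  by apply: le_trans x0 _; exact: ltW.
have mw : measurable_fun (`]0, +oo[%classic : set mR) (fun x : mR => G (F x) * w x).
  apply: open_continuous_measurable_fun; first exact: interval_open.
  move=> x; rewrite inE/= in_itv/= andbT => x0.
  by apply: cvgM; [apply: continuous_comp; [exact: cF|exact: cG]|exact: cw].
pose a n : R := harmonic n.
have a0 n : 0 < a n by exact: harmonic_gt0.
have F_gt0 (x : R) : 0 < x -> 0 < F x by move=> x0; rewrite -F0; apply: F_lt; rewrite ?in_itv/= ?lexx// ltW.
have an m n : (m <= n)%N -> a n <= a m by move=> mn; rewrite lef_pV2 ?posrE ?ltr0n// ler_nat.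
have E n : (\int[mu]_(x in `[a n, +oo[) (G (F x) * w x)%:E = \int[mu]_(s in `[F (a n), +oo[) (G s)%:E)%E.
  rewrite (@increasing_ge0_integration_by_substitutiony R F G (a n)).
  - apply: eq_integral => x; rewrite inE/= in_itv/= andbT => ax.
    by congr EFin; rewrite fctE d1F//; exact: lt_le_trans ax.
  - by move=> x y; rewrite !in_itv/= !andbT => ax ay; apply: F_lt; rewrite in_itv/= andbT; apply: ltW; apply: lt_le_trans (a0 n) _.
  - move=> x; rewrite in_itv/= andbT => ax; have x0 := lt_trans (a0 n) ax.
    rewrite /continuous_at d1F//.
    have c : w y @[y --> x] --> (w x : R) by exact: cw.
    apply: cvg_trans c.
    apply: near_eq_cvg; near=> y; rewrite d1F//.
    by near: y; exact: lt_nbhsr.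
  - apply/cvg_ex; exists (w (a n)).
    have c : w y @[y --> (a n)^'+] --> (w (a n) : R) by apply: cvg_at_right_filter; exact: cw.
    apply: cvg_trans c.
    apply: near_eq_cvg; near=> y; rewrite d1F//.
    by apply: (lt_trans (a0 n)).
  - apply/cvg_ex; exists l; apply: cvg_trans wl.
    by apply: near_eq_cvg; near=> y; rewrite d1F.
  - split; last by apply: cvg_at_right_filter; exact: cF.
    by move=> x; rewrite in_itv/= andbT => ax; case: (dF (lt_trans (a0 n) ax)).
  - exact: F_y.
  - exact: continuous_subspaceT.
  - by move=> x _.
have L (b : nat -> R) (H : R -> R) : (forall n, 0 < b n) -> (forall m n, (m <= n)%N -> b n <= b m) ->
    (forall s, 0 < s -> exists n, b n <= s) -> (forall x, 0 < x -> 0 <= H x) ->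
    measurable_fun (`]0, +oo[%classic : set mR) (H : mR -> R) ->
    (\int[mu]_(x in `[b n, +oo[) (H x)%:E @[n --> \oo] --> \int[mu]_(x in `]0%R, +oo[) (H x)%:E)%E.
  move=> b0 bn bs H0 mH; rewrite -(bigcup_itv b0 bs).
  have sub n : `[b n, +oo[%classic `<=` `]0, +oo[%classic.
    by move=> x; rewrite /= !in_itv/= !andbT; exact: lt_le_trans.
  apply: ge0_nondecreasing_set_cvg_integral.
  - by move=> m n mn; apply/subsetPset => x; rewrite /= !in_itv/= !andbT; apply: le_trans; exact: bn.
  - by [].
  - by move=> n; apply/measurable_EFinP; exact: measurable_funS mH.
  - by move=> n x; rewrite /= in_itv/= andbT lee_fin => bx; apply: H0; exact: lt_le_trans bx.
have h1 := L a (fun x => G (F x) * w x) a0 an (@harmonic_le) (fun x x0 => mulr_ge0 (G0 _) (w0 x0)) mw.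
have h2 : (\int[mu]_(x in `[F (a n), +oo[) (G x)%:E @[n --> \oo] --> \int[mu]_(x in `]0%R, +oo[) (G x)%:E)%E.
  apply: L; last first.
  - by apply: measurable_funTS; exact: continuous_measurable_fun.
  - by move=> x _.
  - move=> s /F_small[x x0 Fx]; have [n hn] := harmonic_le x0; exists n.
    by apply: le_trans Fx; apply: F_le => //; exact: ltW.
  - by move=> m n mn; apply: F_le; [exact: ltW|exact: an].
  - by move=> n; exact: F_gt0.
move: h1; under eq_cvg do rewrite E.
move=> h1; exact: (cvg_unique _ h1 h2).
Unshelve. all: by end_near. Qed.

End Substitution.

Lemma arsinh_sqrt_small (s : R) : 0 < s -> exists2 x, 0 < x & arsinh_sqrt x <= s.
Proof.
move=> s0; exists (rsinh s ^+ 2); last by rewrite arsinh_sqrtK// ltW.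
by rewrite exprn_gt0// divr_gt0// subr_gt0 ltr_expR; lra.
Qed.

Lemma ge0_arsinh_sqrt_subst (G : R -> R) : continuous G -> (forall x, 0 <= G x) ->
  (\int[mu]_(x in `]0%R, +oo[) (G (arsinh_sqrt x) * leg_weight x)%:E = \int[mu]_(s in `]0%R, +oo[) (2 * G s)%:E)%E.
Proof.
move=> cG G0.
have w2 : leg_weight x / 2 @[x --> +oo] --> (0 / 2 : R) by apply: cvgM; [exact: leg_weight_cvg0|exact: cvg_cst].
rewrite -(@ge0_substitution0y arsinh_sqrt (fun x => leg_weight x / 2) (0 / 2) arsinh_sqrt_lt arsinh_sqrt0 is_derive_arsinh_sqrt _ _ w2 arsinh_sqrt_cvgy arsinh_sqrt_small (fun s => 2 * G s)).
- by apply: eq_integral => x _; congr EFin; field.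
- by move=> x x0; apply: cvgM; [exact: continuous_leg_weight|exact: cvg_cst].
- by move=> x x0; rewrite divr_ge0// invr_ge0 mulr_ge0 ?sqrtr_ge0.
- by move=> x; apply: cvgM; [exact: cvg_cst|exact: cG].
- by move=> x; rewrite mulr_ge0.
Qed.

(** This is Gamma(1/2), the normalisation of the Legendre function with mu = 1/2. The substitution s
    = sqrt x turns it into twice the Gaussian integral over the half-line. *)
Lemma integral_gamma_half :
  (\int[mu]_(x in `]0%R, +oo[) (expR (- x) / Num.sqrt x)%:E = (Num.sqrt pi)%:E)%E.
Proof.
have s0 (x : R) : 0 < x -> 0 < Num.sqrt x by rewrite sqrtr_gt0.
have wl : (2 * Num.sqrt x)^-1 @[x --> +oo] --> (0 : R).
  apply/cvgrPdist_le => e e0; near=> x.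
  have x0 : 0 < x by near: x; apply: nbhs_pinfty_gt; exact: num_real.
  have xe : (e^-1) ^+ 2 <= x by near: x; apply: nbhs_pinfty_ge; exact: num_real.
  have h : e^-1 <= Num.sqrt x.
    by rewrite (le_trans (ler_norm _))// -sqrtr_sqr ler_sqrt// ltW.
  rewrite sub0r normrN ger0_norm; last by rewrite invr_ge0 mulr_ge0 ?sqrtr_ge0.
  rewrite invf_ple ?posrE ?mulr_gt0 ?s0//; apply: le_trans h _; have := s0 _ x0; lra.
have Fy : Num.sqrt x @[x --> +oo] --> (+oo : set_system R).
  apply/cvgryPge => A; near=> x.
  have x0 : 0 < x by near: x; apply: nbhs_pinfty_gt; exact: num_real.
  have xA : A ^+ 2 <= x by near: x; apply: nbhs_pinfty_ge; exact: num_real.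
  by rewrite (le_trans (ler_norm A))// -sqrtr_sqr ler_sqrt// ltW.
have cg : continuous (fun s : R => 2 * gauss_fun s).
  by move=> s; apply: cvgM; [exact: cvg_cst|exact: continuous_gauss_fun].
transitivity (\int[mu]_(s in `]0%R, +oo[) (2 * gauss_fun s)%:E)%E; last first.
  under eq_integral do rewrite EFinM.
  have mg : measurable_fun (`]0, +oo[%classic : set mR) (EFin \o @gauss_fun R).
    apply/measurable_EFinP; apply: measurable_funTS; exact: measurable_gauss_fun.
  rewrite ge0_integralZl//; last by move=> x _; rewrite lee_fin gauss_fun_ge0.
  by rewrite integral_itv_obnd_cbnd// integral0y_gauss -EFinM; congr EFin; field.
rewrite -(@ge0_substitution0y Num.sqrt (fun x => (2 * Num.sqrt x)^-1) 0 _ (sqrtr0 R) (@is_derive1_sqrt R) _ _ wl Fy _ _ cg).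
- apply: eq_integral => x; rewrite inE/= in_itv/= andbT => x0; congr EFin.
  by rewrite /gauss_fun sqr_sqrtr ?ltW//; field; rewrite gt_eqF ?s0.
- move=> x y; rewrite !in_itv/= !andbT => x0 y0 xy; rewrite ltr_sqrt//; exact: le_lt_trans xy.
- move=> x x0; apply: cvgV; first by rewrite mulf_neq0// gt_eqF ?s0.
  by apply: cvgM; [exact: cvg_cst|exact: sqrt_continuous].
- by move=> x x0; rewrite invr_ge0 mulr_ge0 ?sqrtr_ge0.
- by move=> s hs; exists (s ^+ 2); [rewrite exprn_gt0|rewrite sqrtr_sqr gtr0_norm].
- by move=> x; rewrite mulr_ge0 ?gauss_fun_ge0.
Unshelve. all: by end_near. Qed.

(** The nonnegative case is applied to |G| and to |G| + G, whose difference gives G. *)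
Lemma arsinh_sqrt_subst (G : R -> R) : continuous G -> mu.-integrable `]0, +oo[ (EFin \o G) ->
  mu.-integrable `]0, +oo[ (EFin \o (fun x => G (arsinh_sqrt x) * leg_weight x)) /\
  \int[mu]_(x in `]0, +oo[) (G (arsinh_sqrt x) * leg_weight x) = 2 * \int[mu]_(s in `]0, +oo[) G s.
Proof.
move=> cG iG.
have mD : measurable (`]0, +oo[%classic : set mR) by [].
have w0 (x : R) : 0 <= leg_weight x by rewrite invr_ge0 mulr_ge0 ?sqrtr_ge0.
have key (H : R -> R) : continuous H -> (forall x, 0 <= H x) -> mu.-integrable `]0, +oo[ (EFin \o H) ->
  mu.-integrable `]0, +oo[ (EFin \o (fun x => H (arsinh_sqrt x) * leg_weight x)) /\
  \int[mu]_(x in `]0, +oo[) (H (arsinh_sqrt x) * leg_weight x) = 2 * \int[mu]_(s in `]0, +oo[) H s.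
  move=> cH H0 iH; have e := ge0_arsinh_sqrt_subst cH H0.
  have i2 := integrable_scale mD 2 iH.
  split; last by rewrite -RintegralZl// /Rintegral e.
  apply/integrableP; split.
    apply/measurable_EFinP; apply: open_continuous_measurable_fun; first exact: interval_open.
    move=> x; rewrite inE/= in_itv/= andbT => x0.
    apply: cvgM; last exact: continuous_leg_weight.
    apply: (@continuous_comp _ _ _ arsinh_sqrt H); last exact: cH.
    by apply/differentiable_continuous/derivable1_diffP; case: (is_derive_arsinh_sqrt x0).
  rewrite [X in (X < _)%E](_ : _ = \int[mu]_(x in `]0%R, +oo[) (2 * H x)%:E)%E.
    by have := integrable_fin_num mD i2; rewrite fin_numElt => /andP[].
  by rewrite -e; apply: eq_integral => x _ /=; rewrite ger0_norm// mulr_ge0.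
have cN : continuous (fun s => `|G s|) by move=> s; apply: cvg_norm; exact: cG.
have iN := integrable_norm iG.
have [i1 e1] := key (fun s => `|G s|) cN (fun s => normr_ge0 _) iN.
have [i2 e2] : mu.-integrable `]0, +oo[ (EFin \o (fun x => (`|G (arsinh_sqrt x)| + G (arsinh_sqrt x)) * leg_weight x)) /\
  \int[mu]_(x in `]0, +oo[) ((`|G (arsinh_sqrt x)| + G (arsinh_sqrt x)) * leg_weight x) = 2 * \int[mu]_(s in `]0, +oo[) (`|G s| + G s).
  apply: (key (fun s => `|G s| + G s)).
  - by move=> s; apply: cvgD; [exact: cN|exact: cG].
  - by move=> s; rewrite -lerBlDr sub0r lerNl lerNnormlW.
  - exact: (integrable_add mD iN iG).
have E : (fun x => G (arsinh_sqrt x) * leg_weight x) = (fun x => (`|G (arsinh_sqrt x)| + G (arsinh_sqrt x)) * leg_weight x - `|G (arsinh_sqrt x)| * leg_weight x).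
  by apply/funext => x; ring.
split; first by rewrite E; exact: (integrable_sub mD i2 i1).
rewrite [X in Rintegral _ _ X]E (RintegralB mD i2 i1) e1 e2 (RintegralD mD iN iG); ring.
Qed.

End ArsinhSqrt.

(** * Integrals over the whole line *)

Section LineIntegrals.
Context {R : realType}.
Local Notation mu := (@lebesgue_measure R).
Local Notation mR := (measurableTypeR R).

Lemma integrable_opp (f : R -> R) : mu.-integrable setT (EFin \o f) ->
  mu.-integrable setT (EFin \o (fun x => f (- x))).
Proof.
move=> i_f.
have mN : measurable_fun (setT : set mR) (-%R : mR -> mR) by [].
apply/integrableP; split.
  have mf : measurable_fun (setT : set mR) (f : mR -> R) by apply/measurable_EFinP; exact: measurable_int i_f.
  by apply/measurable_EFinP; exact: (measurableT_comp mf mN).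
have : (\int[pushforward mu (-%R : mR -> mR)]_y (`|(EFin \o f) y|) < +oo)%E.
  rewrite (eq_measure_integral mu).
    by have /integrableP[] := i_f.
  by move=> A mA _; exact: lebesgue_measureN.
rewrite ge0_integral_pushforward//.
by apply: measurableT_comp => //; exact: measurable_int i_f.
Qed.

(** Folding cancels odd parts: it is how the sine term in tau disappears and a half-line cosine
    integral remains. *)
Lemma Rintegral_fold (f : R -> R) : mu.-integrable setT (EFin \o f) ->
  \int[mu]_x f x = \int[mu]_(x in `]0, +oo[) (f x + f (- x)).
Proof.
move=> i_f; have i_n := integrable_opp i_f.
have sub (h : R -> R) (D : set mR) : measurable D -> mu.-integrable setT (EFin \o h) -> mu.-integrable D (EFin \o h).
  by move=> mD; exact: integrableS.
have mD : measurable (`]0, +oo[%classic : set mR) by [].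
have mN0 : measurable (`]-oo, 0]%classic : set mR) by [].
rewrite (RintegralD mD (sub _ _ mD i_f) (sub _ _ mD i_n)).
have e : \int[mu]_(x in `]-oo, 0]) f x = \int[mu]_(x in `]0, +oo[) f (- x).
  rewrite (@Rintegral_itv_obnd_cbnd R 0 +oo%O (fun x => f (- x))); last by apply: sub.
  rewrite /Rintegral; congr fine.
  have mN : measurable_fun (setT : set mR) (-%R : mR -> mR) by [].
  transitivity (\int[pushforward mu (-%R : mR -> mR)]_(y in `]-oo, 0%R]) ((EFin \o f) y))%E.
    by apply: eq_measure_integral => A mA _; exact/esym/lebesgue_measureN.
  have pre : (-%R : mR -> mR) @^-1` `]-oo, 0]%classic = `[0, +oo[%classic.
    by apply/seteqP; split => x /=; rewrite !in_itv/= ?andbT oppr_le0.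
  rewrite integral_pushforward ?pre//; first exact: measurable_int i_f.
  exact: sub i_n.
rewrite -e addrC -(Rintegral_setU mN0 mD).
- by congr (Rintegral _ _ _); apply/seteqP; split => x//= _; rewrite /= !in_itv/= andbT; apply/orP; case: leP.
- by apply: sub => //; exact: measurableU.
- apply/disj_setPS => x /=; rewrite !in_itv/= andbT => -[]; lra.
Qed.

Lemma integrable_oneDsqrV : mu.-integrable setT (EFin \o (fun t => (1 + t ^+ 2)^-1)).
Proof.
have p (t : R) : 0 < 1 + t ^+ 2 by rewrite ltr_pwDl// sqr_ge0.
have c : continuous (fun t : R => (1 + t ^+ 2)^-1).
  move=> t; apply: cvgV; first by rewrite gt_eqF.
  by apply: cvgD; [exact: cvg_cst|exact: exprn_continuous].
apply/integrableP; split; first by apply/measurable_EFinP; exact: continuous_measurable_fun.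
rewrite [X in (X < _)%E](_ : _ = \int[mu]_t ((1 + t ^+ 2)^-1)%:E)%E; last first.
  by apply: eq_integral => t _ /=; rewrite ger0_norm// invr_ge0 ltW.
rewrite ge0_symfun_integralT//.
- rewrite (_ : [set x | (0 <= x)%R] = `[0, +oo[%classic); last first.
    by apply/seteqP; split => x /=; rewrite in_itv/= andbT.
  have i0 := integrable_cauchy (0 : R).
  rewrite -integral_itv_obnd_cbnd; last by apply/measurable_EFinP/measurable_funTS; exact: continuous_measurable_fun.
  have mD : measurable (`]0, +oo[%classic : set mR) by [].
  have := integrable_fin_num mD i0.
  rewrite [X in X \is a fin_num](_ : _ = \int[mu]_(t in `]0%R, +oo[) ((1 + t ^+ 2)^-1)%:E)%E.
    by move=> /fineK <-; rewrite -EFinM ltry.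
  by apply: eq_integral => t _ /=; rewrite subr0.
- by move=> t; rewrite invr_ge0 ltW.
- by move=> t /=; rewrite sqrrN.
Qed.

End LineIntegrals.

(** * The double integral in real form *)

Section LegendreWave.
Context {R : realType}.
Local Notation mu := (@lebesgue_measure R).
Local Notation mR := (measurableTypeR R).

Section Measurability.
Context d (T : measurableType d).
Implicit Types f : T -> R.

Lemma measurable_fun_rcosh f : measurable_fun setT f -> measurable_fun setT (fun x => rcosh (f x)).
Proof.
move=> mf; apply: (measurableT_comp _ mf); apply: continuous_measurable_fun.
exact: (is_derive_continuous is_derive_rcosh).
Qed.

Lemma measurable_fun_powR f p : measurable_fun setT f -> measurable_fun setT (fun x => f x `^ p).
Proof. by move=> mf; exact: (measurableT_comp (measurable_powR p) mf). Qed.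

Lemma measurable_fun_sqrt f : measurable_fun setT f -> measurable_fun setT (fun x => Num.sqrt (f x)).
Proof.
move=> mf; apply: (measurableT_comp _ mf); apply: continuous_measurable_fun; exact: sqrt_continuous.
Qed.

Lemma measurable_fun_arsinh_sqrt f : measurable_fun setT f -> measurable_fun setT (fun x => arsinh_sqrt (f x)).
Proof.
move=> mf; apply: (measurableT_comp (@measurable_ln R)).
by apply: measurable_funD; apply: measurable_fun_sqrt => //; exact: measurable_funD.
Qed.

Lemma measurable_fun_leg_weight f : measurable_fun setT f -> measurable_fun setT (fun x => leg_weight (f x)).
Proof.
move=> mf.
rewrite (_ : (fun x => _) = (fun x => (Num.sqrt (f x) * Num.sqrt (f x + 1)) `^ (-1))); last first.
  by apply/funext => x; rewrite powR_inv1// mulr_ge0 ?sqrtr_ge0.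
apply: measurable_fun_powR.
by apply: measurable_funM; apply: measurable_fun_sqrt => //; exact: measurable_funD.
Qed.

End Measurability.

Variables (al be a b k1 k2 sg phi : R).
Hypotheses (al0 : 0 < al) (be0 : 0 < be) (a0 : 0 < a) (sg1 : sg = 1 \/ sg = -1).

(** Up to the factor 1 / sqrt pi, the Legendre function divided by the fourth root of x (x + 1). *)
Definition leg_kernel (t x : R) := cos (2 * t * arsinh_sqrt x) * leg_weight x.
(* The sign sg distinguishes the two exponentials of cosh(nu u); phi = 0 gives the
   real part and phi = pi / 2 the imaginary part. *)
Definition wave (t x u : R) := expR (k1 * u - a * (rcosh u `^ al * (x + 1) `^ (be / 2))) *
  cos (k2 * u + sg * (2 * t * u) - b * (rcosh u `^ al * (x + 1) `^ (be / 2)) - phi).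

Lemma measurable_leg_kernel d (T : measurableType d) (t x : T -> R) : measurable_fun setT t -> measurable_fun setT x ->
  measurable_fun setT (fun w => leg_kernel (t w) (x w)).
Proof.
move=> mt mx; apply: measurable_funM; last exact: measurable_fun_leg_weight.
by apply: measurable_cosM; apply: measurable_funM; [exact: measurable_funM|exact: measurable_fun_arsinh_sqrt].
Qed.

Lemma measurable_wave d (T : measurableType d) (t x u : T -> R) :
  measurable_fun setT t -> measurable_fun setT x -> measurable_fun setT u ->
  measurable_fun setT (fun w => wave (t w) (x w) (u w)).
Proof.
move=> mt mx mu'.
have mcq : measurable_fun setT (fun w => rcosh (u w) `^ al * (x w + 1) `^ (be / 2)).
  by apply: measurable_funM; apply: measurable_fun_powR; [exact: measurable_fun_rcosh|exact: measurable_funD].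
apply: measurable_funM.
  apply: measurableT_comp => //.
  by apply: measurable_funB; exact: measurable_funM.
apply: measurable_cosM; apply: measurable_funB => //; apply: measurable_funB; last exact: measurable_funM.
apply: measurable_funD; first exact: measurable_funM.
by apply: measurable_funM => //; apply: measurable_funM => //; exact: measurable_funM.
Qed.

Let mD : measurable (`]0, +oo[%classic : set mR). Proof. by []. Qed.

Let h1 (x : R) := expR (- (a / 2 * rcosh (arsinh_sqrt x) `^ be)) * leg_weight x.
Let h2 (u : R) := expR (k1 * u - a / 2 * rcosh u `^ al).

Let ih1 : mu.-integrable `]0, +oo[ (EFin \o h1).
Proof.
have a2 : 0 < a / 2 by rewrite divr_gt0.
have [] // := @arsinh_sqrt_subst R (fun s => expR (- (a / 2 * rcosh s `^ be))) _ (integrable_expRN_rcosh be0 a2).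
apply: (@is_derive_continuous R _ (fun x => - (a / 2 * (be * rtanh x * rcosh x `^ be)) * expR (- (a / 2 * rcosh x `^ be)))) => x.
have d := is_derive_rcosh_powR be x.
by apply: is_derive_eq; rewrite /GRing.scale/=; ring.
Qed.

Let ih2 : mu.-integrable `]0, +oo[ (EFin \o h2).
Proof. by apply: integrable_expR_rcosh => //; rewrite divr_gt0. Qed.

(** The exponent contains the product C Q. As C and Q are at least 1, 2 C Q >= C + Q, which
    separates the variables and yields the product majorant needed for Fubini. *)
Lemma wave_le (t x u : R) : 0 <= x -> `|wave t x u| <= expR (- (a / 2 * rcosh (arsinh_sqrt x) `^ be)) * h2 u.
Proof.
move=> x0; rewrite /wave normrM ger0_norm ?expR_ge0// (le_trans (ler_piMr _ (cos_max _)))// ?expR_ge0//.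
rewrite -expRD ler_expR -rcosh_arsinh_sqrt_powR//.
have := rcosh_powR_ge1 u (ltW al0); have := rcosh_powR_ge1 (arsinh_sqrt x) (ltW be0).
move: (rcosh u `^ al) (rcosh (arsinh_sqrt x) `^ be) => C Q Q1 C1.
have : 0 <= a * ((C - 1) * Q + (Q - 1) * C) by rewrite mulr_ge0 ?(ltW a0)// addr_ge0// mulr_ge0//; lra.
lra.
Qed.

Lemma leg_weight_ge0 (x : R) : 0 <= leg_weight x.
Proof. by rewrite invr_ge0 mulr_ge0 ?sqrtr_ge0. Qed.

Lemma leg_kernel_le (t x : R) : `|leg_kernel t x| <= leg_weight x.
Proof. by rewrite /leg_kernel normrM (ger0_norm (leg_weight_ge0 _)) ler_piMl ?leg_weight_ge0 ?cos_max. Qed.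

Lemma integrable_wave (t x : R) : 0 <= x -> mu.-integrable `]0, +oo[ (EFin \o wave t x).
Proof.
move=> x0; have i := integrable_scale mD (expR (- (a / 2 * rcosh (arsinh_sqrt x) `^ be))) ih2.
apply: (integrable_dominated mD _ i); last by move=> u _; exact: wave_le.
by apply: measurable_funTS; apply: (@measurable_wave _ mR (cst t) (cst x) id).
Qed.

Let fW (t : R) (z : mR * mR) := leg_kernel t z.1 * wave t z.1 z.2.

(** The exchange of x and u at fixed t. The majorant [h1 x * h2 u] does not depend on t, so it says
    nothing about integrability in t. *)
Let fW_fub t :
   mu.-integrable `]0, +oo[ (EFin \o (fun x => \int[mu]_(u in `]0, +oo[) fW t (x, u))) /\
   \int[mu]_(x in `]0, +oo[) \int[mu]_(u in `]0, +oo[) fW t (x, u) =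
   \int[mu]_(u in `]0, +oo[) \int[mu]_(x in `]0, +oo[) fW t (x, u).
Proof.
have [||_ i2 e] := @Rintegral_fubini _ _ _ mR mR mu mu `]0, +oo[ `]0, +oo[ mD mD (fW t) h1 h2 _ ih1 ih2.
- apply: measurable_funM; first by apply: (@measurable_leg_kernel _ (mR * mR)%type (cst t) fst).
  by apply: (@measurable_wave _ (mR * mR)%type (cst t) fst snd).
- move=> x u; rewrite /= in_itv/= andbT => x0 _; rewrite /fW/= normrM.
  rewrite (_ : h1 x * h2 u = leg_weight x * (expR (- (a / 2 * rcosh (arsinh_sqrt x) `^ be)) * h2 u)); last by rewrite /h1; ring.
  by apply: ler_pM => //; [exact: leg_kernel_le|exact: wave_le (ltW x0)].
- by split; [exact: i2|exact: e].
Qed.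

Let innerE t x : 0 < x -> \int[mu]_(u in `]0, +oo[) fW t (x, u) = leg_kernel t x * \int[mu]_(u in `]0, +oo[) wave t x u.
Proof. by move=> x0; rewrite -(RintegralZl _ mD (integrable_wave t (ltW x0))). Qed.

Lemma integrable_leg_wave (t : R) :
  mu.-integrable `]0, +oo[ (EFin \o (fun x => leg_kernel t x * \int[mu]_(u in `]0, +oo[) wave t x u)).
Proof.
have [i _] := fW_fub t.
apply: eq_integrable i => // x; rewrite inE/= in_itv/= andbT => x0.
by rewrite innerE.
Qed.

Let S (t u : R) := \int[mu]_(x in `]0, +oo[) fW t (x, u).
Let psi (u : R) := k2 * u - phi.
Let osc0 (u : R) := osc be (a * rcosh u `^ al) (b * rcosh u `^ al) (psi u).
(** Shifting the phase by pi / 2 turns the cosine into a sine, so that both quadratures are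
    instances of [osc] and share its estimates. *)
Let oscS (u : R) := osc be (a * rcosh u `^ al) (b * rcosh u `^ al) (psi u - pi / 2).

Let A0 u : 0 < a * rcosh u `^ al.
Proof. by rewrite mulr_gt0// powR_gt0// rcosh_gt0. Qed.

(** The factor cosh(u)^al cancels in the ratio of the two parameters, so one constant serves all
    u. *)
Let m := `|b| / a.
Let m0 : 0 <= m. Proof. by rewrite divr_ge0// ltW. Qed.
Let Bm u : `|b * rcosh u `^ al| <= m * (a * rcosh u `^ al).
Proof.
rewrite normrM (ger0_norm (powR_ge0 _ _)) mulrA ler_wpM2r ?powR_ge0// /m divfK//.
by rewrite gt_eqF.
Qed.

Lemma integrable_osc (B psi' A : R) : 0 < A -> forall t,
   mu.-integrable `]0, +oo[ (EFin \o (fun s => cos (2 * t * s) * osc be A B psi' s)) /\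
   continuous (fun s => cos (2 * t * s) * osc be A B psi' s).
Proof.
move=> A0' t.
have cc : continuous (fun s => cos (2 * t * s) * osc be A B psi' s).
  move=> s; apply: cvgM; last exact: (is_derive_continuous (is_derive_osc be A B psi')).
  apply: (@continuous_comp _ _ _ (fun s : R => 2 * t * s) cos); last exact: continuous_cos.
  by apply: cvgM; [exact: cvg_cst|exact: cvg_id].
split => //.
apply: (integrable_dominated mD _ (integrable_expRN_rcosh be0 A0')).
  by apply: measurable_funTS; exact: continuous_measurable_fun.
move=> s _; rewrite normrM (le_trans (ler_piMl _ (cos_max _)))// /osc normrM.
by rewrite (ger0_norm (expR_ge0 _)) ler_piMr ?expR_ge0// cos_max.
Qed.

(** After the substitution the addition formula separates the phase 2 t u from the part depending on
    s. The sign [sg] stays in front of the sine alone, because the cosine is even. *)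
Let SE t u : S t u = expR (k1 * u) * (2 * (cos (2 * u * t) * cos_transform (osc0 u) t - sg * sin (2 * u * t) * cos_transform (oscS u) t)).
Proof.
have [i1 c1] := integrable_osc (b * rcosh u `^ al) (psi u) (A0 u) t.
have [i2 c2] := integrable_osc (b * rcosh u `^ al) (psi u - pi / 2) (A0 u) t.
have [j1 e1] := arsinh_sqrt_subst c1 i1.
have [j2 e2] := arsinh_sqrt_subst c2 i2.
have j1' := integrable_scale mD (cos (2 * u * t)) j1.
have j2' := integrable_scale mD (sg * sin (2 * u * t)) j2.
have j := integrable_sub mD j1' j2'.
transitivity (expR (k1 * u) * (cos (2 * u * t) * (2 * cos_transform (osc0 u) t) - sg * sin (2 * u * t) * (2 * cos_transform (oscS u) t))); last by ring.
rewrite /cos_transform -e1 -e2 -(RintegralZl _ mD j1) -(RintegralZl _ mD j2) -(RintegralB mD j1' j2') -(RintegralZl _ mD j).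
apply: eq_Rintegral => x; rewrite inE/= in_itv/= andbT => x0.
rewrite /fW/= /leg_kernel /wave /osc rcosh_arsinh_sqrt_powR ?ltW//.
set Q := (x + 1) `^ (be / 2); set C := rcosh u `^ al; set th := psi u - b * C * Q.
rewrite (_ : psi u - pi / 2 - b * C * Q = th - pi / 2); last by rewrite /th; ring.
rewrite cosBpihalf (_ : k1 * u - a * (C * Q) = k1 * u + - (a * C * Q)) ?expRD; last by ring.
rewrite (_ : k2 * u + sg * (2 * t * u) - b * (C * Q) - phi = th + sg * (2 * u * t)); last by rewrite /th /psi; ring.
have -> : cos (th + sg * (2 * u * t)) = cos th * cos (2 * u * t) - sin th * (sg * sin (2 * u * t)).
  by rewrite cosD; case: sg1 => ->; rewrite ?mul1r// !mulN1r cosN sinN.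
by ring.
Qed.

Let I0 := \int[mu]_(s in `]0, +oo[) expR (- (a / 4 * rcosh s `^ be)).

Let a4 : 0 < a / 4. Proof. by rewrite divr_gt0. Qed.

(** [osc_bounds] has already halved a; separating C from Q by 2 C Q >= C + Q halves it again, whence
    a / 4. *)
Let I0_ge u : \int[mu]_(s in `]0, +oo[) expR (- (a * rcosh u `^ al / 2 * rcosh s `^ be)) <=
  expR (- (a / 4 * rcosh u `^ al)) * I0.
Proof.
have i0 := integrable_expRN_rcosh be0 a4.
have A2 : 0 < a * rcosh u `^ al / 2 by rewrite divr_gt0.
rewrite -(RintegralZl _ mD i0).
apply: (le_Rintegral mD (integrable_expRN_rcosh be0 A2) (integrable_scale mD _ i0)) => s _.
rewrite -expRD ler_expR.
have := rcosh_powR_ge1 u (ltW al0); have := rcosh_powR_ge1 s (ltW be0).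
move: (rcosh u `^ al) (rcosh s `^ be) => C Q Q1 C1.
have : 0 <= a * ((C - 1) * Q + (Q - 1) * C) by rewrite mulr_ge0 ?(ltW a0)// addr_ge0// mulr_ge0//; lra.
lra.
Qed.

Let K := osc_bound be m.
Let K0 : 0 <= K. Proof. exact: osc_bound_ge0. Qed.

Let cos_transform_osc_le1 u t ps : `|cos_transform (osc be (a * rcosh u `^ al) (b * rcosh u `^ al) ps) t| <=
  K * I0 * expR (- (a / 4 * rcosh u `^ al)) * (1 + t ^+ 2)^-1.
Proof.
have p1 : 0 < 1 + t ^+ 2 by rewrite ltr_pwDl// sqr_ge0.
rewrite ler_pdivlMr// mulrC.
apply: (@le_trans _ _ (K * \int[mu]_(s in `]0, +oo[) expR (- (a * rcosh u `^ al / 2 * rcosh s `^ be)))).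
  have h := cos_transform_osc_le ps be0 (A0 u) t m0 (Bm u); apply: le_trans h.
  by rewrite ler_wpM2r//; have := sqr_ge0 t; lra.
by rewrite -[leRHS]mulrA ler_wpM2l// [leRHS]mulrC; exact: I0_ge.
Qed.

Let H2 (u : R) := 4 * K * I0 * expR (k1 * u - a / 4 * rcosh u `^ al).

(** This majorant, integrable jointly in t and u, is what integrating x first was for. The 4 in [H2]
    is the factor 2 of the substitution times the two quadratures. *)
Let S_le t u : `|S t u| <= (1 + t ^+ 2)^-1 * H2 u.
Proof.
rewrite SE normrM (ger0_norm (expR_ge0 _)) normrM (ger0_norm (_ : 0 <= 2))//.
rewrite (_ : _ * H2 u = expR (k1 * u) * (2 * (K * I0 * expR (- (a / 4 * rcosh u `^ al)) * (1 + t ^+ 2)^-1 +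
    K * I0 * expR (- (a / 4 * rcosh u `^ al)) * (1 + t ^+ 2)^-1))); last first.
  by rewrite /H2 expRD; ring.
rewrite ler_wpM2l ?expR_ge0// ler_wpM2l// (le_trans (ler_normB _ _))// lerD//.
  by rewrite normrM (le_trans (ler_piMl _ (cos_max _)))//; exact: cos_transform_osc_le1.
rewrite normrM (le_trans (ler_piMl _ _))//; last exact: cos_transform_osc_le1.
by rewrite normrM; case: sg1 => ->; rewrite ?normrN normr1 mul1r sin_max.
Qed.

Let S_fub : mu.-integrable setT (EFin \o (fun t => \int[mu]_(u in `]0, +oo[) S t u)) /\
  \int[mu]_t \int[mu]_(u in `]0, +oo[) S t u = \int[mu]_(u in `]0, +oo[) \int[mu]_t S t u.
Proof.
have iH2 : mu.-integrable `]0, +oo[ (EFin \o H2).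
  by have h := integrable_scale mD (4 * K * I0) (integrable_expR_rcosh k1 al0 a4); exact: h.
have mS : measurable_fun setT (fun z : mR * mR => S z.1 z.2).
  apply: (@measurable_Rintegral R _ _ (mR * mR)%type mR mu `]0, +oo[ mD (fun w => leg_kernel w.1.1 w.2 * wave w.1.1 w.2 w.1.2)).
  have m1 : measurable_fun setT (fun w : mR * mR * mR => w.1.1) by exact: (measurableT_comp (@measurable_fst _ _ _ _)).
  have m2 : measurable_fun setT (fun w : mR * mR * mR => w.1.2) by exact: (measurableT_comp (@measurable_snd _ _ _ _)).
  by apply: measurable_funM; [exact: measurable_leg_kernel|exact: measurable_wave].
have [|_ i e] := @Rintegral_fubini _ _ _ mR mR mu mu setT `]0, +oo[ measurableT mD (fun z => S z.1 z.2) (fun t => (1 + t ^+ 2)^-1) H2 mS integrable_oneDsqrV iH2.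
  by move=> t u _ _; exact: S_le.
by split; [exact: i|exact: e].
Qed.

Let cos_transformN (g : R -> R) t : cos_transform g (- t) = cos_transform g t.
Proof. by apply: eq_Rintegral => s _; rewrite mulrN mulNr cosN. Qed.

(** The sine quadrature is odd in t, because cosine transforms are even, and folding cancels it. The
    cosine quadrature appears with factor 4, and inversion evaluates it at s = u with factor pi /
    4. *)
Let intS u : 0 < u -> \int[mu]_t S t u = pi * (expR (k1 * u) * osc0 u u).
Proof.
move=> u0.
have i1 : mu.-integrable setT (EFin \o (S ^~ u)).
  have h := integrable_scale measurableT (H2 u) integrable_oneDsqrV.
  apply: (integrable_dominated measurableT _ h); last by move=> t _; rewrite mulrC; exact: S_le.
  apply: (@measurable_Rintegral R _ _ mR mR mu `]0, +oo[ mD (fun w => leg_kernel w.1 w.2 * wave w.1 w.2 u)).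
  by apply: measurable_funM; [exact: measurable_leg_kernel|apply: (@measurable_wave _ _ fst snd (cst u))].
rewrite Rintegral_fold//.
have inv := cos_transform_osc_inversion (psi u) be0 (A0 u) m0 (Bm u) u0.
transitivity (\int[mu]_(t in `]0, +oo[) (4 * expR (k1 * u) * (cos_transform (osc0 u) t * cos (2 * u * t)))).
  by apply: eq_Rintegral => t _; rewrite !SE !cos_transformN mulrN cosN sinN; ring.
have ic : mu.-integrable `]0, +oo[ (EFin \o (fun t => cos_transform (osc0 u) t * cos (2 * u * t))).
  have i01 : mu.-integrable `]0, +oo[ (EFin \o (fun t => (1 + t ^+ 2)^-1)).
    exact: (integrableS measurableT mD (@subsetT _ _) integrable_oneDsqrV).
  have h := integrable_scale mD (K * I0 * expR (- (a / 4 * rcosh u `^ al))) i01.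
  apply: (integrable_dominated mD _ h).
    apply: measurable_funTS; apply: measurable_funM.
      apply: measurable_cos_transform; apply: continuous_measurable_fun.
      exact: (is_derive_continuous (is_derive_osc _ _ _ _)).
    by apply: measurable_cosM; exact: measurable_funM.
  move=> t _; rewrite normrM (le_trans (ler_piMr _ (cos_max _)))//; exact: cos_transform_osc_le1.
by rewrite (RintegralZl _ mD ic) inv /osc0; field.
Qed.

Let oscE u : expR (k1 * u) * osc0 u u = expR (k1 * u - a * rcosh u `^ (al + be)) * cos (k2 * u - b * rcosh u `^ (al + be) - phi).
Proof.
have c1 : (al + be == 0) ==> (rcosh u != 0).
  by apply/implyP => _; rewrite gt_eqF ?rcosh_gt0.
rewrite /osc0 /osc /psi (powRD c1); set C := _ `^ al; set Q := _ `^ be.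
rewrite (_ : k1 * u - a * (C * Q) = k1 * u + - (a * C * Q)) ?expRD; last by ring.
rewrite (_ : k2 * u - b * (C * Q) - phi = k2 * u - phi - b * C * Q); last by ring.
by rewrite mulrA.
Qed.

Lemma integrable_diagonal_wave :
  mu.-integrable `]0, +oo[ (EFin \o (fun u => expR (k1 * u - a * rcosh u `^ (al + be)) * cos (k2 * u - b * rcosh u `^ (al + be) - phi))).
Proof.
have ab : 0 < al + be by rewrite addr_gt0.
apply: (integrable_dominated mD _ (integrable_expR_rcosh k1 ab a0)).
  have mp : measurable_fun (setT : set mR) (fun u : mR => rcosh u `^ (al + be)).
    by apply: measurable_fun_powR; exact: measurable_fun_rcosh.
  apply: measurable_funTS; apply: measurable_funM.
    apply: measurableT_comp => //; apply: measurable_funB; exact: measurable_funM.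
  apply: measurable_cosM; apply: measurable_funB => //; apply: measurable_funB; exact: measurable_funM.
by move=> u _; rewrite normrM (ger0_norm (expR_ge0 _)) ler_piMr ?expR_ge0// cos_max.
Qed.

Lemma integral_leg_wave :
  mu.-integrable setT (EFin \o (fun t => \int[mu]_(x in `]0, +oo[) (leg_kernel t x * \int[mu]_(u in `]0, +oo[) wave t x u))) /\
  \int[mu]_t \int[mu]_(x in `]0, +oo[) (leg_kernel t x * \int[mu]_(u in `]0, +oo[) wave t x u) =
  pi * \int[mu]_(u in `]0, +oo[) (expR (k1 * u - a * rcosh u `^ (al + be)) * cos (k2 * u - b * rcosh u `^ (al + be) - phi)).
Proof.
have JE : (fun t => \int[mu]_(x in `]0, +oo[) (leg_kernel t x * \int[mu]_(u in `]0, +oo[) wave t x u)) =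
   (fun t => \int[mu]_(u in `]0, +oo[) S t u).
  apply/funext => t; have [_ e] := fW_fub t; rewrite /S -e.
  by apply: eq_Rintegral => x; rewrite inE/= in_itv/= andbT => x0; rewrite innerE.
rewrite JE; have [i e] := S_fub; split; first exact: i.
rewrite e.
transitivity (\int[mu]_(u in `]0, +oo[) (pi * (expR (k1 * u - a * rcosh u `^ (al + be)) * cos (k2 * u - b * rcosh u `^ (al + be) - phi)))).
  apply: eq_Rintegral => u; rewrite inE/= in_itv/= andbT => u0.
  by rewrite (intS u0) oscE.
exact: (RintegralZl _ mD integrable_diagonal_wave).
Qed.

End LegendreWave.

(** * Real power series *)

Section PowerSeries.
Context {R : realType}.
Implicit Types (a b : nat -> R) (M K x h s : R).

Definition psum a x s := pseries a x n @[n --> \oo] --> s.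
Definition psval a x := limn (pseries a x).
(** A lower bound 1 / K for the radius of convergence, in a form that can be propagated along
    recurrences of coefficients. *)
Definition geo_le a M K := forall n, `|a n| <= M * K ^+ n.

Lemma psvalE a x s : psum a x s -> psval a x = s.
Proof. by move=> h; apply: cvg_lim => //. Qed.

Lemma geo_le_cvg a M K x : 0 <= M -> 0 <= K -> geo_le a M K -> `|x| * K < 1 -> cvgn (pseries a x).
Proof.
move=> M0 K0 aM xK; apply: normed_cvg.
apply: (@series_le_cvg _ _ (geometric M (`|x| * K))).
- by move=> n /=.
- by move=> n; rewrite /geometric/= mulr_ge0// exprn_ge0// mulr_ge0.
- by move=> n; rewrite /geometric/= normrM normrX exprMn [_ ^+ n * K ^+ n]mulrC mulrA ler_wpM2r ?exprn_ge0.
- by apply: is_cvg_geometric_series; rewrite ger0_norm ?mulr_ge0.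
Qed.

Lemma geo_le_psum a M K x : 0 <= M -> 0 <= K -> geo_le a M K -> `|x| * K < 1 -> psum a x (psval a x).
Proof. by move=> M0 K0 aM xK; exact: (geo_le_cvg M0 K0 aM xK). Qed.

Lemma bernoulli_ineq (q : R) n : 1 <= q -> 1 + n%:R * (q - 1) <= q ^+ n.
Proof.
move=> q1; elim: n => [|n IH]; first by rewrite mul0r addr0 expr0.
rewrite exprS -[n.+1%:R]natr1.
have q0 : 0 <= q by rewrite (le_trans _ q1).
have h := ler_wpM2l q0 IH.
have n0 : 0 <= n%:R * (q - 1) ^+ 2 by rewrite mulr_ge0// sqr_ge0.
lra.
Qed.

(** The factor n + 1 of the derived series is paid for by enlarging K: with q = K' / K, Bernoulli's
    inequality bounds n by q^n / (q - 1). *)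
Lemma geo_le_diffs a M K K' : 0 <= M -> 0 < K -> K < K' -> geo_le a M K ->
  exists2 M', 0 <= M' & geo_le (pseries_diffs a) M' K'.
Proof.
move=> M0 K0 KK aM.
pose q := K' / K; have q1 : 1 < q by rewrite /q ltr_pdivlMr// mul1r.
have qp : 0 < q - 1 by rewrite subr_gt0.
exists (((q - 1)^-1 + 1) * M * K).
  by rewrite mulr_ge0 ?(ltW K0)// mulr_ge0// addr_ge0// invr_ge0 ltW.
move=> n; rewrite /pseries_diffs normrM (ger0_norm (ler0n _ _)).
have qn : 0 <= q ^+ n by rewrite exprn_ge0//; lra.
have h : n.+1%:R <= ((q - 1)^-1 + 1) * q ^+ n.
  have b := bernoulli_ineq n (ltW q1).
  have b1 : n%:R <= (q - 1)^-1 * q ^+ n.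
    by rewrite mulrC ler_pdivlMr//; lra.
  have b0 : 0 <= n%:R * (q - 1) by rewrite mulr_ge0// ltW.
  by rewrite -[n.+1%:R]natr1 mulrDl mul1r lerD//; lra.
apply: (@le_trans _ _ (((q - 1)^-1 + 1) * q ^+ n * (M * K ^+ n.+1))); first exact: ler_pM.
rewrite (_ : K' = q * K); last by rewrite /q; field; rewrite gt_eqF.
rewrite [(q * K) ^+ n]exprMn [K ^+ n.+1]exprS.
by rewrite (_ : _ * (M * _) = (((q - 1)^-1 + 1) * M * K * (q ^+ n * K ^+ n))); [|ring].
Qed.

Lemma is_derive_psval a M K x : 0 <= M -> 0 < K -> geo_le a M K -> `|x| * K < 1 ->
  is_derive x 1 (psval a) (psval (pseries_diffs a) x) /\
  psum (pseries_diffs a) x (psval (pseries_diffs a) x).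
Proof.
move=> M0 K0 aM xK.
(* Termwise differentiation at x asks for convergence of the series and of its first two derived
   series at some y with |x| < y. Each derivation enlarges the ratio, hence the chain K < K1 < K2 <
   1 / y. *)
pose y := (`|x| + K^-1) / 2.
have xi : `|x| < K^-1 by rewrite -[ltRHS]mul1r ltr_pdivlMr.
have y0 : 0 < y by rewrite divr_gt0// ltr_wpDl// invr_gt0.
have xy : `|x| < y by rewrite /y; lra.
have yK : y * K < 1 by rewrite -ltr_pdivlMr// div1r /y; lra.
have Ky : K < y^-1 by rewrite -[ltRHS]mul1r ltr_pdivlMr// mulrC.
pose K1 := (K + y^-1) / 2; pose K2 := (K1 + y^-1) / 2.
have K1y : K < K1 /\ K1 < y^-1 by rewrite /K1; lra.
have K2y : K1 < K2 /\ K2 < y^-1 by rewrite /K2; lra.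
have K10 : 0 < K1 by lra.
have K20 : 0 < K2 by lra.
have [M1 M10 aM1] := geo_le_diffs M0 K0 K1y.1 aM.
have [M2 M20 aM2] := geo_le_diffs M10 K10 K2y.1 aM1.
have ny : `|y| = y by rewrite gtr0_norm.
have yK1 : `|y| * K1 < 1 by rewrite ny mulrC -ltr_pdivlMr// div1r; lra.
have yK2 : `|y| * K2 < 1 by rewrite ny mulrC -ltr_pdivlMr// div1r; lra.
split; last first.
  apply: (geo_le_psum M10 (ltW K10) aM1).
  apply: le_lt_trans yK1; rewrite ler_wpM2r// ?ltW//; rewrite ny//.
apply: (@pseries_snd_diffs R a y x); last by rewrite ny.
- by apply: (geo_le_cvg M0 (ltW K0) aM); rewrite ny.
- exact: (geo_le_cvg M10 (ltW K10) aM1).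
- exact: (geo_le_cvg M20 (ltW K20) aM2).
Qed.

(** Multiplication of the series by its variable. *)
Definition coef_shift a (n : nat) : R := if n is m.+1 then a m else 0.

Lemma coef_shift_diffs a n : coef_shift (pseries_diffs a) n = n%:R * a n.
Proof. by case: n => [|n]//=; rewrite mul0r. Qed.

Lemma psum_shift a x s : psum a x s -> psum (coef_shift a) x (x * s).
Proof.
move=> h; rewrite /psum -cvg_shiftS /=.
rewrite (_ : (fun n => pseries (coef_shift a) x n.+1) = (fun n => x * pseries a x n)).
  by apply: cvgM => //; exact: cvg_cst.
apply/funext => n; rewrite /pseries /series/= big_nat_recl//= mul0r add0r mulr_sumr.
by apply: eq_bigr => i _; rewrite exprS; ring.
Qed.

Lemma psum_linear a b (k l : R) x s t : psum a x s -> psum b x t ->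
  psum (fun n => k * a n + l * b n) x (k * s + l * t).
Proof.
move=> h1 h2; rewrite /psum.
rewrite (_ : pseries _ x = (fun n => k * pseries a x n + l * pseries b x n)).
  by apply: cvgD; apply: cvgM => //; exact: cvg_cst.
apply/funext => n; rewrite /pseries /series/= !mulr_sumr -big_split/=.
by apply: eq_bigr => i _; ring.
Qed.

Arguments psum_linear {a b} k l {x s t}.

Lemma psum_unique a x s t : psum a x s -> psum a x t -> s = t.
Proof. by move=> h1 h2; exact: (cvg_unique _ h1 h2). Qed.

Lemma psum0 a : psum a 0 (a 0%N).
Proof.
rewrite /psum -cvg_shiftS /= (_ : (fun n => _) = cst (a 0%N)); first exact: cvg_cst.
apply/funext => n; rewrite /pseries /series/= big_nat_recl//= expr0 mulr1 big1 ?addr0//.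
by move=> i _; rewrite exprS mul0r mulr0.
Qed.

Lemma psum_geo_le a x s : x != 0 -> psum a x s -> exists2 M, 0 <= M & geo_le a M (`|x|^-1).
Proof.
move=> x0 h.
have c : cvgn (pseries a x) by apply/cvg_ex; exists s.
have [M [_ hM]] := cvg_series_bounded c.
exists (`|M| + 1); first by rewrite addr_ge0.
move=> n; rewrite exprVn ler_pdivlMr ?exprn_gt0 ?normr_gt0// -normrX -normrM.
by apply: hM => //=; rewrite (le_lt_trans (ler_norm M))// ltrDl.
Qed.

(** The hypothesis is one-sided because at the endpoint of an interval of vanishing nothing is known
    to the right. By strong induction the lower coefficients vanish, so the series may be divided by
    h^n; letting h tend to 0 from the left gives a_n = 0. *)
Lemma psum_eq0 a (r : R) : 0 < r -> (forall h, - r < h < 0 -> psum a h 0) -> forall n, a n = 0.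
Proof.
move=> r0 ah n.
have [M M0 aM] : exists2 M, 0 <= M & geo_le a M (`|- (r / 2)|^-1).
  apply: (@psum_geo_le a (- (r / 2)) 0); first by rewrite oppr_eq0 mulf_neq0 ?gt_eqF.
  by apply: ah; lra.
move: aM; rewrite normrN gtr0_norm ?divr_gt0//; set K := _^-1 => aM.
have K0 : 0 < K by rewrite invr_gt0 divr_gt0.
elim/ltn_ind: n => n IH.
pose b m := a (n + m)%N.
have bM : geo_le b (M * K ^+ n) K by move=> m; rewrite /b -mulrA -exprD.
have M'0 : 0 <= M * K ^+ n by rewrite mulr_ge0// exprn_ge0// ltW.
have bh h : - r < h < 0 -> psum b h 0.
  move=> hh; have h0 : h ^+ n != 0 by rewrite expf_neq0// lt_eqF//; lra.
  have := ah h hh; rewrite /psum -(cvg_shiftn n) => /(@cvgM _ _ _ _ (cst (h ^+ n)^-1) _ _ _ (cvg_cst _)).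
  rewrite mulr0; apply: cvg_trans; apply: near_eq_cvg; apply: nearW => m.
  rewrite /pseries /series /= (big_cat_nat _ (leq_addl m n))//=.
  rewrite big_nat_cond big1 ?add0r; last by move=> i /andP[/andP[_ i_n] _]; rewrite IH// mul0r.
  rewrite -[X in \sum_(X <= _ < _) _]add0n big_addn addnK mulr_sumr.
  by apply: eq_bigr => i _; rewrite addnC exprD /b; field.
have d0 : is_derive (0 : R) 1 (psval b) (psval (pseries_diffs b) 0).
  by have [] := @is_derive_psval b _ K 0 M'0 K0 bM _; rewrite ?normr0 ?mul0r.
have c0 : {for (0 : R), continuous (psval b)} by apply/differentiable_continuous/derivable1_diffP; case: d0.
have l1 : psval b h @[h --> 0^'-] --> psval b 0 by apply: cvg_at_left_filter.
have l2 : psval b h @[h --> 0^'-] --> (0 : R).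
  apply: cvg_near_cst; near=> h; apply/psvalE/bh.
  apply/andP; split; near: h; last exact: nbhs_left_lt.
  by apply: nbhs_left_gt; rewrite oppr_lt0.
have := cvg_unique _ l1 l2; rewrite (psvalE (@psum0 b)) /b addn0; exact.
Unshelve. all: by end_near. Qed.

End PowerSeries.
Arguments psum_linear {R a b} k l {x s t}.

(** * Power series solution of the Legendre system at an ordinary point *)

Section LocalSolution.
Context {R : realType}.
Variables (tau D m : R).
Hypotheses (D0 : 0 < D) (m0 : 0 <= m).

(** Chosen so that every coefficient in the numerators of [ode_step n] is at most C0 (n + 1);
    dividing by D (n + 1) leaves C0 / D. *)
Let C0 := m + 2 + `|tau| * (D + m + 1).

(* Coefficients number n, n - 1 and n - 2 of the two series; those of negative index are 0. *)
Record ode_state := OdeState { s_a : R; s_b : R; s_a1 : R; s_b1 : R; s_a2 : R }.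

(* The system solved is, with p = D + m h + h^2,
     p f' = - (m + 2 h) / 4 f - tau g,   p g' = (m + 2 h) / 4 g + tau p f,
   satisfied by legendre_cos and legendre_sin at x0 + h when p = (x0 + h) (x0 + h + 1). *)
Definition ode_step n s := OdeState
  (((- (m * n%:R) - m / 4) * s_a s + (- (n%:R - 1) - 2^-1) * s_a1 s - tau * s_b s) / (D * n.+1%:R))
  (((- (m * n%:R) + m / 4) * s_b s + (- (n%:R - 1) + 2^-1) * s_b1 s +
     tau * (D * s_a s + m * s_a1 s + s_a2 s)) / (D * n.+1%:R))
  (s_a s) (s_b s) (s_a1 s).

Fixpoint ode_states (s0 : ode_state) n := if n is n'.+1 then ode_step n' (ode_states s0 n') else s0.

Let N s := `|s_a s| + `|s_b s| + `|s_a1 s| + `|s_b1 s| + `|s_a2 s|.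

Let lin5 (C c1 c2 c3 c4 c5 : R) s : `|c1| <= C -> `|c2| <= C -> `|c3| <= C -> `|c4| <= C -> `|c5| <= C ->
  `|c1 * s_a s + c2 * s_b s + c3 * s_a1 s + c4 * s_b1 s + c5 * s_a2 s| <= C * N s.
Proof.
move=> h1 h2 h3 h4 h5; rewrite /N !mulrDr.
do 4 (rewrite (le_trans (ler_normD _ _))//; apply: lerD; last by rewrite normrM ler_wpM2r).
by rewrite normrM ler_wpM2r.
Qed.

Let coef (c : R) n : `|c| <= C0 * n.+1%:R -> `|c / (D * n.+1%:R)| <= C0 / D.
Proof.
move=> h; have n1 : 0 < n.+1%:R :> R by [].
rewrite normrM normfV (ger0_norm (mulr_ge0 (ltW D0) (ltW n1))).
by rewrite ler_pdivrMr ?mulr_gt0// mulrA divfK// gt_eqF.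
Qed.

Let coefs n : [/\ `|- (m * n%:R) - m / 4| <= C0 * n.+1%:R, `|- (m * n%:R) + m / 4| <= C0 * n.+1%:R,
   `|- (n%:R - 1) - 2^-1| <= C0 * n.+1%:R, `|- (n%:R - 1) + 2^-1| <= C0 * n.+1%:R &
   [/\ `|0 : R| <= C0 * n.+1%:R, `|tau| <= C0 * n.+1%:R, `|tau * D| <= C0 * n.+1%:R & `|tau * m| <= C0 * n.+1%:R]].
Proof.
have n0 : 0 <= n%:R :> R by [].
have t0 : 0 <= `|tau| by [].
have mn : 0 <= m * n%:R by rewrite mulr_ge0.
have td : 0 <= `|tau| * D by rewrite mulr_ge0// ltW.
have tm : 0 <= `|tau| * m by rewrite mulr_ge0.
have tn : 0 <= `|tau| * (D + m + 1) * n%:R by rewrite !mulr_ge0// !addr_ge0// ltW.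
have e : C0 * n.+1%:R = m * n%:R + m + 2 * n%:R + 2 + `|tau| * (D + m + 1) * n%:R + (`|tau| * D + `|tau| * m + `|tau|).
  by rewrite /C0 -[n.+1%:R]natr1; ring.
rewrite e normr0 !normrM (gtr0_norm D0) (ger0_norm m0).
have m0' := m0; clear e; move: t0 mn td tm tn n0 m0'.
set A1 := m * n%:R; set A2 := `|tau| * D; set A3 := `|tau| * m; set A4 := `|tau| * (D + m + 1) * n%:R.
move: A1 A2 A3 A4 `|tau| (n%:R : R) => A1 A2 A3 A4 A5 A6 *.
by split; [..|split]; rewrite ?ler_norml; first [lra|apply/andP; split; lra].
Qed.

Let ode_step_le n s : N (ode_step n s) <= (2 * (C0 / D) + 1) * N s.
Proof.
have [c1 c2 c3 c4 [z0 c5 c6 c7]] := coefs n.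
have n1 : n.+1%:R != 0 :> R by [].
have Dn : D != 0 by rewrite gt_eqF.
have ha : `|s_a (ode_step n s)| <= C0 / D * N s.
  rewrite (_ : s_a _ = (- (m * n%:R) - m / 4) / (D * n.+1%:R) * s_a s + (- tau) / (D * n.+1%:R) * s_b s +
    (- (n%:R - 1) - 2^-1) / (D * n.+1%:R) * s_a1 s + 0 / (D * n.+1%:R) * s_b1 s + 0 / (D * n.+1%:R) * s_a2 s); last first.
    by rewrite /=; move: (n.+1%:R) n1 => X X0; field; rewrite Dn X0.
  by apply: lin5; apply: coef; rewrite ?normrN.
have hb : `|s_b (ode_step n s)| <= C0 / D * N s.
  rewrite (_ : s_b _ = (tau * D) / (D * n.+1%:R) * s_a s + (- (m * n%:R) + m / 4) / (D * n.+1%:R) * s_b s +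
    (tau * m) / (D * n.+1%:R) * s_a1 s + (- (n%:R - 1) + 2^-1) / (D * n.+1%:R) * s_b1 s + tau / (D * n.+1%:R) * s_a2 s); last first.
    by rewrite /=; move: (n.+1%:R) n1 => X X0; field; rewrite Dn X0.
  by apply: lin5; apply: coef.
rewrite /N /= in ha hb *.
have := normr_ge0 (s_b1 s); have := normr_ge0 (s_a2 s).
move: ha hb; set u := `|_ / _|; set v := `|_ / _|; set c := C0 / D; lra.
Qed.

Let C0_ge0 : 0 <= C0.
Proof. by rewrite /C0 addr_ge0 ?mulr_ge0 ?addr_ge0// ltW. Qed.

(** Each of the two new coefficients costs C0 / D times the norm of the state, and the three that
    are carried over cost at most that norm once. *)
Let K := 2 * (C0 / D) + 1.

Let ode_states_le s0 n : N (ode_states s0 n) <= N s0 * K ^+ n.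
Proof.
elim: n => [|n IH]; first by rewrite expr0 mulr1.
rewrite (le_trans (ode_step_le _ _))// exprS (mulrCA (N s0)) ler_wpM2l//.
by rewrite addr_ge0// mulr_ge0// divr_ge0// ltW.
Qed.

Variables (a0 b0 : R).
Let st := ode_states (OdeState a0 b0 0 0 0).
Let a n := s_a (st n).
Let b n := s_b (st n).

Let sa1 n : s_a1 (st n) = coef_shift a n. Proof. by case: n. Qed.
Let sb1 n : s_b1 (st n) = coef_shift b n. Proof. by case: n. Qed.
Let sa2 n : s_a2 (st n) = coef_shift (coef_shift a) n. Proof. by case: n => //= n; rewrite sa1. Qed.

(** At n = 0 the factor n - 1 is -1, a real subtraction, but it multiplies the coefficient of index
    -1, which is 0. *)
Let coef_shift2_diffs (u : nat -> R) n : coef_shift (coef_shift (pseries_diffs u)) n = (n%:R - 1) * coef_shift u n.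
Proof.
by case: n => [|n]/=; rewrite ?mulr0// coef_shift_diffs -[n.+1%:R]natr1 addrK.
Qed.

Let rec_a n : D * pseries_diffs a n + m * coef_shift (pseries_diffs a) n + coef_shift (coef_shift (pseries_diffs a)) n =
  - (m / 4 * a n + 2^-1 * coef_shift a n) - tau * b n.
Proof.
rewrite coef_shift_diffs coef_shift2_diffs /pseries_diffs {1}/a /= -/(st n) -/(a n) -/(b n) sa1.
by have := pnatr_eq0 R n.+1; move: (n.+1%:R) => X /= /negbT X0; field; rewrite X0 gt_eqF.
Qed.

Let rec_b n : D * pseries_diffs b n + m * coef_shift (pseries_diffs b) n + coef_shift (coef_shift (pseries_diffs b)) n =
  (m / 4 * b n + 2^-1 * coef_shift b n) + tau * (D * a n + m * coef_shift a n + coef_shift (coef_shift a) n).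
Proof.
rewrite coef_shift_diffs coef_shift2_diffs /pseries_diffs {1}/b /= -/(st n) -/(a n) -/(b n) sa1 sb1 sa2.
by have := pnatr_eq0 R n.+1; move: (n.+1%:R) => X /= /negbT X0; field; rewrite X0 gt_eqF.
Qed.

(** Since p(0) = D is not 0, the recurrences determine the coefficients of index n + 1, and their
    geometric bound turns the formal series into an actual solution. The equations stay multiplied
    by p, so that all their coefficients are polynomials in h. *)
Lemma legendre_local_solution : exists a b K,
  [/\ 0 < K, a 0%N = a0, b 0%N = b0 &
  forall h, `|h| * K < 1 -> [/\ psum a h (psval a h), psum b h (psval b h) &
   exists a' b', [/\ is_derive h 1 (psval a) a', is_derive h 1 (psval b) b',
     (D + m * h + h ^+ 2) * a' = - ((m + 2 * h) / 4 * psval a h) - tau * psval b h &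
     (D + m * h + h ^+ 2) * b' = (m + 2 * h) / 4 * psval b h + tau * ((D + m * h + h ^+ 2) * psval a h)]]].
Proof.
have K0 : 0 < K by rewrite ltr_pwDr// mulr_ge0// divr_ge0// ltW.
have M0 : 0 <= N (OdeState a0 b0 0 0 0) by rewrite !addr_ge0.
have ga : geo_le a (N (OdeState a0 b0 0 0 0)) K.
  by move=> n; apply: le_trans (ode_states_le _ _); rewrite /N -!addrA lerDl !addr_ge0.
have gb : geo_le b (N (OdeState a0 b0 0 0 0)) K.
  by move=> n; apply: le_trans (ode_states_le _ _); rewrite /N -!addrA addrCA lerDl !addr_ge0.
exists a, b, K; split => // h hK.
have pa := geo_le_psum M0 (ltW K0) ga hK.
have pb := geo_le_psum M0 (ltW K0) gb hK.
have [da pda] := is_derive_psval M0 K0 ga hK.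
have [db pdb] := is_derive_psval M0 K0 gb hK.
split => //; exists (psval (pseries_diffs a) h), (psval (pseries_diffs b) h); split => //.
- have L := psum_linear 1 1 (psum_linear D m pda (psum_shift pda)) (psum_shift (psum_shift pda)).
  have Rr := psum_linear 1 (- tau) (psum_linear (- (m / 4)) (- 2^-1) pa (psum_shift pa)) pb.
  rewrite (_ : (fun n => 1 * (- (m / 4) * a n + _) + _) =
     (fun n => 1 * (D * pseries_diffs a n + m * coef_shift (pseries_diffs a) n) + 1 * coef_shift (coef_shift (pseries_diffs a)) n)) in Rr; last first.
    by apply/funext => n; rewrite !mul1r rec_a; ring.
  by have := psum_unique L Rr; lra.
- have L := psum_linear 1 1 (psum_linear D m pdb (psum_shift pdb)) (psum_shift (psum_shift pdb)).
  have Rr := psum_linear 1 tau (psum_linear (m / 4) (2^-1) pb (psum_shift pb))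
     (psum_linear 1 1 (psum_linear D m pa (psum_shift pa)) (psum_shift (psum_shift pa))).
  rewrite (_ : (fun n => 1 * (m / 4 * b n + _) + _) =
     (fun n => 1 * (D * pseries_diffs b n + m * coef_shift (pseries_diffs b) n) + 1 * coef_shift (coef_shift (pseries_diffs b)) n)) in Rr; last first.
    by apply/funext => n; rewrite !mul1r rec_b; ring.
  by have := psum_unique L Rr; lra.
Qed.

End LocalSolution.

(** * The elementary form of the Legendre function *)

Section LegendreAnalytic.
Context {R : realType}.

Lemma is_derive0_eq (f : R -> R) (l r x y : R) :
  (forall z, l < z < r -> is_derive z 1 f 0) -> l < x < r -> l < y < r -> f x = f y.
Proof.
move=> df; wlog xy : x y / x <= y => [wl hx hy|/andP[lx xr] /andP[ly yr]].
  by have [/wl|/ltW /wl] := leP x y => h; [exact: h|exact/esym/h].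
have [||z _] := @MVT_segment R f (cst 0) x y xy.
- move=> z; rewrite in_itv/= => /andP[xz zy]; apply: df.
  by rewrite (lt_trans lx xz) (lt_trans zy yr).
- apply: derivable_within_continuous => z; rewrite in_itv/= => /andP[xz zy].
  by have [] : is_derive z 1 f 0 by apply: df; rewrite (lt_le_trans lx xz) (le_lt_trans zy yr).
by rewrite mul0r => /eqP; rewrite subr_eq0 => /eqP.
Qed.

Lemma is_derive_addl (x0 h : R) : is_derive h 1 (fun h => x0 + h) 1.
Proof.
have d := is_deriveD (is_derive_cst x0 h 1) (is_derive_id h 1).
by apply: (@is_derive_eq _ _ _ _ _ _ _ _ d); rewrite add0r.
Qed.

Definition root4 (x : R) := Num.sqrt (Num.sqrt x * Num.sqrt (x + 1)).

Lemma root4_gt0 (x : R) : 0 < x -> 0 < root4 x.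
Proof. by move=> x0; rewrite sqrtr_gt0 mulr_gt0// sqrtr_gt0//; lra. Qed.

Lemma root4_sqr (x : R) : 0 < x -> root4 x ^+ 2 = Num.sqrt x * Num.sqrt (x + 1).
Proof. by move=> x0; rewrite sqr_sqrtr// mulr_ge0// sqrtr_ge0. Qed.

Lemma root4_pow4 (x : R) : 0 < x -> root4 x ^+ 4 = x * (x + 1).
Proof.
move=> x0; rewrite -[4%N]/(2 * 2)%N exprM root4_sqr// exprMn !sqr_sqrtr//; lra.
Qed.

Lemma leg_weightE (x : R) : 0 < x -> leg_weight x = root4 x ^- 2.
Proof. by move=> x0; rewrite root4_sqr. Qed.

Lemma is_derive_root4 (x : R) : 0 < x -> is_derive x 1 root4 ((2 * x + 1) / (4 * root4 x ^+ 3)).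
Proof.
move=> x0; have x1 : 0 < x + 1 by lra.
have s0 : 0 < Num.sqrt x by rewrite sqrtr_gt0.
have s1 : 0 < Num.sqrt (x + 1) by rewrite sqrtr_gt0.
have d1 := is_derive1_sqrt x0; have d2 := is_derive_sqrt_shift x1.
have d3 : is_derive x 1 (fun x : R => Num.sqrt x * Num.sqrt (x + 1))
    ((2 * x + 1) / (2 * (Num.sqrt x * Num.sqrt (x + 1)))).
  apply: is_derive_eq; rewrite /GRing.scale/=.
  rewrite (_ : 2 * x + 1 = Num.sqrt x ^+ 2 + Num.sqrt (x + 1) ^+ 2); first by field; rewrite !gt_eqF.
  by rewrite !sqr_sqrtr ?ltW//; ring.
have p0 : 0 < Num.sqrt x * Num.sqrt (x + 1) by rewrite mulr_gt0.
have h := @is_derive1_comp R Num.sqrt (fun x => Num.sqrt x * Num.sqrt (x + 1)) x _ _ (is_derive1_sqrt p0) d3.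
apply: (@is_derive_eq _ _ _ _ _ _ _ _ h); rewrite -/(root4 x) -root4_sqr//.
by have := root4_gt0 x0; move: (root4 x) => r r0; field; rewrite gt_eqF.
Qed.

Lemma is_derive_root4V (x : R) : 0 < x -> is_derive x 1 (fun x => (root4 x)^-1) (- (2 * x + 1) / (4 * root4 x ^+ 5)).
Proof.
move=> x0; have r0 := root4_gt0 x0.
have h := @is_deriveV R root4 x _ 1 (lt0r_neq0 r0) (is_derive_root4 x0).
apply: (@is_derive_eq _ _ _ _ _ _ _ _ h); rewrite /GRing.scale/=.
by field; rewrite gt_eqF.
Qed.

Variable tau : R.

Definition legendre_cos (x : R) := (root4 x)^-1 * cos (2 * tau * arsinh_sqrt x).
(** The factor [root4 x], not its inverse, is what gives this pair a system with rational
    coefficients: differentiating the phase produces [legendre_sin] over x (x + 1) in one equation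
    and [legendre_cos] itself in the other. *)
Definition legendre_sin (x : R) := root4 x * sin (2 * tau * arsinh_sqrt x).

Lemma is_derive_arsinh_sqrt_phase (x : R) : 0 < x -> is_derive x 1 (fun x => 2 * tau * arsinh_sqrt x) (tau / root4 x ^+ 2).
Proof.
move=> x0; have r0 := root4_gt0 x0; have d := is_derive_arsinh_sqrt x0; rewrite leg_weightE// in d.
by apply: is_derive_eq; rewrite /GRing.scale/=; field; rewrite gt_eqF.
Qed.

Lemma is_derive_legendre_cos (x : R) : 0 < x -> is_derive x 1 legendre_cos
  ((- ((2 * x + 1) / 4 * legendre_cos x) - tau * legendre_sin x) / (x * (x + 1))).
Proof.
move=> x0; have r0 := root4_gt0 x0.
have d1 := is_derive_root4V x0.
have d2 := @is_derive1_comp R cos _ x _ _ (is_derive_cos _) (is_derive_arsinh_sqrt_phase x0).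
have d : is_derive x 1 legendre_cos _ := is_deriveM d1 d2.
apply: (@is_derive_eq _ _ _ _ _ _ _ _ d); rewrite /GRing.scale/= /legendre_cos /legendre_sin -root4_pow4//.
by move: (root4 x) r0 => r r0; field; rewrite gt_eqF.
Qed.

Lemma is_derive_legendre_sin (x : R) : 0 < x -> is_derive x 1 legendre_sin
  (((2 * x + 1) / 4 * legendre_sin x + tau * (x * (x + 1) * legendre_cos x)) / (x * (x + 1))).
Proof.
move=> x0; have r0 := root4_gt0 x0.
have d1 := is_derive_root4 x0.
have d2 := @is_derive1_comp R sin _ x _ _ (is_derive_sin _) (is_derive_arsinh_sqrt_phase x0).
have d : is_derive x 1 legendre_sin _ := is_deriveM d1 d2.
apply: (@is_derive_eq _ _ _ _ _ _ _ _ d); rewrite /GRing.scale/= /legendre_cos /legendre_sin -root4_pow4//.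
by move: (root4 x) r0 => r r0; field; rewrite gt_eqF.
Qed.

Lemma legendre_cos_psum (x0 : R) : 0 < x0 -> exists a K, 0 < K /\
  forall h, `|h| * K < 1 -> psum a h (legendre_cos (x0 + h)).
Proof.
move=> x00.
have D0 : 0 < x0 * (x0 + 1) by rewrite mulr_gt0//; lra.
have m0 : 0 <= 2 * x0 + 1 by lra.
have [a [b [K [K0 ea eb ab]]]] := legendre_local_solution tau D0 m0 (legendre_cos x0) (legendre_sin x0).
(* The extra summand forces |h| < x0, so that x0 + h stays positive, where the elementary functions
   are differentiable. *)
exists a, (K + x0^-1); split; first by rewrite addr_gt0// invr_gt0.
have bnd (h : R) : `|h| * (K + x0^-1) < 1 -> `|h| * K < 1 /\ `|h| < x0.
  rewrite mulrDr => hh; have h1 : 0 <= `|h| * K by rewrite mulr_ge0// ltW.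
  have h2 : 0 <= `|h| / x0 by rewrite divr_ge0// ltW.
  by split; [lra|rewrite -[ltRHS]mul1r -ltr_pdivrMr//; lra].
pose r := (K + x0^-1)^-1.
have Kx : 0 < K + x0^-1 by rewrite addr_gt0// invr_gt0.
have r0 : 0 < r by rewrite invr_gt0.
have inr (h : R) : - r < h < r -> `|h| * (K + x0^-1) < 1.
  by move=> hh; rewrite -ltr_pdivlMr// div1r ltr_norml.
(* E is a first integral of the linear system, and it vanishes only with both differences. *)
pose E h := root4 (x0 + h) ^+ 2 * (legendre_cos (x0 + h) - psval a h) ^+ 2 +
            (root4 (x0 + h))^-1 ^+ 2 * (legendre_sin (x0 + h) - psval b h) ^+ 2.
have dE (h : R) : - r < h < r -> is_derive h 1 E 0.
  move=> /inr /[dup] hh /bnd [hK hx].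
  have x1 : 0 < x0 + h by move: hx; rewrite ltr_norml; lra.
  have r1 := root4_gt0 x1.
  have [_ _ [a' [b' [da db ea' eb']]]] := ab h hK.
  have ds := is_derive_addl x0 h.
  have d1 := @is_derive1_comp R legendre_cos (fun h => x0 + h) h _ _ (is_derive_legendre_cos x1) ds.
  have d2 := @is_derive1_comp R legendre_sin (fun h => x0 + h) h _ _ (is_derive_legendre_sin x1) ds.
  have d3 := @is_derive1_comp R root4 (fun h => x0 + h) h _ _ (is_derive_root4 x1) ds.
  have d4 := @is_derive1_comp R (fun x => (root4 x)^-1) (fun h => x0 + h) h _ _ (is_derive_root4V x1) ds.
  have p0 : (x0 + h) * (x0 + h + 1) != 0 by rewrite gt_eqF// mulr_gt0//; lra.
  have ep : x0 * (x0 + 1) + (2 * x0 + 1) * h + h ^+ 2 = (x0 + h) * (x0 + h + 1) by ring.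
  rewrite ep in ea' eb'.
  have -> : E = (fun h => (root4 \o (fun h => x0 + h)) h ^+ 2 * ((legendre_cos \o (fun h => x0 + h)) h - psval a h) ^+ 2 +
            ((fun x => (root4 x)^-1) \o (fun h => x0 + h)) h ^+ 2 * ((legendre_sin \o (fun h => x0 + h)) h - psval b h) ^+ 2) by [].
  apply: is_derive_eq; rewrite /GRing.scale/=.
  have {}ea' : a' = (- ((2 * x0 + 1 + 2 * h) / 4 * psval a h) - tau * psval b h) / ((x0 + h) * (x0 + h + 1)).
    by rewrite -ea'; field; move: p0; rewrite mulf_eq0 negb_or => /andP[-> ->].
  have {}eb' : b' = ((2 * x0 + 1 + 2 * h) / 4 * psval b h + tau * ((x0 + h) * (x0 + h + 1) * psval a h)) / ((x0 + h) * (x0 + h + 1)).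
    by rewrite -eb'; field; move: p0; rewrite mulf_eq0 negb_or => /andP[-> ->].
  rewrite ea' eb' -!(root4_pow4 x1).
  move: (legendre_cos _) (legendre_sin _) (psval a h) (psval b h) => F G A B.
  rewrite (_ : 2 * x0 + 1 + 2 * h = 2 * (x0 + h) + 1); last by ring.
  move: (x0 + h) r1 => x; move: (root4 x) => u u0.
  by field; rewrite gt_eqF.
have E0 : E 0 = 0.
  have [pa pb _] : [/\ psum a 0 (psval a 0), psum b 0 (psval b 0) & True].
    by have [] := ab 0; rewrite ?normr0 ?mul0r.
  rewrite /E addr0 (psum_unique pa (@psum0 _ a)) (psum_unique pb (@psum0 _ b)) ea eb !subrr.
  by rewrite expr0n/= !mulr0 addr0.
move=> h hh; have [hK hx] := bnd h hh.
have hr : - r < h < r by rewrite -ltr_norml /r -[ltRHS]mul1r ltr_pdivlMr.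
have x1 : 0 < x0 + h by move: hx; rewrite ltr_norml; lra.
have r1 := root4_gt0 x1.
have : E h = 0 by rewrite -E0; apply: (is_derive0_eq dE hr); rewrite oppr_lt0 r0.
have s1 := mulr_ge0 (sqr_ge0 (root4 (x0 + h))) (sqr_ge0 (legendre_cos (x0 + h) - psval a h)).
have s2 := mulr_ge0 (sqr_ge0 (root4 (x0 + h))^-1) (sqr_ge0 (legendre_sin (x0 + h) - psval b h)).
move=> /eqP; rewrite /E paddr_eq0// => /andP[+ _].
rewrite mulf_eq0 !sqrf_eq0 gt_eqF//= subr_eq0 => /eqP ->.
by have [] := ab h hK.
Qed.

End LegendreAnalytic.

(** * The Gauss series on ]0, 1[ *)

Section Hypergeometric.
Context {R : realType}.
Variable tau : R.

(* Up to the sign (-1)^n, the Gauss coefficients; they and tau hyp_coef n / (n + 1/2) are the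
   coefficients of the series c, d with (1 + x) c' = - c / 2 - tau d, x d' = - d / 2 + tau c. *)
Fixpoint hyp_coef n : R :=
  if n is m.+1 then - (((m%:R + 2^-1) ^+ 2 + tau ^+ 2) / ((m%:R + 2^-1) * m.+1%:R) * hyp_coef m) else 1.

Let hyp_coef_sin n := tau * hyp_coef n / (n%:R + 2^-1).

Let nhalf n : 0 < n%:R + 2^-1 :> R.
Proof. by rewrite ltr_wpDl// invr_gt0. Qed.

(** The ratio of moduli is at most 1 exactly when tau^2 <= (n + 1/2) / 2, because (n + 1/2) (n + 1)
    = (n + 1/2)^2 + (n + 1/2) / 2. *)
Let hyp_coef_dec n : 2 * tau ^+ 2 <= n%:R -> `|hyp_coef n.+1| <= `|hyp_coef n|.
Proof.
move=> tn; rewrite /= normrN normrM ler_piMl//.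
have n2 := nhalf n; have n1 : 0 < n.+1%:R :> R by [].
have p : 0 < (n%:R + 2^-1) * n.+1%:R :> R by rewrite mulr_gt0.
have q : 0 <= (n%:R + 2^-1) ^+ 2 + tau ^+ 2 by rewrite addr_ge0 ?sqr_ge0.
rewrite ger0_norm; last by rewrite divr_ge0// ltW.
rewrite ler_pdivrMr// mul1r -[n.+1%:R]natr1.
rewrite (_ : (_ + _) * (n%:R + 1) = (n%:R + 2^-1) ^+ 2 + 2^-1 * (n%:R + 2^-1)); last by field.
by rewrite lerD2l; lra.
Qed.

(** The moduli are eventually nonincreasing, so the sum over an initial segment bounds them all;
    this gives radius of convergence at least 1. *)
Lemma hyp_coef_bounded : exists2 M, 0 <= M & geo_le hyp_coef M 1.
Proof.
pose n0 := (Num.truncn (2 * tau ^+ 2)).+1.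
have h0 : 2 * tau ^+ 2 <= n0%:R.
  by have := truncnS_gt (2 * tau ^+ 2); rewrite /n0 => /ltW.
exists (\sum_(i < n0.+1) `|hyp_coef i|); first by rewrite sumr_ge0.
move=> n; rewrite expr1n mulr1.
have small m : (m <= n0)%N -> `|hyp_coef m| <= \sum_(i < n0.+1) `|hyp_coef i|.
  move=> mn; rewrite (bigD1 (Ordinal (mn : (m < n0.+1)%N)))//= lerDl sumr_ge0//.
have [/small//|/ltnW nn0] := leqP n n0.
rewrite -(subnKC nn0); elim: (n - n0)%N => [|k IH]; first by rewrite addn0; exact: small.
rewrite addnS (le_trans (hyp_coef_dec _))// (le_trans h0)// ler_nat leq_addr//.
Qed.

Let hd_bounded M : 0 <= M -> geo_le hyp_coef M 1 -> geo_le hyp_coef_sin (2 * `|tau| * M) 1.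
Proof.
move=> M0 h n; have n2 := nhalf n; have := h n; rewrite !expr1n !mulr1 => hn.
rewrite /hyp_coef_sin normrM normfV (gtr0_norm n2) ler_pdivrMr// normrM.
have n0 : 0 <= n%:R :> R by [].
have t0 : 0 <= `|tau| by [].
have tM : 0 <= 2 * `|tau| * M * n%:R by rewrite !mulr_ge0.
have := ler_wpM2l t0 hn; lra.
Qed.

Let hyp_coef_ode (x : R) : `|x| < 1 -> exists c' d',
  [/\ is_derive x 1 (psval hyp_coef) c', is_derive x 1 (psval hyp_coef_sin) d',
      (1 + x) * c' = - (2^-1 * psval hyp_coef x) - tau * psval hyp_coef_sin x &
      x * d' = - (2^-1 * psval hyp_coef_sin x) + tau * psval hyp_coef x].
Proof.
move=> x1; have [M M0 gc] := hyp_coef_bounded; have gd := hd_bounded M0 gc.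
have M1 : 0 <= 2 * `|tau| * M by rewrite !mulr_ge0.
have xK : `|x| * 1 < 1 by rewrite mulr1.
have pc := geo_le_psum M0 ler01 gc xK.
have pd := geo_le_psum M1 ler01 gd xK.
have [dc pdc] := is_derive_psval M0 ltr01 gc xK.
have [dd pdd] := is_derive_psval M1 ltr01 gd xK.
exists (psval (pseries_diffs hyp_coef) x), (psval (pseries_diffs hyp_coef_sin) x); split => //.
- have L := psum_linear 1 1 pdc (psum_shift pdc).
  have Rr := psum_linear (- 2^-1) (- tau) pc pd.
  rewrite (_ : (fun n => - 2^-1 * _ + _) =
     (fun n => 1 * pseries_diffs hyp_coef n + 1 * coef_shift (pseries_diffs hyp_coef) n)) in Rr; last first.
    apply/funext => n; rewrite coef_shift_diffs /pseries_diffs /hyp_coef_sin /=.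
    have := pnatr_eq0 R n.+1; have := nhalf n; have : n%:R + 1 = n.+1%:R :> R := natr1 n.
    move: (hyp_coef n) (n.+1%:R : R) (n%:R : R) => u X Y /= <- Y0 /negbT X0; field.
    by rewrite X0 (_ : Y * 2 + 1 = 2 * (Y + 2^-1)) ?mulf_neq0 ?gt_eqF//; field.
  by have := psum_unique L Rr; lra.
- have Rr := psum_linear (- 2^-1) tau pd pc.
  rewrite (_ : (fun n => - 2^-1 * _ + _) = coef_shift (pseries_diffs hyp_coef_sin)) in Rr; last first.
    apply/funext => n; rewrite coef_shift_diffs /hyp_coef_sin /=.
    have := nhalf n; move: (hyp_coef n) (n%:R : R) => u Y /= Y0; field.
    by rewrite (_ : Y * 2 + 1 = 2 * (Y + 2^-1)) ?mulf_neq0 ?gt_eqF//; field.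
  by have := psum_unique (psum_shift pdd) Rr; lra.
Qed.

Lemma hyp_coef_psum (x : R) : 0 < x < 1 -> psum hyp_coef x (cos (2 * tau * arsinh_sqrt x) / Num.sqrt (x + 1)).
Proof.
(* The two bracketed pairs rotate at the same rate, hence their distance is constant. *)
pose E (x : R) := (Num.sqrt (x + 1) * psval hyp_coef x - cos (2 * tau * arsinh_sqrt x)) ^+ 2 +
           (Num.sqrt x * psval hyp_coef_sin x - sin (2 * tau * arsinh_sqrt x)) ^+ 2.
have dE (y : R) : 0 < y < 1 -> is_derive y 1 E 0.
  move=> /andP[y0 y1]; have y11 : 0 < y + 1 by lra.
  have [c' [d' [dc dd ec ed]]] : exists c' d',
    [/\ is_derive y 1 (psval hyp_coef) c', is_derive y 1 (psval hyp_coef_sin) d',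
      (1 + y) * c' = - (2^-1 * psval hyp_coef y) - tau * psval hyp_coef_sin y &
      y * d' = - (2^-1 * psval hyp_coef_sin y) + tau * psval hyp_coef y] by apply: hyp_coef_ode; rewrite gtr0_norm.
  have s0 : 0 < Num.sqrt y by rewrite sqrtr_gt0.
  have s1 : 0 < Num.sqrt (y + 1) by rewrite sqrtr_gt0.
  have da := is_derive_arsinh_sqrt_phase tau y0; rewrite root4_sqr// in da.
  have d1 := @is_derive1_comp R cos _ y _ _ (is_derive_cos _) da.
  have d2 := @is_derive1_comp R sin _ y _ _ (is_derive_sin _) da.
  have d3 := is_derive1_sqrt y0; have d4 := is_derive_sqrt_shift y11.
  have -> : E = (fun x => (Num.sqrt (x + 1) * psval hyp_coef x - (cos \o (fun x => 2 * tau * arsinh_sqrt x)) x) ^+ 2 +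
           (Num.sqrt x * psval hyp_coef_sin x - (sin \o (fun x => 2 * tau * arsinh_sqrt x)) x) ^+ 2) by [].
  apply: is_derive_eq; rewrite /GRing.scale/=.
  have e1 : 1 + y = Num.sqrt (y + 1) ^+ 2 by rewrite sqr_sqrtr ?ltW// addrC.
  have e0 : y = Num.sqrt y ^+ 2 by rewrite sqr_sqrtr ?ltW.
  have {}ec : c' = (- (2^-1 * psval hyp_coef y) - tau * psval hyp_coef_sin y) / Num.sqrt (y + 1) ^+ 2.
    by rewrite -ec -e1; field; rewrite gt_eqF//; lra.
  have {}ed : d' = (- (2^-1 * psval hyp_coef_sin y) + tau * psval hyp_coef y) / Num.sqrt y ^+ 2.
    by rewrite -ed -e0; field; rewrite gt_eqF.
  rewrite ec ed; move: (psval hyp_coef y) (psval hyp_coef_sin y) (cos _) (sin _) => A B C S.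
  move: (Num.sqrt y) (Num.sqrt (y + 1)) s0 s1 => u v u0 v0.
  by field; rewrite !gt_eqF.
(* The system is singular at 0, where sqrt x has no derivative. The initial value there can only be
   reached through continuity of [E]. *)
have cE : {for (0 : R), continuous E}.
  have [c' [d' [dc dd _ _]]] : exists c' d',
    [/\ is_derive (0 : R) 1 (psval hyp_coef) c', is_derive (0 : R) 1 (psval hyp_coef_sin) d',
      (1 + 0) * c' = - (2^-1 * psval hyp_coef 0) - tau * psval hyp_coef_sin 0 &
      0 * d' = - (2^-1 * psval hyp_coef_sin 0) + tau * psval hyp_coef 0] by apply: hyp_coef_ode; rewrite normr0.
  have cc : {for (0 : R), continuous (psval hyp_coef)} by apply/differentiable_continuous/derivable1_diffP; case: dc.
  have cd : {for (0 : R), continuous (psval hyp_coef_sin)} by apply/differentiable_continuous/derivable1_diffP; case: dd.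
  have cs1 : {for (0 : R), continuous (fun x : R => Num.sqrt (x + 1))}.
    apply: (@continuous_comp _ _ _ (fun x : R => x + 1) Num.sqrt); last exact: sqrt_continuous.
    by apply: cvgD; [exact: cvg_id|exact: cvg_cst].
  have cs0 : {for (0 : R), continuous (@Num.sqrt R)} by exact: sqrt_continuous.
  have ca : {for (0 : R), continuous (fun x => 2 * tau * arsinh_sqrt x)}.
    apply: cvgM; first exact: cvg_cst.
    apply: (@continuous_comp _ _ _ (fun x : R => Num.sqrt x + Num.sqrt (x + 1)) (@ln R)).
      by apply: cvgD; [exact: cs0|exact: cs1].
    by apply: continuous_ln; exact: arsinh_sqrt_arg.
  have sq (f : R -> R) : {for (0 : R), continuous f} -> {for (0 : R), continuous (fun x => f x ^+ 2)}.
    by move=> cf; apply: (@continuous_comp _ _ _ f (fun y : R => y ^+ 2)) => //; exact: exprn_continuous.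
  apply: cvgD; apply: sq; apply: cvgB.
  - by apply: cvgM; [exact: cs1|exact: cc].
  - by apply: (@continuous_comp _ _ _ (fun x => 2 * tau * arsinh_sqrt x) cos) => //; exact: continuous_cos.
  - by apply: cvgM; [exact: cs0|exact: cd].
  - by apply: (@continuous_comp _ _ _ (fun x => 2 * tau * arsinh_sqrt x) sin) => //; exact: continuous_sin.
have E0 : E 0 = 0.
  by rewrite /E (psvalE (@psum0 _ hyp_coef)) arsinh_sqrt0 mulr0 cos0 sin0 sqrtr0 add0r sqrtr1 mul0r mulr1 !subrr expr0n addr0.
move=> x01; have Ex : E x = 0.
  have l1 : E y @[y --> 0^'+] --> E 0 by apply: cvg_at_right_filter.
  have l2 : E y @[y --> 0^'+] --> E x.
    apply: cvg_near_cst; near=> y; apply: (is_derive0_eq dE) => //.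
    by apply/andP; split; near: y; [exact: nbhs_right_gt|exact: nbhs_right_lt].
  by rewrite (cvg_unique _ l2 l1).
have s1 := sqr_ge0 (Num.sqrt (x + 1) * psval hyp_coef x - cos (2 * tau * arsinh_sqrt x)).
have s2 := sqr_ge0 (Num.sqrt x * psval hyp_coef_sin x - sin (2 * tau * arsinh_sqrt x)).
move: Ex => /eqP; rewrite /E paddr_eq0// => /andP[+ _].
rewrite sqrf_eq0 subr_eq0 => /eqP <-.
have x1 : 0 < Num.sqrt (x + 1) by rewrite sqrtr_gt0; lra.
rewrite [X in psum _ _ X](_ : _ = psval hyp_coef x); last by field; rewrite gt_eqF.
have [M M0 gc] := hyp_coef_bounded.
by apply: (geo_le_psum M0 ler01 gc); rewrite mulr1 gtr0_norm; lra.
Unshelve. all: by end_near. Qed.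

End Hypergeometric.

(** * Complex series on the real line and an identity theorem *)

Section ComplexSeries.
Context {R : realType}.
Implicit Types (a : nat -> R[i]) (s : R[i]) (h : R).

Lemma Re_add (x y : R[i]) : Re (x + y) = Re x + Re y. Proof. by case: x; case: y. Qed.
Lemma Im_add (x y : R[i]) : Im (x + y) = Im x + Im y. Proof. by case: x; case: y. Qed.
Lemma Re_mul_real (x : R[i]) h : Re (x * h%:C) = Re x * h.
Proof. by case: x => u v; simpc. Qed.
Lemma Im_mul_real (x : R[i]) h : Im (x * h%:C) = Im x * h.
Proof. by case: x => u v; simpc. Qed.

Lemma cvg_complexP (u : nat -> R[i]) s :
  ((u : nat -> R[i]^o) n @[n --> \oo] --> (s : R[i]^o)) <->
  (Re (u n) @[n --> \oo] --> Re s) /\ (Im (u n) @[n --> \oo] --> Im s).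
Proof.
have nE (z : R[i]) : `|z| = (Num.sqrt (Re z ^+ 2 + Im z ^+ 2))%:C by exact: normc_def.
split.
- move=> /cvgrPdist_lt h.
  have le2 (x y : R) : `|x| <= Num.sqrt (x ^+ 2 + y ^+ 2).
    by rewrite -sqrtr_sqr ler_wsqrtr// lerDl sqr_ge0.
  have hN (e : R) : 0 < e -> \forall n \near \oo, Num.sqrt ((Re s - Re (u n)) ^+ 2 + (Im s - Im (u n)) ^+ 2) < e.
    move=> e0; have e0C : 0 < e%:C :> R[i] by rewrite ltcR.
    have [N _ hN] := h _ e0C; exists N => // n /hN /=.
    by rewrite nE ltcR; case: (s) (u n) => [s1 s2] [u1 u2].
  split; apply/cvgrPdist_lt => e /hN[N _ h']; exists N => // n /h'; apply: le_lt_trans => //.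
  by rewrite [X in Num.sqrt X]addrC; exact: le2.
- move=> [/cvgrPdist_lt h1 /cvgrPdist_lt h2]; apply/cvgrPdist_lt => e.
  rewrite ltcE/= => /andP[/eqP ie re].
  have r2 : 0 < Re e / 2 by rewrite divr_gt0.
  have [N1 _ hN1] := h1 _ r2; have [N2 _ hN2] := h2 _ r2.
  exists (maxn N1 N2) => // n /=; rewrite geq_max => /andP[/hN1/= n1 /hN2/= n2].
  rewrite nE ltcE/= ie eqxx/=.
  rewrite (@le_lt_trans _ _ (`|Re s - Re (u n)| + `|Im s - Im (u n)|))//; last lra.
  rewrite -[leRHS]ger0_norm ?addr_ge0// -sqrtr_sqr ler_wsqrtr//.
  case: (s) (u n) => [s1 s2] [u1 u2] /=.
  rewrite [leRHS]sqrrD !real_normK ?num_real// addrAC lerDl.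
  by rewrite mulrn_wge0// mulr_ge0.
Qed.

Lemma csum_toP a h s : csum_to (fun n => a n * h%:C ^+ n) s <->
  psum (fun n => Re (a n)) h (Re s) /\ psum (fun n => Im (a n)) h (Im s).
Proof.
rewrite /csum_to cvg_complexP /psum.
have eR n : Re (series (fun n => a n * h%:C ^+ n) n) = pseries (fun n => Re (a n)) h n.
  rewrite /pseries /series/=; elim: n => [|n IH]; first by rewrite !big_geq.
  by rewrite !big_nat_recr//= Re_add IH -rmorphXn/= Re_mul_real.
have eI n : Im (series (fun n => a n * h%:C ^+ n) n) = pseries (fun n => Im (a n)) h n.
  rewrite /pseries /series/=; elim: n => [|n IH]; first by rewrite !big_geq.
  by rewrite !big_nat_recr//= Im_add IH -rmorphXn/= Im_mul_real.
by rewrite (funext eR) (funext eI).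
Qed.

Definition ranalytic (g : R -> R) := forall t0 : R, 1 < t0 ->
  exists2 r, 0 < r & exists c, forall t, `|t - t0| < r -> psum c (t - t0) (g t).

Lemma ranalytic_sub (f g : R -> R) : ranalytic f -> ranalytic g -> ranalytic (fun t => f t - g t).
Proof.
move=> hf hg t0 t01; have [r r0 [a ha]] := hf t0 t01; have [q q0 [b hb]] := hg t0 t01.
exists (Num.min r q); first by rewrite lt_min r0.
exists (fun n => 1 * a n + (-1) * b n) => t; rewrite lt_min => /andP[tr tq].
rewrite (_ : f t - g t = 1 * f t + (-1) * g t); last by ring.
exact: psum_linear (ha t tr) (hb t tq).
Qed.

(** Let T be the supremum of the t such that g vanishes on ]1, t[. The expansion of g at T vanishes
    to the left of T, hence has zero coefficients, hence g vanishes beyond T as well; a finite T is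
    impossible. *)
Lemma ranalytic_eq0 (g : R -> R) : ranalytic g -> (forall t, 1 < t < 3 -> g t = 0) ->
  forall t, 1 < t -> g t = 0.
Proof.
move=> ag g0 t1 t11; apply: contrapT => gt1.
pose S := [set t : R | forall s : R, 1 < s < t -> g s = 0].
have S3 : S 3 by move=> s; exact: g0.
have ubS : ubound S t1.
  by move=> t St; rewrite leNgt; apply/negP => t1t; apply: gt1; apply: St; rewrite t11.
have hS : has_sup S by split; [exists 3|exists t1].
set T := sup S.
have T3 : 3 <= T by apply: ub_le_sup => //; exists t1.
have gT t : 1 < t < T -> g t = 0.
  move=> /andP[t1' tT]; have [s Ss ts] := sup_adherent (eps:=T - t) (E:=S) ltac:(by rewrite subr_gt0) hS.
  by apply: Ss; rewrite t1'; rewrite -/T in ts; lra.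
have [r r0 [a ha]] := ag T ltac:(lra).
have a0 n : a n = 0.
  (* The minimum with 1 keeps T + h above 1, as T is at least 3. *)
  apply: (@psum_eq0 _ a (Num.min r 1)); first by rewrite lt_min r0 ltr01.
  move=> h /andP[]; rewrite ltrNl lt_min => /andP[hr h1] h0.
  have -> : h = T + h - T by ring.
  rewrite -[X in psum _ _ X](gT (T + h)); last by apply/andP; split; lra.
  by apply: ha; rewrite (_ : T + h - T = h); [rewrite ltr0_norm|ring].
have gr t : T - r < t < T + r -> g t = 0.
  move=> /andP[t2 t3]; have := ha t; rewrite ltr_norml => /(_ ltac:(by apply/andP; split; lra)) h.
  apply: (psum_unique h); rewrite (_ : a = fun=> 0); last exact/funext.
  rewrite /psum (_ : pseries _ _ = cst 0); first exact: cvg_cst.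
  by apply/funext => n; rewrite /pseries /series/= big1// => i _; rewrite mul0r.
have : S (T + r / 2).
  move=> s /andP[s1 s2]; have [sT|sT] := ltP s T; first by apply: gT; rewrite s1.
  by apply: gr; apply/andP; split; lra.
by move=> /(ub_le_sup (ex_intro _ t1 ubS)); rewrite -/T; lra.
Qed.

End ComplexSeries.

(** * The value of [legendreP] for mu = 1/2 and lambda = -1/2 + i tau *)

Section LegendreValue.
Context {R : realType}.
Local Notation mu := (@lebesgue_measure R).

Lemma cexp_real (r : R) : cexp r%:C = (expR r)%:C.
Proof. by rewrite /cexp /= cos0 sin0 mulr1 mulr0. Qed.

Lemma cpow_real (r p : R) : cpow r p%:C = (expR (p * ln r))%:C.
Proof. by rewrite /cpow -rmorphM/= cexp_real. Qed.

Lemma sqrt_expR (x : R) : 0 < x -> Num.sqrt x = expR (2^-1 * ln x).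
Proof. by move=> x0; rewrite -powR12_sqrt ?ltW// /powR gt_eqF. Qed.

Lemma half_real_complex : (2%:R^-1 : R[i]) = (2^-1)%:C.
Proof. by rewrite fmorphV rmorph_nat. Qed.

Lemma cGamma_half : cGamma (1 - 2%:R^-1) = (Num.sqrt (pi : R))%:C.
Proof.
have e (t : R) : cpow t (1 - 2%:R^-1 - 1) * (expR (- t))%:C = (expR (- 2^-1 * ln t) * expR (- t))%:C.
  rewrite (_ : 1 - 2%:R^-1 - 1 = (- 2^-1)%:C); last by rewrite half_real_complex rmorphN/=; ring.
  by rewrite cpow_real -rmorphM.
rewrite /cGamma (funext e) /cintegral /=; congr (_ +i* _); last by rewrite /Rintegral integral0.
rewrite /Rintegral -[RHS]/(fine (Num.sqrt pi)%:E) -integral_gamma_half; congr fine.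
apply: eq_integral => t; rewrite inE/= in_itv/= andbT => t0.
congr EFin; rewrite mulrC; congr (_ * _).
by rewrite mulNr expRN; congr (_^-1); exact/esym/sqrt_expR.
Qed.

Lemma pochhammerS (a : R[i]) n : pochhammer a n.+1 = pochhammer a n * (a + n%:R).
Proof. by rewrite /pochhammer big_nat_recr. Qed.

Variable tau : R.
Local Notation lam := (- 2%:R^-1 + 'i%C * tau%:C : R[i]).

(** The two upper parameters are 1/2 -+ i tau, so the product of their shifts by n is the real
    number (n + 1/2)^2 + tau^2. The sign (-1)^n will cancel against the argument (1 - t) / 2 =
    -x. *)
Lemma hyp2F1_coefE n : hyp2F1_coef (- lam) (lam + 1) (1 - 2%:R^-1) n = ((-1) ^+ n * hyp_coef tau n)%:C.
Proof.
elim: n => [|n IH].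
  by rewrite /hyp2F1_coef /pochhammer !big_geq// fact0 /= expr0 !mulr1 invr1 mulr1 rmorph1.
rewrite /hyp2F1_coef !pochhammerS factS natrM.
transitivity (hyp2F1_coef (- lam) (lam + 1) (1 - 2%:R^-1) n *
   ((- lam + n%:R) * (lam + 1 + n%:R) / ((1 - 2%:R^-1 + n%:R) * n.+1%:R))).
  by rewrite /hyp2F1_coef !invfM; ring.
rewrite IH (_ : (- lam + n%:R) * (lam + 1 + n%:R) = ((n%:R + 2^-1) ^+ 2 + tau ^+ 2)%:C); last first.
  rewrite rmorphD !rmorphXn/= rmorphD/= -half_real_complex rmorph_nat.
  have i2 : ('i%C : R[i]) ^+ 2 = -1 := sqr_i R.
  (* Writing tau^2 with a factor i^2 leaves an identity that holds with i as an indeterminate. *)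
  rewrite (_ : tau%:C ^+ 2 = - ('i%C ^+ 2 * tau%:C ^+ 2)); last by rewrite i2; ring.
  by field.
rewrite (_ : (1 - 2%:R^-1 + n%:R) * n.+1%:R = ((n%:R + 2^-1) * n.+1%:R)%:C); last first.
  by rewrite rmorphM/= rmorphD/= -half_real_complex !rmorph_nat; congr (_ * _); field.
rewrite -fmorphV/= -!rmorphM/=; congr (_%:C).
by rewrite [(-1) ^+ n.+1]exprS; move: (_ / _); move: (hyp_coef _ _) ((-1) ^+ n) => H s q; ring.
Qed.

Lemma hyp2F1_halfE (x : R) : 0 < x < 1 ->
  hyp2F1 (- lam) (lam + 1) (1 - 2%:R^-1) (- x)%:C = (cos (2 * tau * arsinh_sqrt x) / Num.sqrt (x + 1))%:C.
Proof.
move=> x01; apply: (@cvg_lim R[i]^o); first exact: norm_hausdorff.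
have -> : (fun n => hyp2F1_coef (- lam) (lam + 1) (1 - 2%:R^-1) n * (- x)%:C ^+ n) =
   (fun n => ((-1) ^+ n * hyp_coef tau n)%:C * (- x)%:C ^+ n).
  by apply/funext => n; rewrite hyp2F1_coefE.
apply/csum_toP; split => /=.
- have := @hyp_coef_psum R tau x x01; rewrite /psum (_ : pseries (hyp_coef tau) x = pseries (fun n => (-1) ^+ n * hyp_coef tau n) (- x))//.
  apply/funext => n; rewrite /pseries /series/=; apply: eq_bigr => i _.
  by rewrite [(- x) ^+ i]exprNn mulrACA -exprMn mulrN1 opprK expr1n mul1r.
- rewrite /psum (_ : pseries _ _ = cst 0); first exact: cvg_cst.
  by apply/funext => n; rewrite /pseries /series/= big1// => i _; rewrite mul0r.
Qed.

Let Q (t : R) := (Num.sqrt pi)^-1 * legendre_cos tau ((t - 1) / 2).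

Lemma ranalytic_legendre : ranalytic Q.
Proof.
move=> t0 t01; have x0 : 0 < (t0 - 1) / 2 by lra.
have [a [K [K0 h]]] := legendre_cos_psum tau x0.
exists (2 / K); first by rewrite divr_gt0.
(* The expansion in (t - t0) / 2 becomes one in t - t0, whence the powers of 2; the null summand
   only gives the shape of [psum_linear]. *)
exists (fun n => (Num.sqrt pi)^-1 * (a n / 2 ^+ n) + 0 * 0) => t tr.
have hh : `|(t - t0) / 2| * K < 1.
  by rewrite normrM normfV (ger0_norm (ler0n _ 2)) mulrAC ltr_pdivrMr// mul1r -ltr_pdivlMr.
have p2 : psum (fun n => a n / 2 ^+ n) (t - t0) (legendre_cos tau ((t - 1) / 2)).
  have := h _ hh; rewrite /psum (_ : (t0 - 1) / 2 + (t - t0) / 2 = (t - 1) / 2); last by field.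
  rewrite (_ : pseries a _ = pseries (fun n => a n / 2 ^+ n) (t - t0))//.
  apply/funext => n; rewrite /pseries /series/=; apply: eq_bigr => i _.
  by rewrite exprMn exprVn; ring.
rewrite /Q -[X in psum _ _ X]addr0 -[X in psum _ _ (_ + X)](mul0r 0).
apply: psum_linear => //; rewrite /psum (_ : pseries _ _ = cst 0); first exact: cvg_cst.
by apply/funext => n; rewrite /pseries /series/= big1// => i _; rewrite mul0r.
Qed.

(** With x = (t - 1) / 2 the prefactor is ((x + 1) / x)^(1/4), and the Gauss series contributes (x +
    1)^(-1/2); together they give (x (x + 1))^(-1/4). *)
Lemma legendreP_seriesE (t : R) : 1 < t < 3 -> legendreP_series (2%:R^-1) lam t = (Q t)%:C.
Proof.
move=> /andP[t1 t3]; pose x := (t - 1) / 2.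
have x01 : 0 < x < 1 by rewrite /x; lra.
have x0 : 0 < x by case/andP: x01.
rewrite /legendreP_series cGamma_half (_ : (1 - t) / 2 = - x); last by rewrite /x; field.
rewrite hyp2F1_halfE// (_ : (2%:R^-1 / 2%:R : R[i]) = (4^-1)%:C); last first.
  by rewrite fmorphV rmorph_nat; field.
rewrite cpow_real -fmorphV/= -!rmorphM/=; congr (_%:C).
have x1 : 0 < x + 1 by lra.
have -> : (t + 1) / (t - 1) = (x + 1) / x by rewrite /x; field; rewrite !gt_eqF//; lra.
rewrite /Q -/x -mulrA /legendre_cos; congr (_ * _).
rewrite [RHS]mulrC mulrCA; congr (_ * _).
have s0 : 0 < Num.sqrt x by rewrite sqrtr_gt0.
have s1 : 0 < Num.sqrt (x + 1) by rewrite sqrtr_gt0.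
clearbody x; rewrite ln_div ?posrE//.
rewrite /root4 (sqrt_expR (mulr_gt0 s0 s1)).
rewrite lnM ?posrE//.
rewrite (sqrt_expR x0) (sqrt_expR x1) !expRK.
by rewrite -!expRN -expRD; congr expR; field.
Qed.

(** Exhibiting the elementary function as one continuation ensures that the chosen one satisfies the
    specification; the identity theorem, on real and imaginary parts, then makes the two equal on
    all of ]1, +oo[. *)
Lemma legendreP_halfE (x : R) : 0 < x ->
  legendreP (2%:R^-1) lam (2%:R * x + 1) = ((Num.sqrt pi)^-1 * legendre_cos tau x)%:C.
Proof.
move=> x0; have isQ : is_legendreP (2%:R^-1) lam (fun t => (Q t)%:C).
  split; last by move=> t t13; rewrite legendreP_seriesE.
  move=> t0; rewrite /= in_itv/= andbT => t01.
  have [r r0 [c hc]] := ranalytic_legendre t01; exists r => //.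
  exists (fun n => (c n)%:C) => t tr; apply/csum_toP; split => /=; first exact: hc.
  rewrite /psum (_ : pseries _ _ = cst 0); first exact: cvg_cst.
  by apply/funext => n; rewrite /pseries /series/= big1// => i _; rewrite mul0r.
have [aP eP] : is_legendreP (2%:R^-1) lam (legendreP (2%:R^-1) lam).
  by apply: (@xgetPex _ (fun=> 0) [set P | is_legendreP (2%:R^-1) lam P]); exists (fun t => (Q t)%:C).
set P := legendreP _ _ in aP eP *.
have aRe : ranalytic (fun t => Re (P t)).
  move=> t0 t01; have [|r r0 [c hc]] := aP t0; first by rewrite /= in_itv/= andbT.
  by exists r => //; exists (fun n => Re (c n)) => t /hc /csum_toP[].
have aIm : ranalytic (fun t => Im (P t)).
  move=> t0 t01; have [|r r0 [c hc]] := aP t0; first by rewrite /= in_itv/= andbT.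
  by exists r => //; exists (fun n => Im (c n)) => t /hc /csum_toP[].
have eRe t : 1 < t -> Re (P t) - Q t = 0.
  apply: (ranalytic_eq0 (ranalytic_sub aRe ranalytic_legendre)) => s s13.
  by rewrite eP// legendreP_seriesE//= subrr.
have eIm t : 1 < t -> Im (P t) = 0.
  by apply: (ranalytic_eq0 aIm) => s s13; rewrite eP// legendreP_seriesE.
have x1 : 1 < 2 * x + 1 by lra.
have := eRe _ x1; have := eIm _ x1; rewrite /Q (_ : (2 * x + 1 - 1) / 2 = x); last by field.
by case: (P _) => u v /= -> /eqP; rewrite subr_eq0 => /eqP ->.
Qed.

End LegendreValue.

(** * Real and imaginary parts *)

Section Assembly.
Context {R : realType}.
Local Notation mu := (@lebesgue_measure R).
Local Notation mR := (measurableTypeR R).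

(** In modulus the argument is an arccosine whatever the sign of Im z, and the cosine is positive on
    [0, pi / 2[. *)
Lemma Re_carg_gt0 (z : R[i]) : z != 0 -> `|carg z| < pi / 2 -> 0 < Re z.
Proof.
move=> z0; pose N := ComplexField.Normc.normc z.
have N0 : 0 < N.
  have Nge : 0 <= N by rewrite /N; case: (z) => u v; exact: sqrtr_ge0.
  rewrite lt0r Nge andbT; apply: contra z0 => /eqP h.
  by apply/eqP; exact: ComplexField.Normc.eq0_normc h.
have cN : `|Re z / N| <= 1.
  rewrite normrM normfV (gtr0_norm N0) ler_pdivrMr// mul1r.
  by rewrite /N; case: (z) => u v /=; rewrite -sqrtr_sqr ler_wsqrtr// lerDl sqr_ge0.
have -> : `|carg z| = acos (Re z / N).
  have a0 : 0 <= acos (Re z / N) by apply: acos_ge0; rewrite -ler_norml.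
  by rewrite /carg -/N; case: ifP => _; rewrite ?normrN ger0_norm.
move=> h; have c0 : 0 < cos (acos (Re z / N)).
  apply: cos_gt0_pihalf; rewrite h andbT (@lt_le_trans _ _ 0)//.
    by rewrite oppr_lt0 divr_gt0// pi_gt0.
  by apply: acos_ge0; rewrite -ler_norml.
by move: c0; rewrite acosK ?in_itv/= -?ler_norml// pmulr_lgt0// invr_gt0.
Qed.

Definition plane_wave (k1 k2 a b phi C u : R) := expR (k1 * u - a * C) * cos (k2 * u - b * C - phi).

(** The two plane waves are the exponentials of cosh(nu u). Since sin Y = cos(Y - pi / 2), the
    imaginary part is the same expression with another phi. *)
Lemma kernel_ReIm (nu z : R[i]) (C u : R) :
  let w := cexp (- (z * C%:C)) * ccosh (nu * u%:C) in
  let k phi := 2^-1 * (plane_wave (Re nu) (Im nu) (Re z) (Im z) phi C u +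
     plane_wave (- Re nu) (- Im nu) (Re z) (Im z) phi C u) in
  Re w = k 0 /\ Im w = k (pi / 2).
Proof.
case: nu z => n1 n2 [a b] w k; rewrite {}/w {}/k /plane_wave /ccosh.
have cE (x y : R) : cexp (x +i* y) = (expR x * cos y) +i* (expR x * sin y) by [].
have e1 (x y r : R) : (x +i* y) * r%:C = (x * r) +i* (y * r) by simpc.
have e2 (x y : R) : - (x +i* y) = (- x) +i* (- y) by simpc.
have e3 (x y x' y' : R) : (x +i* y) + (x' +i* y') = (x + x') +i* (y + y') by simpc.
have e4 (x y x' y' : R) : (x +i* y) * (x' +i* y') = (x * x' - y * y') +i* (x * y' + y * x') by simpc.
rewrite half_real_complex [(a +i* b) * _]e1 [(n1 +i* n2) * _]e1 !e2 !cE e3 e1 e4 /= !cosN !sinN.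
rewrite (_ : - n1 * u - a * C = - (n1 * u) + - (a * C)); last by ring.
rewrite (_ : n2 * u - b * C - 0 = n2 * u - b * C); last by rewrite subr0.
rewrite (_ : - n2 * u - b * C - 0 = - (n2 * u + b * C)); last by ring.
rewrite (_ : - n2 * u - b * C - pi / 2 = - (n2 * u + b * C) - pi / 2); last by ring.
rewrite !cosBpihalf cosN sinN cosB cosD sinB sinD !expRD.
by split; ring.
Qed.

Definition plane_wave_integral (al : R) (nu z : R[i]) (phi : R) := \int[mu]_(u in `]0, +oo[)
  (2^-1 * (plane_wave (Re nu) (Im nu) (Re z) (Im z) phi (rcosh u `^ al) u +
    plane_wave (- Re nu) (- Im nu) (Re z) (Im z) phi (rcosh u `^ al) u)).

Lemma genK_plane_wave (al : R) (nu z : R[i]) : genK al nu z = plane_wave_integral al nu z 0 +i* plane_wave_integral al nu z (pi / 2).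
Proof.
rewrite /genK /cintegral; congr (_ +i* _); apply: eq_Rintegral => u _.
- by have [] := kernel_ReIm nu z (rcosh u `^ al) u.
- by have [] := kernel_ReIm nu z (rcosh u `^ al) u.
Qed.

(** The factor 1 / sqrt pi comes from the Legendre function and 1 / 2 from the hyperbolic cosine. *)
Definition folded_wave (al beta : R) (nu z : R[i]) (phi tau x : R) := (Num.sqrt pi)^-1 / 2 *
  (leg_kernel tau x * \int[mu]_(u in `]0, +oo[) wave al beta (Re z) (Im z) (Re nu) (Im nu) 1 phi tau x u +
   leg_kernel tau x * \int[mu]_(u in `]0, +oo[) wave al beta (Re z) (Im z) (- Re nu) (- Im nu) (-1) phi tau x u).

Lemma integrand_ReIm (nu z : R[i]) (beta tau x : R) (al : R) : 0 < al -> 0 < beta -> 0 < Re z -> 0 < x ->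
  let w := legendreP (2%:R^-1) (- 2%:R^-1 + 'i%C * tau%:C) (2%:R * x + 1)
      / ((x * (x + 1)) `^ (4%:R^-1))%:C
    * genK al (nu + 2%:R * 'i%C * tau%:C) (z * ((x + 1) `^ (beta / 2%:R))%:C) in
  Re w = folded_wave al beta nu z 0 tau x /\ Im w = folded_wave al beta nu z (pi / 2) tau x.
Proof.
move=> al0 be0 a0 x0 w.
have mD : measurable (`]0, +oo[%classic : set mR) by [].
have r0 := root4_gt0 x0.
have rE : (x * (x + 1)) `^ 4^-1 = root4 x.
  rewrite -root4_pow4// -powR_mulrn ?ltW// -powRrM (_ : 4%:R * 4^-1 = 1) ?powRr1 ?ltW//.
  by rewrite mulfV.
have eL : legendreP (2%:R^-1) (- 2%:R^-1 + 'i%C * tau%:C) (2%:R * x + 1) / ((x * (x + 1)) `^ (4%:R^-1))%:C =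
    ((Num.sqrt pi)^-1 * leg_kernel tau x)%:C.
  rewrite legendreP_halfE// rE -fmorphV/= -rmorphM/=; congr (_%:C).
  by rewrite -mulrA /legendre_cos /leg_kernel leg_weightE//; congr (_ * _); field; rewrite gt_eqF.
have eN : nu + 2%:R * 'i%C * tau%:C = (Re nu) +i* (Im nu + 2 * tau).
  case: (nu) => n1 n2; rewrite (_ : 2%:R * 'i%C * tau%:C = 0 +i* (2 * tau)) /=; last first.
    by rewrite -[2%:R : R[i]](rmorph_nat (real_complex R)) /=; simpc.
  by simpc.
have eG (phi : R) : plane_wave_integral al (Re nu +i* (Im nu + 2 * tau)) (z * ((x + 1) `^ (beta / 2%:R))%:C) phi =
   2^-1 * (\int[mu]_(u in `]0, +oo[) wave al beta (Re z) (Im z) (Re nu) (Im nu) 1 phi tau x u +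
      \int[mu]_(u in `]0, +oo[) wave al beta (Re z) (Im z) (- Re nu) (- Im nu) (-1) phi tau x u).
  have i1 := integrable_wave (Im z) (Re nu) (Im nu) 1 phi al0 be0 a0 tau (ltW x0).
  have i2 := integrable_wave (Im z) (- Re nu) (- Im nu) (-1) phi al0 be0 a0 tau (ltW x0).
  rewrite -(RintegralD mD i1 i2) -(RintegralZl _ mD (integrable_add mD i1 i2)).
  apply: eq_Rintegral => u _; rewrite /plane_wave !Re_mul_real !Im_mul_real /wave /=.
  by congr (_ * (expR _ * cos _ + expR _ * cos _)); ring.
rewrite /w eL eN genK_plane_wave mulrC Re_mul_real Im_mul_real /= !eG /folded_wave.
by split; ring.
Qed.

(** The constants agree: the outer 1 / sqrt pi, the inner (1 / sqrt pi) / 2 and the pi of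
    [integral_leg_wave] leave the 1 / 2 of [plane_wave_integral]. *)
Lemma plane_wave_integral_leg (al beta : R) (nu z : R[i]) (phi : R) : 0 < al -> 0 < beta -> 0 < Re z ->
  let k := folded_wave al beta nu z phi in
  [/\ forall tau, mu.-integrable `]0, +oo[ (EFin \o k tau),
      mu.-integrable setT (EFin \o (fun tau => \int[mu]_(x in `]0, +oo[) k tau x)) &
      plane_wave_integral (al + beta) nu z phi = (Num.sqrt pi)^-1 * \int[mu]_tau \int[mu]_(x in `]0, +oo[) k tau x].
Proof.
move=> al0 be0 a0 k.
pose W k1 k2 sg tau x := leg_kernel tau x * \int[mu]_(u in `]0, +oo[) wave al beta (Re z) (Im z) k1 k2 sg phi tau x u.
have mD : measurable (`]0, +oo[%classic : set mR) by [].
have i1 tau : mu.-integrable `]0, +oo[ (EFin \o W (Re nu) (Im nu) 1 tau).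
  by have h := integrable_leg_wave (Im z) (Re nu) (Im nu) 1 phi al0 be0 a0 tau; exact: h.
have i2 tau : mu.-integrable `]0, +oo[ (EFin \o W (- Re nu) (- Im nu) (-1) tau).
  by have h := integrable_leg_wave (Im z) (- Re nu) (- Im nu) (-1) phi al0 be0 a0 tau; exact: h.
have [j1 e1] := integral_leg_wave (Im z) (Re nu) (Im nu) phi al0 be0 a0 (or_introl (erefl 1)).
have [j2 e2] := integral_leg_wave (Im z) (- Re nu) (- Im nu) phi al0 be0 a0 (or_intror (erefl (-1))).
have d1 := integrable_diagonal_wave (Im z) (Re nu) (Im nu) phi al0 be0 a0.
have d2 := integrable_diagonal_wave (Im z) (- Re nu) (- Im nu) phi al0 be0 a0.
have kE tau : \int[mu]_(x in `]0, +oo[) k tau x = (Num.sqrt pi)^-1 / 2 *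
   (\int[mu]_(x in `]0, +oo[) W (Re nu) (Im nu) 1 tau x + \int[mu]_(x in `]0, +oo[) W (- Re nu) (- Im nu) (-1) tau x).
  by rewrite -(RintegralD mD (i1 tau) (i2 tau)) -(RintegralZl _ mD (integrable_add mD (i1 tau) (i2 tau))).
split.
- by move=> tau; have h := integrable_scale mD ((Num.sqrt pi)^-1 / 2) (integrable_add mD (i1 tau) (i2 tau)); exact: h.
- rewrite (funext kE).
  by have h := integrable_scale measurableT ((Num.sqrt pi)^-1 / 2) (integrable_add measurableT j1 j2); exact: h.
- rewrite (funext kE) (RintegralZl _ measurableT (integrable_add measurableT j1 j2)) (RintegralD measurableT j1 j2) e1 e2.
  rewrite /plane_wave_integral (RintegralZl _ mD (integrable_add mD d1 d2)) (RintegralD mD d1 d2).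
  have pp : Num.sqrt (pi : R) ^+ 2 = pi by rewrite sqr_sqrtr// pi_ge0.
  have s0 : Num.sqrt (pi : R) != 0 by rewrite gt_eqF// sqrtr_gt0 pi_gt0.
  move: (\int[mu]_(u in _) _) (\int[mu]_(u in _) _) => I1 I2.
  by move: (Num.sqrt pi) pp s0 => s pp s0; rewrite -pp; field.
Qed.

End Assembly.

Lemma real_complexMl (R : realType) (k u v : R) : k%:C * (u +i* v) = (k * u) +i* (k * v).
Proof. by simpc. Qed.

Lemma mem_itv0y_gt0 (R : realType) (x : R) : x \in (`]0, +oo[%classic : set R) -> 0 < x.
Proof. by rewrite inE/= in_itv/= andbT. Qed.

Theorem theorem2 (R : realType) (alpha beta : R) (nu z : R[i])
    (halpha : 0 < alpha < 1) (hbeta : 0 < beta) (hz : z != 0)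
    (harg : 0 <= `|carg z| < (1 - alpha) * pi / 2%:R) :
  let integrand (tau x : R) : R[i] :=
    legendreP (2%:R^-1) (- 2%:R^-1 + 'i%C * tau%:C) (2%:R * x + 1)
      / ((x * (x + 1)) `^ (4%:R^-1))%:C
    * genK alpha (nu + 2%:R * 'i%C * tau%:C) (z * ((x + 1) `^ (beta / 2%:R))%:C) in
  [/\ forall tau : R, cintegrable `]0, +oo[ (integrand tau),
      cintegrable setT (fun tau => cintegral `]0, +oo[ (integrand tau)) &
      genK (alpha + beta) nu z =
        ((Num.sqrt pi)^-1)%:C *
        cintegral setT (fun tau => cintegral `]0, +oo[ (integrand tau))].
Proof.
move=> integrand; case/andP: halpha => al0 al1; case/andP: harg => _ harg1.
(* As alpha is positive, the sector lies in the open right half-plane. *)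
have a0 : 0 < Re z.
  apply: Re_carg_gt0 => //; apply: lt_trans harg1 _.
  by rewrite -mulrA gtr_pMl ?divr_gt0 ?pi_gt0//; lra.
have [i1 j1 e1] := plane_wave_integral_leg nu 0 al0 hbeta a0.
have [i2 j2 e2] := plane_wave_integral_leg nu (pi / 2) al0 hbeta a0.
have mD : measurable (`]0, +oo[%classic : set (measurableTypeR R)) by [].
(* The identification is made for x > 0, where the closed form of [legendreP] is available; this is
   the whole domain of integration. *)
have pt tau x : x \in (`]0, +oo[%classic : set R) ->
    Re (integrand tau x) = folded_wave alpha beta nu z 0 tau x /\
    Im (integrand tau x) = folded_wave alpha beta nu z (pi / 2) tau x.
  move=> x0; exact: (@integrand_ReIm R nu z beta tau x alpha al0 hbeta a0 (mem_itv0y_gt0 x0)).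
have cE : (fun tau => cintegral `]0, +oo[ (integrand tau)) = (fun tau =>
    (\int[lebesgue_measure]_(x in `]0, +oo[) folded_wave alpha beta nu z 0 tau x) +i*
    (\int[lebesgue_measure]_(x in `]0, +oo[) folded_wave alpha beta nu z (pi / 2) tau x)).
  by apply/funext => tau; congr (_ +i* _); apply: eq_Rintegral => x /(pt tau) [].
rewrite cE.
split.
- move=> tau; split.
  + apply: eq_integrable (i1 tau) => // x x0; congr EFin; exact/esym/(pt tau x x0).1.
  + apply: eq_integrable (i2 tau) => // x x0; congr EFin; exact/esym/(pt tau x x0).2.
- by split; [exact: j1|exact: j2].
- by rewrite genK_plane_wave e1 e2 -real_complexMl.
Qed.
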